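(* The elliptic minors $\xi_I^J(z)\in\mathcal{F}_{\mathrm{ell}}(M(n))$ satisfy the following for every $z\in\mathbb{C}^\times$. (i) Let $I_1,I_2,J\subseteq\{1,\dots,n\}$ and set $I=I_1\cup I_2$. Then $$S_l(I_1,I_2;\lambda)\,\xi_I^J(z)=\sum_{J_1\cup J_2=J}S_l(J_1,J_2;\rho)\,\xi_{I_1}^{J_1}(q^{2\#I_2}z)\,\xi_{I_2}^{J_2}(z).$$ (ii) Let $J_1,J_2,I\subseteq\{1,\dots,n\}$ and set $J=J_1\cup J_2$. Then $$S_r(J_1,J_2;\rho)\,\xi_I^J(z)=\sum_{I_1\cup I_2=I}S_r(I_1,I_2;\lambda)\,\xi_{I_1}^{J_1}(z)\,\xi_{I_2}^{J_2}(q^{2\#J_1}z).$$ The sums run over all pairs of subsets $(J_1,J_2)$, respectively $(I_1,I_2)$, of $\{1,\dots,n\}$ with the indicated union.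
   Context: **Parameters and functions.** $p,q$ are real, $0<p,q<1$, and generic: if $p^aq^b=1$ with $a,b\in\mathbb{Z}$ then $a=b=0$. $\theta(z)=\prod_{j\ge0}(1-zp^j)(1-p^{j+1}/z)$ for $z\in\mathbb{C}^\times$, and $E(s)=q^s\theta(q^{-2s})$ for $s\in\mathbb{C}$ (so $E(-s)=-E(s)$). $n$ is a positive integer, $[1,n]=\{1,\dots,n\}$. $\mathfrak{h}$ is the space of traceless diagonal complex $n\times n$ matrices, $\omega(i)\in\mathfrak{h}^*$ is $\omega(i)(\mathrm{diag}(h_1,\dots,h_n))=h_i$, and $\zeta_{ij}=\zeta(E_{ii}-E_{jj})$ for $\zeta\in\mathfrak{h}^*$. $M_{\mathfrak{h}^*}$ is the field of meromorphic functions on $\mathfrak{h}^*$. Put $$\alpha(s,z)=\frac{\theta(z)\theta(q^{2(s+1)})}{\theta(q^2z)\theta(q^{2s})},\qquad \beta(s,z)=\frac{\theta(q^2)\theta(q^{-2s}z)}{\theta(q^2z)\theta(q^{-2s})}.$$ **The algebra $\mathcal{F}_{\mathrm{ell}}(M(n))$.** It is the unital associative $\mathbb{C}$-algebra generated by $e_{ij}(z)$ ($i,j\in[1,n]$, $z\in\mathbb{C}^\times$) and two mutually commuting copies of the algebra $M_{\mathfrak{h}^*}$, with elements written $f(\lambda)$ and $f(\rho)$, with relations: $f(\lambda)e_{ij}(z)=e_{ij}(z)f(\lambda+\omega(i))$, $f(\rho)e_{ij}(z)=e_{ij}(z)f(\rho+\omega(j))$; and, for $a\ne c$, $b\ne d$,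 $k\in\mathbb{Z}$, and (in (2)-(4)) $z_1/z_2\notin p^{\mathbb{Z}}q^{-2}$: (1) $e_{ab}(z_1)e_{ab}(z_2)=e_{ab}(z_2)e_{ab}(z_1)$; (2) $e_{ab}(z_1)e_{ad}(z_2)=\alpha(\rho_{bd},\frac{z_1}{z_2})e_{ad}(z_2)e_{ab}(z_1)+\beta(\rho_{db},\frac{z_1}{z_2})e_{ab}(z_2)e_{ad}(z_1)$; (3) $\alpha(\lambda_{ac},\frac{z_1}{z_2})e_{ab}(z_1)e_{cb}(z_2)+\beta(\lambda_{ac},\frac{z_1}{z_2})e_{cb}(z_1)e_{ab}(z_2)=e_{cb}(z_2)e_{ab}(z_1)$; (4) $\alpha(\lambda_{ac},\frac{z_1}{z_2})e_{ab}(z_1)e_{cd}(z_2)+\beta(\lambda_{ac},\frac{z_1}{z_2})e_{cb}(z_1)e_{ad}(z_2)=\alpha(\rho_{bd},\frac{z_1}{z_2})e_{cd}(z_2)e_{ab}(z_1)+\beta(\rho_{db},\frac{z_1}{z_2})e_{cb}(z_2)e_{ad}(z_1)$; (5) $\alpha(\lambda_{ac},q^2)\big(e_{ab}(z)e_{cd}(p^kq^2z)-q^{2k\lambda_{ca}}e_{cb}(z)e_{ad}(p^kq^2z)\big)=\alpha(\rho_{bd},q^2)e_{cd}(p^kq^2z)e_{ab}(z)-q^{2k\rho_{bd}}\beta(\rho_{bd},q^2)e_{cb}(p^kq^2z)e_{ad}(z)$. Here e.g. $\alpha(\lambda_{ac},z)$ is the image of the function $\zeta\mapsto\alpha(\zeta_{ac},z)$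 in the $\lambda$-copy of $M_{\mathfrak{h}^*}$. **Minors.** For $I\subseteq[1,n]$ put $F_I(\zeta)=\prod_{i<j;\,i,j\in I}E(\zeta_{ij}+1)$, $F^I(\zeta)=\prod_{i<j;\,i,j\in I}E(\zeta_{ij})$. If $\#I\neq\#J$ then $\xi_I^J(z)=0$. If $I=\{i_1<\dots<i_d\}$, $J=\{j_1<\dots<j_d\}$ then $$\xi_I^J(z)=\frac{F^J(\rho)}{F^I(\lambda)}\sum_{\sigma\in S_I}\mathrm{sgn}(\sigma)\,e_{\sigma(i_1)j_1}(z)e_{\sigma(i_2)j_2}(q^2z)\cdots e_{\sigma(i_d)j_d}(q^{2(d-1)}z),$$ which also equals $$\frac{F_J(\rho)}{F_I(\lambda)}\sum_{\tau\in S_J}\Big(\prod_{i<j;\,i,j\in J;\,\tau(i)>\tau(j)}\frac{E(\rho_{\tau(i)\tau(j)}+1)}{E(\rho_{\tau(j)\tau(i)}+1)}\Big)e_{i_d\tau(j_d)}(q^{2(d-1)}z)\cdots e_{i_1\tau(j_1)}(z)$$ ($S_I,S_J$ are the groups of permutations of $I,J$; $\xi_\emptyset^\emptyset(z)=1$). **Signums.** $S_l(I,J;\zeta)=S_r(I,J;\zeta)=0$ if $I\cap J\neq\emptyset$; if $I\cap J=\emptyset$, $$S_l(I,J;\zeta)=\prod_{i\in I,\,j\in J}E(\zeta_{ji}+1),\qquad S_r(I,J;\zeta)=\prod_{i\in I,\,j\in J}E(\zeta_{ij})^{-1}.$$ *)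

(* Defs.v *)
From HB Require Import structures.
From mathcomp Require Import all_boot all_order all_algebra.
From mathcomp Require Import perm.
From mathcomp Require Import complex.
From mathcomp Require Import all_classical all_reals all_analysis.

Set Implicit Arguments.
Unset Strict Implicit.
Unset Printing Implicit Defensive.

Import Order.TTheory GRing.Theory Num.Theory.
Import numFieldNormedType.Exports.
Import VectorInternalTheory.

Local Open Scope classical_set_scope.
Local Open Scope ring_scope.
Local Open Scope complex_scope.
Local Open Scope quotient_scope.

(* The topology and the norm of the complex numbers, taken from those of the
   one-dimensional normed module R[i]^o. *)
HB.instance Definition _ (R : realType) := NormedModule.copy R[i] R[i]^o.

Section Meromorphic.
Variables (R : realType) (V : vectType R[i]).

(* The topology and the complex structure of V are transported along the linear
   bijection r2v : 'rV[R[i]]_(dim V) -> V; any other linear coordinates would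
   give the same notions.  [differentiable] is Frechet differentiability over
   R[i], so on an open set it is holomorphy. *)
Definition holomorphic_on (U : set 'rV[R[i]]_(dim V))
    (g : 'rV[R[i]]_(dim V) -> R[i]) : Prop :=
  forall x, U x -> differentiable g x.

(* f is, near every point, a quotient g / h of holomorphic functions, where h
   vanishes identically on no nonempty open set.  The values of f at the zeros
   of h are irrelevant; see [mero_eq]. *)
Definition meromorphic (f : V -> R[i]) : Prop :=
  forall x, exists (U : set 'rV[R[i]]_(dim V))
                   (g h : 'rV[R[i]]_(dim V) -> R[i]),
    [/\ open U /\ U x, holomorphic_on U g, holomorphic_on U h,
        forall O, open O -> O !=set0 -> O `<=` U -> exists2 y, O y & h y != 0 &
        forall y, U y -> h y != 0 -> f (r2v y) = g y / h y].

(* Two representatives define the same meromorphic function when they agree on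
   a dense open set. *)
Definition mero_eq (f g : V -> R[i]) : Prop :=
  exists D : set 'rV[R[i]]_(dim V),
    [/\ open D, dense D & forall y, D y -> f (r2v y) = g (r2v y)].

Lemma mero_eq_refl f : mero_eq f f.
Proof.
exists setT; split=> //; first exact: openT.
by move=> O [y Oy] _; exists y.
Qed.

Lemma mero_eq_sym f g : mero_eq f g -> mero_eq g f.
Proof. by move=> [D [oD dD eD]]; exists D; split=> // y /eD. Qed.

Lemma mero_eq_op2 (op : R[i] -> R[i] -> R[i]) f f' g g' :
  mero_eq f f' -> mero_eq g g' ->
  mero_eq (fun x => op (f x) (g x)) (fun x => op (f' x) (g' x)).
Proof.
move=> [D [oD dD eD]] [D' [oD' dD' eD']]; exists (D `&` D').
by split=> [||y [/eD-> /eD'->]//]; [exact: openI | exact: denseI].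
Qed.

Lemma mero_eq_trans g f h : mero_eq f g -> mero_eq g h -> mero_eq f h.
Proof.
move=> [D [oD dD eD]] [D' [oD' dD' eD']]; exists (D `&` D').
by split=> [||y [/eD-> /eD'->]//]; [exact: openI | exact: denseI].
Qed.

Lemma meromorphic_cst c : meromorphic (fun=> c).
Proof.
move=> x; exists setT, (fun=> c), (fun=> 1); split.
- by split=> //; exact: openT.
- by move=> y _; exact: differentiable_cst.
- by move=> y _; exact: differentiable_cst.
- by move=> O _ [y Oy] _; exists y => //; exact: oner_neq0.
- by move=> y _ _; rewrite divr1.
Qed.

Lemma holomorphic_neq0_open (U O : set 'rV[R[i]]_(dim V)) h y :
  holomorphic_on U h -> open O -> O `<=` U -> O y -> h y != 0 ->
  exists W, [/\ open W, W y, W `<=` O & forall z, W z -> h z != 0].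
Proof.
move=> hU oO OU Oy hy.
have /(_ [set c : R[i] | c != 0]) := differentiable_continuous (hU _ (OU _ Oy)).
have op0 : open [set c : R[i] | c != 0].
  rewrite (_ : [set _ | _] = ~` [set (0 : R[i])]).
    apply: closed_openC; apply: accessible_closed_set1.
    by apply: hausdorff_accessible; exact: norm_hausdorff.
  by apply/seteqP; split=> c /= /eqP.
move=> /(_ (open_nbhs_nbhs (conj op0 hy))) hnb.
have : nbhs y (O `&` [set z | h z != 0]).
  by apply: filterI; [exact: open_nbhs_nbhs | exact: hnb].
rewrite nbhsE => -[W [oW Wy] WO]; exists W; split=> //.
- by move=> z /WO[].
- by move=> z /WO[].
Qed.

Lemma nonvanishing_mul (U1 U2 : set 'rV[R[i]]_(dim V)) h1 h2 :
  holomorphic_on U1 h1 ->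
  (forall O, open O -> O !=set0 -> O `<=` U1 -> exists2 y, O y & h1 y != 0) ->
  (forall O, open O -> O !=set0 -> O `<=` U2 -> exists2 y, O y & h2 y != 0) ->
  forall O, open O -> O !=set0 -> O `<=` U1 `&` U2 ->
    exists2 y, O y & h1 y * h2 y != 0.
Proof.
move=> hh1 n1 n2 O oO O0 OU.
have OU1 : O `<=` U1 by move=> z /OU[].
have [y Oy h1y] := n1 O oO O0 OU1.
have [W [oW Wy WO nW]] := holomorphic_neq0_open hh1 oO OU1 Oy h1y.
have [] := n2 W oW (ex_intro _ y Wy); first by move=> z /WO/OU[].
by move=> z Wz h2z; exists z; [exact: WO | rewrite mulf_neq0 ?nW].
Qed.

Lemma meromorphic_sub f1 f2 :
  meromorphic f1 -> meromorphic f2 -> meromorphic (fun x => f1 x - f2 x).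
Proof.
move=> m1 m2 x.
have [U1 [g1 [h1 [[oU1 U1x] dg1 dh1 n1 e1]]]] := m1 x.
have [U2 [g2 [h2 [[oU2 U2x] dg2 dh2 n2 e2]]]] := m2 x.
exists (U1 `&` U2), ((g1 * h2) \- (g2 * h1)), (h1 * h2); split.
- by split=> //; exact: openI.
- move=> y [U1y U2y].
  by apply: differentiableB; apply: differentiableM; auto.
- by move=> y [U1y U2y]; apply: differentiableM; auto.
- exact: nonvanishing_mul dh1 n1 n2.
- move=> y [U1y U2y]; rewrite /= mulf_eq0 negb_or => /andP[h1y h2y].
  by rewrite e1 // e2 // -mulNr addf_div // mulNr.
Qed.

Lemma meromorphic_mul f1 f2 :
  meromorphic f1 -> meromorphic f2 -> meromorphic (fun x => f1 x * f2 x).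
Proof.
move=> m1 m2 x.
have [U1 [g1 [h1 [[oU1 U1x] dg1 dh1 n1 e1]]]] := m1 x.
have [U2 [g2 [h2 [[oU2 U2x] dg2 dh2 n2 e2]]]] := m2 x.
exists (U1 `&` U2), (g1 * g2), (h1 * h2); split.
- by split=> //; exact: openI.
- by move=> y [U1y U2y]; apply: differentiableM; auto.
- by move=> y [U1y U2y]; apply: differentiableM; auto.
- exact: nonvanishing_mul dh1 n1 n2.
- move=> y [U1y U2y]; rewrite /= mulf_eq0 negb_or => /andP[h1y h2y].
  by rewrite e1 // e2 // mulf_div.
Qed.

Lemma meromorphic_opp f : meromorphic f -> meromorphic (fun x => - f x).
Proof.
move=> mf; rewrite (_ : (fun x => _) = fun x => 0 - f x).
  exact: meromorphic_sub (meromorphic_cst 0) mf.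
by apply/funext => x; rewrite sub0r.
Qed.

Lemma meromorphic_add f1 f2 :
  meromorphic f1 -> meromorphic f2 -> meromorphic (fun x => f1 x + f2 x).
Proof.
move=> m1 m2; rewrite (_ : (fun x => _) = fun x => f1 x - - f2 x).
  exact: meromorphic_sub m1 (meromorphic_opp m2).
by apply/funext => x; rewrite opprK.
Qed.

Record mero_fun := MeroFun {
  mero_val :> V -> R[i];
  mero_valP : meromorphic mero_val }.

HB.instance Definition _ := gen_eqMixin mero_fun.
HB.instance Definition _ := gen_choiceMixin mero_fun.

Definition mero_rel : rel mero_fun := fun f g => `[< mero_eq f g >].

Lemma mero_rel_equiv : equiv_class_of mero_rel.
Proof.
split=> [f|f g|g f h]; rewrite /mero_rel.
- by apply/asboolP; exact: mero_eq_refl.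
- by apply/asboolP/asboolP; exact: mero_eq_sym.
- by move=> /asboolP fg /asboolP gh; apply/asboolP; exact: mero_eq_trans fg gh.
Qed.

Canonical mero_equiv := EquivRelPack mero_rel_equiv.

(* The ring of meromorphic functions on V; it is in fact a field. *)
Definition mero := {eq_quot mero_equiv}.
HB.instance Definition _ := Choice.on mero.
HB.instance Definition _ := EqQuotient.on mero.

Lemma mero_piE (f g : mero_fun) : mero_eq f g -> \pi_mero f = \pi_mero g.
Proof. by move=> fg; apply/eqmodP/asboolP. Qed.

Lemma mero_reprE (f : mero_fun) : mero_eq (repr (\pi_mero f)) f.
Proof. by apply/asboolP; rewrite -/(mero_rel _ _); apply/eqmodP; rewrite reprK. Qed.

Definition mcst (c : R[i]) : mero := \pi_mero (MeroFun (meromorphic_cst c)).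
Definition madd (a b : mero) : mero :=
  \pi_mero (MeroFun (meromorphic_add (mero_valP (repr a)) (mero_valP (repr b)))).
Definition mopp (a : mero) : mero :=
  \pi_mero (MeroFun (meromorphic_opp (mero_valP (repr a)))).
Definition mmul (a b : mero) : mero :=
  \pi_mero (MeroFun (meromorphic_mul (mero_valP (repr a)) (mero_valP (repr b)))).

Lemma madd_pi f g (mf : meromorphic f) (mg : meromorphic g) :
  madd (\pi_mero (MeroFun mf)) (\pi_mero (MeroFun mg))
  = \pi_mero (MeroFun (meromorphic_add mf mg)).
Proof. by apply: mero_piE; apply: (mero_eq_op2 +%R); exact: mero_reprE. Qed.

Lemma mmul_pi f g (mf : meromorphic f) (mg : meromorphic g) :
  mmul (\pi_mero (MeroFun mf)) (\pi_mero (MeroFun mg))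
  = \pi_mero (MeroFun (meromorphic_mul mf mg)).
Proof. by apply: mero_piE; apply: (mero_eq_op2 *%R); exact: mero_reprE. Qed.

Lemma mopp_pi f (mf : meromorphic f) :
  mopp (\pi_mero (MeroFun mf)) = \pi_mero (MeroFun (meromorphic_opp mf)).
Proof.
apply: mero_piE => /=; have mr := mero_reprE (MeroFun mf).
exact: (mero_eq_op2 (fun c _ => - c) mr mr).
Qed.

Lemma mero_pi_ext f g (mf : meromorphic f) (mg : meromorphic g) :
  f =1 g -> \pi_mero (MeroFun mf) = \pi_mero (MeroFun mg).
Proof. by move=> /funext fg; apply: mero_piE; rewrite /= fg; exact: mero_eq_refl. Qed.

Lemma mero_ind (P : mero -> Prop) :
  (forall f (mf : meromorphic f), P (\pi_mero (MeroFun mf))) -> forall a, P a.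
Proof. by move=> IH a; rewrite -[a]reprK; case: (repr a) => f mf; exact: IH. Qed.

Lemma maddA : associative madd.
Proof.
elim/mero_ind=> f mf; elim/mero_ind=> g mg; elim/mero_ind=> h mh.
by rewrite !madd_pi; apply: mero_pi_ext => x; rewrite addrA.
Qed.

Lemma maddC : commutative madd.
Proof.
elim/mero_ind=> f mf; elim/mero_ind=> g mg.
by rewrite !madd_pi; apply: mero_pi_ext => x; rewrite addrC.
Qed.

Lemma madd0 : left_id (mcst 0) madd.
Proof.
by elim/mero_ind=> f mf; rewrite madd_pi; apply: mero_pi_ext => x; rewrite add0r.
Qed.

Lemma maddN : left_inverse (mcst 0) mopp madd.
Proof.
elim/mero_ind=> f mf.
by rewrite mopp_pi madd_pi; apply: mero_pi_ext => x; rewrite addNr.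
Qed.

HB.instance Definition _ :=
  GRing.isZmodule.Build mero maddA maddC madd0 maddN.

Lemma mmulA : associative mmul.
Proof.
elim/mero_ind=> f mf; elim/mero_ind=> g mg; elim/mero_ind=> h mh.
by rewrite !mmul_pi; apply: mero_pi_ext => x; rewrite mulrA.
Qed.

Lemma mmulC : commutative mmul.
Proof.
elim/mero_ind=> f mf; elim/mero_ind=> g mg.
by rewrite !mmul_pi; apply: mero_pi_ext => x; rewrite mulrC.
Qed.

Lemma mmul1 : left_id (mcst 1) mmul.
Proof.
by elim/mero_ind=> f mf; rewrite mmul_pi; apply: mero_pi_ext => x; rewrite mul1r.
Qed.

Lemma mmulDl : left_distributive mmul +%R.
Proof.
elim/mero_ind=> f mf; elim/mero_ind=> g mg; elim/mero_ind=> h mh.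
rewrite /GRing.add /= !(madd_pi, mmul_pi).
by apply: mero_pi_ext => x; rewrite mulrDl.
Qed.

Lemma mone_neq0 : mcst 1 != 0.
Proof.
apply/eqP => /eqmodP /asboolP [D [_ dD eD]].
have [y [_ /eD /eqP]] := dD setT (ex_intro _ 0 I) openT.
by rewrite /= oner_eq0.
Qed.

HB.instance Definition _ :=
  GRing.Zmodule_isComNzRing.Build mero mmulA mmulC mmul1 mmulDl mone_neq0.

(* The meromorphic function represented by f; the value 0 for an f that is not
   meromorphic is a dummy. *)
Definition mer (f : V -> R[i]) : mero :=
  if pselect (meromorphic f) is left mf then \pi_mero (MeroFun mf) else 0.

Lemma merE f (mf : meromorphic f) : mer f = \pi_mero (MeroFun mf).
Proof. by rewrite /mer; case: pselect => // mf'; exact: mero_pi_ext. Qed.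

Lemma mer_cst c : mer (fun=> c) = mcst c.
Proof. exact: merE. Qed.

Lemma merD f g : meromorphic f -> meromorphic g ->
  mer (fun x => f x + g x) = mer f + mer g.
Proof.
by move=> mf mg; rewrite (merE mf) (merE mg) [RHS]madd_pi; exact: merE.
Qed.

Lemma merM f g : meromorphic f -> meromorphic g ->
  mer (fun x => f x * g x) = mer f * mer g.
Proof.
by move=> mf mg; rewrite (merE mf) (merE mg) [RHS]mmul_pi; exact: merE.
Qed.

End Meromorphic.

Section Theta.
Variable R : realType.
Local Notation C := R[i].

(* exp (x + i y) = e^x (cos y + i sin y) *)
Definition cexp (z : C) : C :=
  (expR (complex.Re z))%:C * (cos (complex.Im z) +i* sin (complex.Im z)).

(* q^s for real q > 0 and complex s *)
Definition qpow (q : R) (s : C) : C := cexp ((ln q)%:C * s).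

Definition theta (p : R) (z : C) : C :=
  lim ((fun N : nat =>
          \prod_(0 <= j < N) ((1 - z * p%:C ^+ j) * (1 - p%:C ^+ j.+1 / z)))
       @ \oo).

Definition E (p q : R) (s : C) : C := qpow q s * theta p (qpow q (- 2 * s)).

Definition alpha (p q : R) (s z : C) : C :=
  (theta p z * theta p (qpow q (2 * (s + 1)))) /
  (theta p (q%:C ^+ 2 * z) * theta p (qpow q (2 * s))).

Definition beta (p q : R) (s z : C) : C :=
  (theta p (q%:C ^+ 2) * theta p (qpow q (- 2 * s) * z)) /
  (theta p (q%:C ^+ 2 * z) * theta p (qpow q (- 2 * s))).

End Theta.

Section Cartan.
Variables (R : realType) (n : nat).
Local Notation C := R[i].

(* The traceless matrices in the image of diag_mx; see [mem_cartan]. *)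
Definition cartan : {vspace 'M[C]_n} :=
  (limg (linfun (@diag_mx C n)) :&:
   lker (linfun (@mxtrace C n : 'M[C]_n -> C^o)))%VS.

Lemma mem_cartan (A : 'M[C]_n) :
  (A \in cartan) = is_diag_mx A && (\tr A == 0).
Proof.
rewrite memv_cap memv_ker lfunE /=; congr andb; apply/idP/idP.
  by move=> /memv_imgP[d _ ->]; rewrite lfunE /=; exact: diag_mx_is_diag.
move=> /is_diag_mxP AE.
have -> : A = diag_mx (\row_i A i i).
  apply/matrixP => i j; rewrite !mxE; have [->|ij] := eqVneq i j.
    by rewrite mulr1n.
  by rewrite mulr0n AE.
have := memv_img (linfun (@diag_mx C n)) (memvf (\row_i A i i)).
by rewrite lfunE.
Qed.

Definition hdual := 'Hom(subvs_of cartan, C^o).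
HB.instance Definition _ := Vector.on hdual.

Definition omega (i : 'I_n) : hdual :=
  linfun (fun h : subvs_of cartan => vsval h i i : C^o).

Lemma delta_sub_cartan (i j : 'I_n) :
  (delta_mx i i - delta_mx j j : 'M[C]_n) \in cartan.
Proof.
rewrite mem_cartan; apply/andP; split.
  apply/is_diag_mxP => k l kl; rewrite !mxE.
  have nkl a : (k == a) && (l == a) = false.
    by apply/negP => /andP[/eqP ka /eqP la]; rewrite ka la eqxx in kl.
  by rewrite !nkl subr0.
have tr1 (a : 'I_n) : \tr (delta_mx a a : 'M[C]_n) = 1.
  rewrite /mxtrace (bigD1 a) //= big1 => [|k ka]; rewrite !mxE ?eqxx ?addr0 //.
  by rewrite (negPf ka).
by rewrite raddfB /= !tr1 subrr.
Qed.

(* zeta (E_ii - E_jj); by [delta_sub_cartan] and [vsprojK], vsproj is only a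
   coercion into the subtype here. *)
Definition zpair (zeta : hdual) (i j : 'I_n) : C :=
  zeta (vsproj cartan (delta_mx i i - delta_mx j j)).

End Cartan.

Section Fell.
Variables (R : realType) (n : nat) (p q : R).
Local Notation C := R[i].
Local Notation V := (hdual R n).
Local Notation M := (mero V).

Definition Cstar := {z : C | z != 0}.

(* Terms of the free algebra on e_ij(z), f(lambda), f(rho). *)
Inductive fexpr : Type :=
| Xgen of 'I_n & 'I_n & Cstar
| Xlam of M
| Xrho of M
| Xcst of C
| Xadd of fexpr & fexpr
| Xmul of fexpr & fexpr.

(* e_ij(z) for z in C^*; the value 0 at z = 0 is a dummy. *)
Definition Xe (i j : 'I_n) (z : C) : fexpr :=
  if insub z is Some u then Xgen i j u else Xcst 0.

Definition Xsub (x y : fexpr) : fexpr := Xadd x (Xmul (Xcst (-1)) y).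

Definition alpha_lam a c z : fexpr :=
  Xlam (mer (fun zeta => alpha p q (zpair zeta a c) z)).
Definition alpha_rho b d z : fexpr :=
  Xrho (mer (fun zeta => alpha p q (zpair zeta b d) z)).
Definition beta_lam a c z : fexpr :=
  Xlam (mer (fun zeta => beta p q (zpair zeta a c) z)).
Definition beta_rho b d z : fexpr :=
  Xrho (mer (fun zeta => beta p q (zpair zeta b d) z)).

(* z1 / z2 is not in p^Z q^-2 *)
Definition regular_ratio (z1 z2 : C) : Prop :=
  forall k : int, z1 / z2 != p%:C ^ k * q%:C ^ (- 2 : int).

Local Notation "x [+] y" := (Xadd x y) (at level 50, left associativity).
Local Notation "x [-] y" := (Xsub x y) (at level 50, left associativity).
Local Notation "x [*] y" := (Xmul x y) (at level 40, left associativity).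

(* The first seven relations say that the two copies of the algebra of
   meromorphic functions are algebra morphisms and commute with each other. *)
Inductive fell_rel : fexpr -> fexpr -> Prop :=
| rel_lamD f g : fell_rel (Xlam (f + g)) (Xlam f [+] Xlam g)
| rel_lamM f g : fell_rel (Xlam (f * g)) (Xlam f [*] Xlam g)
| rel_lam_cst c : fell_rel (Xlam (mcst V c)) (Xcst c)
| rel_rhoD f g : fell_rel (Xrho (f + g)) (Xrho f [+] Xrho g)
| rel_rhoM f g : fell_rel (Xrho (f * g)) (Xrho f [*] Xrho g)
| rel_rho_cst c : fell_rel (Xrho (mcst V c)) (Xcst c)
| rel_lam_rho f g : fell_rel (Xlam f [*] Xrho g) (Xrho g [*] Xlam f)
| rel_lam_e i j z f : z != 0 -> meromorphic f ->
    fell_rel (Xlam (mer f) [*] Xe i j z)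
             (Xe i j z [*] Xlam (mer (fun zeta => f (zeta + omega R i))))
| rel_rho_e i j z f : z != 0 -> meromorphic f ->
    fell_rel (Xrho (mer f) [*] Xe i j z)
             (Xe i j z [*] Xrho (mer (fun zeta => f (zeta + omega R j))))
| rel1 a b z1 z2 : z1 != 0 -> z2 != 0 ->
    fell_rel (Xe a b z1 [*] Xe a b z2) (Xe a b z2 [*] Xe a b z1)
| rel2 a b d z1 z2 : z1 != 0 -> z2 != 0 -> b != d -> regular_ratio z1 z2 ->
    fell_rel
      (Xe a b z1 [*] Xe a d z2)
      (alpha_rho b d (z1 / z2) [*] Xe a d z2 [*] Xe a b z1
       [+] beta_rho d b (z1 / z2) [*] Xe a b z2 [*] Xe a d z1)
| rel3 a b c z1 z2 : z1 != 0 -> z2 != 0 -> a != c -> regular_ratio z1 z2 ->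
    fell_rel
      (alpha_lam a c (z1 / z2) [*] Xe a b z1 [*] Xe c b z2
       [+] beta_lam a c (z1 / z2) [*] Xe c b z1 [*] Xe a b z2)
      (Xe c b z2 [*] Xe a b z1)
| rel4 a b c d z1 z2 : z1 != 0 -> z2 != 0 -> a != c -> b != d ->
    regular_ratio z1 z2 ->
    fell_rel
      (alpha_lam a c (z1 / z2) [*] Xe a b z1 [*] Xe c d z2
       [+] beta_lam a c (z1 / z2) [*] Xe c b z1 [*] Xe a d z2)
      (alpha_rho b d (z1 / z2) [*] Xe c d z2 [*] Xe a b z1
       [+] beta_rho d b (z1 / z2) [*] Xe c b z2 [*] Xe a d z1)
| rel5 a b c d z (k : int) : z != 0 -> a != c -> b != d ->
    let w := p%:C ^ k * q%:C ^+ 2 * z in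
    fell_rel
      (alpha_lam a c (q%:C ^+ 2) [*]
         (Xe a b z [*] Xe c d w
          [-] Xlam (mer (fun zeta => qpow q (2 * k%:~R * zpair zeta c a)))
             [*] Xe c b z [*] Xe a d w))
      (alpha_rho b d (q%:C ^+ 2) [*] Xe c d w [*] Xe a b z
       [-] Xrho (mer (fun zeta => qpow q (2 * k%:~R * zpair zeta b d)))
          [*] beta_rho b d (q%:C ^+ 2) [*] Xe c b w [*] Xe a d z).

(* The congruence of unital associative R[i]-algebras generated by fell_rel. *)
Inductive fell_eqv : fexpr -> fexpr -> Prop :=
| eqv_rel x y : fell_rel x y -> fell_eqv x y
| eqv_refl x : fell_eqv x x
| eqv_sym x y : fell_eqv x y -> fell_eqv y x
| eqv_trans x y z : fell_eqv x y -> fell_eqv y z -> fell_eqv x z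
| eqv_add x x' y y' :
    fell_eqv x x' -> fell_eqv y y' -> fell_eqv (x [+] y) (x' [+] y')
| eqv_mul x x' y y' :
    fell_eqv x x' -> fell_eqv y y' -> fell_eqv (x [*] y) (x' [*] y')
| eqv_addA x y z : fell_eqv (x [+] (y [+] z)) (x [+] y [+] z)
| eqv_addC x y : fell_eqv (x [+] y) (y [+] x)
| eqv_add0 x : fell_eqv (Xcst 0 [+] x) x
| eqv_addN x : fell_eqv (Xcst (-1) [*] x [+] x) (Xcst 0)
| eqv_mulA x y z : fell_eqv (x [*] (y [*] z)) (x [*] y [*] z)
| eqv_mul1l x : fell_eqv (Xcst 1 [*] x) x
| eqv_mul1r x : fell_eqv (x [*] Xcst 1) x
| eqv_mulDl x y z : fell_eqv ((x [+] y) [*] z) (x [*] z [+] y [*] z)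
| eqv_mulDr x y z : fell_eqv (x [*] (y [+] z)) (x [*] y [+] x [*] z)
| eqv_cstD c d : fell_eqv (Xcst (c + d)) (Xcst c [+] Xcst d)
| eqv_cstM c d : fell_eqv (Xcst (c * d)) (Xcst c [*] Xcst d)
| eqv_cst_central c x : fell_eqv (Xcst c [*] x) (x [*] Xcst c).

HB.instance Definition _ := gen_eqMixin fexpr.
HB.instance Definition _ := gen_choiceMixin fexpr.

Definition fell_eqvb : rel fexpr := fun x y => `[< fell_eqv x y >].

Lemma fell_eqvb_equiv : equiv_class_of fell_eqvb.
Proof.
split=> [x|x y|x y z]; rewrite /fell_eqvb.
- by apply/asboolP; exact: eqv_refl.
- by apply/asboolP/asboolP; exact: eqv_sym.
- by move=> /asboolP xy /asboolP yz; apply/asboolP; exact: eqv_trans xy yz.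
Qed.

Canonical fell_equiv := EquivRelPack fell_eqvb_equiv.

(* The algebra F_ell(M(n)). *)
Definition fell := {eq_quot fell_equiv}.
HB.instance Definition _ := Choice.on fell.
HB.instance Definition _ := EqQuotient.on fell.

Lemma fell_piE (x y : fexpr) : fell_eqv x y -> \pi_fell x = \pi_fell y.
Proof. by move=> xy; apply/eqmodP/asboolP. Qed.

Lemma fell_pi_inj (x y : fexpr) : \pi_fell x = \pi_fell y -> fell_eqv x y.
Proof. by move=> /eqmodP /asboolP. Qed.

Lemma fell_reprE (x : fexpr) : fell_eqv (repr (\pi_fell x)) x.
Proof. by apply: fell_pi_inj; rewrite reprK. Qed.

Definition fell_add (x y : fell) : fell := \pi_fell (repr x [+] repr y).
Definition fell_mul (x y : fell) : fell := \pi_fell (repr x [*] repr y).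
Definition fell_cst (c : C) : fell := \pi_fell (Xcst c).

Lemma fell_add_pi x y :
  fell_add (\pi_fell x) (\pi_fell y) = \pi_fell (x [+] y).
Proof. by apply: fell_piE; apply: eqv_add; exact: fell_reprE. Qed.

Lemma fell_mul_pi x y :
  fell_mul (\pi_fell x) (\pi_fell y) = \pi_fell (x [*] y).
Proof. by apply: fell_piE; apply: eqv_mul; exact: fell_reprE. Qed.

Lemma fell_ind (P : fell -> Prop) : (forall x, P (\pi_fell x)) -> forall a, P a.
Proof. by move=> IH a; rewrite -[a]reprK. Qed.

Let fellE := (fell_add_pi, fell_mul_pi).

Lemma fell_addA : associative fell_add.
Proof.
elim/fell_ind=> x; elim/fell_ind=> y; elim/fell_ind=> z.
by rewrite !fellE; apply: fell_piE; exact: eqv_addA.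
Qed.

Lemma fell_addC : commutative fell_add.
Proof.
elim/fell_ind=> x; elim/fell_ind=> y.
by rewrite !fellE; apply: fell_piE; exact: eqv_addC.
Qed.

Lemma fell_add0 : left_id (fell_cst 0) fell_add.
Proof.
by elim/fell_ind=> x; rewrite !fellE; apply: fell_piE; exact: eqv_add0.
Qed.

Lemma fell_addN :
  left_inverse (fell_cst 0) (fell_mul (fell_cst (-1))) fell_add.
Proof.
by elim/fell_ind=> x; rewrite /fell_cst !fellE; apply: fell_piE; exact: eqv_addN.
Qed.

HB.instance Definition _ :=
  GRing.isZmodule.Build fell fell_addA fell_addC fell_add0 fell_addN.

Lemma fell_mulA : associative fell_mul.
Proof.
elim/fell_ind=> x; elim/fell_ind=> y; elim/fell_ind=> z.
by rewrite !fellE; apply: fell_piE; exact: eqv_mulA.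
Qed.

Lemma fell_mul1l : left_id (fell_cst 1) fell_mul.
Proof.
by elim/fell_ind=> x; rewrite !fellE; apply: fell_piE; exact: eqv_mul1l.
Qed.

Lemma fell_mul1r : right_id (fell_cst 1) fell_mul.
Proof.
by elim/fell_ind=> x; rewrite !fellE; apply: fell_piE; exact: eqv_mul1r.
Qed.

Lemma fell_mulDl : left_distributive fell_mul +%R.
Proof.
elim/fell_ind=> x; elim/fell_ind=> y; elim/fell_ind=> z.
by rewrite /GRing.add /= !fellE; apply: fell_piE; exact: eqv_mulDl.
Qed.

Lemma fell_mulDr : right_distributive fell_mul +%R.
Proof.
elim/fell_ind=> x; elim/fell_ind=> y; elim/fell_ind=> z.
by rewrite /GRing.add /= !fellE; apply: fell_piE; exact: eqv_mulDr.
Qed.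

(* The algebra is not zero: e_ij(z) |-> 0, f(lambda) |-> f, f(rho) |-> f is
   compatible with the relations. *)
Fixpoint fell_eval (x : fexpr) : M :=
  match x with
  | Xgen _ _ _ => 0
  | Xlam f => f
  | Xrho f => f
  | Xcst c => mcst V c
  | Xadd x y => fell_eval x + fell_eval y
  | Xmul x y => fell_eval x * fell_eval y
  end.

Lemma mcst0 : mcst V 0 = 0. Proof. by []. Qed.
Lemma mcst1 : mcst V 1 = 1. Proof. by []. Qed.

Lemma mcstD c d : mcst V (c + d) = mcst V c + mcst V d.
Proof. by rewrite [RHS]madd_pi; exact: mero_pi_ext. Qed.

Lemma mcstM c d : mcst V (c * d) = mcst V c * mcst V d.
Proof. by rewrite [RHS]mmul_pi; exact: mero_pi_ext. Qed.

Lemma fell_evalXe i j z : fell_eval (Xe i j z) = 0.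
Proof. by rewrite /Xe; case: insubP. Qed.

Lemma fell_evalM x y : fell_eval (x [*] y) = fell_eval x * fell_eval y.
Proof. by []. Qed.

Lemma fell_evalD x y : fell_eval (x [+] y) = fell_eval x + fell_eval y.
Proof. by []. Qed.

Lemma fell_eval_mule x i j z : fell_eval (x [*] Xe i j z) = 0.
Proof. by rewrite fell_evalM fell_evalXe mulr0. Qed.

Lemma fell_eval_emul x i j z : fell_eval (Xe i j z [*] x) = 0.
Proof. by rewrite fell_evalM fell_evalXe mul0r. Qed.

Lemma fell_eval_sub0 x y :
  fell_eval x = 0 -> fell_eval y = 0 -> fell_eval (x [-] y) = 0.
Proof. by move=> x0 y0; rewrite fell_evalD fell_evalM x0 y0 mulr0 addr0. Qed.

Lemma fell_eval_add0 x y :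
  fell_eval x = 0 -> fell_eval y = 0 -> fell_eval (x [+] y) = 0.
Proof. by move=> x0 y0; rewrite fell_evalD x0 y0 addr0. Qed.

Lemma fell_eval_rel x y : fell_rel x y -> fell_eval x = fell_eval y.
Proof.
case=> [f g|f g|c|f g|f g|c|f g|i j z f _ _|i j z f _ _|a b z1 z2 _ _
       |a b d z1 z2 _ _ _ _|a b c z1 z2 _ _ _ _|a b c d z1 z2 _ _ _ _ _
       |a b c d z k _ _ _ w].
- exact: erefl.
- exact: erefl.
- exact: erefl.
- exact: erefl.
- exact: erefl.
- exact: erefl.
- exact: mulrC.
- by rewrite fell_eval_mule fell_eval_emul.
- by rewrite fell_eval_mule fell_eval_emul.
- by rewrite !fell_eval_mule.
- by rewrite fell_eval_mule fell_eval_add0 // fell_eval_mule.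
- by rewrite [RHS]fell_eval_mule fell_eval_add0 // fell_eval_mule.
- by rewrite !fell_eval_add0 // fell_eval_mule.
- rewrite fell_evalM fell_eval_sub0 ?fell_eval_mule ?mulr0 //.
  by rewrite fell_eval_sub0 // fell_eval_mule.
Qed.

Lemma fell_eval_eqv x y : fell_eqv x y -> fell_eval x = fell_eval y.
Proof.
elim=> //= *.
- exact: fell_eval_rel.
- congruence.
- congruence.
- congruence.
- exact: addrA.
- exact: addrC.
- by rewrite mcst0 add0r.
- by rewrite -[X in _ + X]mul1r -mcst1 -mulrDl -mcstD addNr mcst0 mul0r.
- exact: mulrA.
- by rewrite mcst1 mul1r.
- by rewrite mcst1 mulr1.
- exact: mulrDl.
- exact: mulrDr.
- exact: mcstD.
- exact: mcstM.
- exact: mulrC.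
Qed.

Lemma fell_one_neq0 : fell_cst 1 != 0.
Proof.
apply/eqP => /fell_pi_inj /fell_eval_eqv /= /eqP.
by rewrite mcst1 mcst0 oner_eq0.
Qed.

HB.instance Definition _ :=
  GRing.Zmodule_isNzRing.Build fell fell_mulA fell_mul1l fell_mul1r
    fell_mulDl fell_mulDr fell_one_neq0.

Definition fell_scale (c : C) (x : fell) : fell := fell_cst c * x.

Lemma fell_scaleA c d x : fell_scale c (fell_scale d x) = fell_scale (c * d) x.
Proof.
rewrite /fell_scale mulrA; congr (_ * _).
by rewrite [LHS]fell_mul_pi; apply: fell_piE; apply: eqv_sym; exact: eqv_cstM.
Qed.

Lemma fell_scale1 : left_id 1 fell_scale.
Proof. by move=> x; exact: mul1r. Qed.

Lemma fell_scaleDr : right_distributive fell_scale +%R.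
Proof. by move=> c x y; exact: mulrDr. Qed.

Lemma fell_scaleDl x : {morph fell_scale^~ x : c d / c + d}.
Proof.
move=> c d; rewrite /fell_scale -mulrDl; congr (_ * _).
by rewrite [RHS]fell_add_pi; apply: fell_piE; exact: eqv_cstD.
Qed.

HB.instance Definition _ :=
  GRing.Zmodule_isLmodule.Build C fell fell_scaleA fell_scale1 fell_scaleDr
    fell_scaleDl.

Lemma fell_scaleAl (c : C) (x y : fell) : GRing.scale c (x * y) = GRing.scale c x * y.
Proof. exact: mulrA. Qed.

HB.instance Definition _ := GRing.Lmodule_isLalgebra.Build C fell fell_scaleAl.

Lemma fell_scaleAr (c : C) (x y : fell) : GRing.scale c (x * y) = x * GRing.scale c y.
Proof.
rewrite [LHS]mulrA [RHS]mulrA; congr (_ * _).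
move: x; elim/fell_ind=> x.
rewrite [LHS]fell_mul_pi [RHS]fell_mul_pi.
by apply: fell_piE; exact: eqv_cst_central.
Qed.

HB.instance Definition _ := GRing.Lalgebra_isAlgebra.Build C fell fell_scaleAr.

Definition egen (i j : 'I_n) (z : C) : fell := \pi_fell (Xe i j z).

(* f(lambda) and f(rho), for a meromorphic function given by a representative *)
Definition lam (f : V -> C) : fell := \pi_fell (Xlam (mer f)).
Definition rho (f : V -> C) : fell := \pi_fell (Xrho (mer f)).

End Fell.

Section Minors.
Variables (R : realType) (n : nat) (p q : R).
Local Notation C := R[i].
Local Notation V := (hdual R n).
Local Notation A := (fell n p q).

Definition Fsup (I : {set 'I_n}) (zeta : V) : C :=
  \prod_(i in I) \prod_(j in I | (i < j)%N) E p q (zpair zeta i j).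

(* [enum_val r] is the r-th element of I in increasing order, r >= 0. *)
(* The ordered product has increasing index r, so the argument of the factors
   runs through z, q^2 z, q^4 z, ... from left to right. *)
Definition minor (I J : {set 'I_n}) (z : C) : A :=
  match #|I| =P #|J| with
  | ReflectT eqIJ =>
      rho p q (Fsup J) * lam p q (fun zeta => (Fsup I zeta)^-1) *
      \sum_(s : {perm 'I_n} | perm_on I s)
         (-1) ^+ s *
         \prod_(r < #|I|)
            egen p q (s (enum_val r)) (enum_val (cast_ord eqIJ r))
              (q%:C ^+ (2 * r) * z)
  | ReflectF _ => 0
  end.

Definition Sl (I J : {set 'I_n}) (zeta : V) : C :=
  if [disjoint I & J]
  then \prod_(i in I) \prod_(j in J) E p q (zpair zeta j i + 1) else 0.

Definition Sr (I J : {set 'I_n}) (zeta : V) : C :=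
  if [disjoint I & J]
  then \prod_(i in I) \prod_(j in J) (E p q (zpair zeta i j))^-1 else 0.

End Minors.

(* Main.v *)
(* Put [s] = E(s).  Both expansions are obtained by adding one column, or one
   row, at a time, so it is enough to expand a minor along a single column or
   row.  Along the first column the expansion is read off the alternating sum
   that defines the minor; it passes to an arbitrary column because
   e_ab(z) e_cd(q^2 z) - e_cb(z) e_ad(q^2 z) is antisymmetric in b and d, which
   is relation (5) for k = 0 combined with relation (3).  Along a row one argues
   by induction on the number m of the remaining rows: relation (4) for
   z1 / z2 = q^(-2m), where alpha and beta are regular as soon as m > 1, is
   multiplied by signums and by smaller minors and summed over the pairs of a row
   and a column, and its terms recombine into minors by the identity
     sum_(a in Z) prod_(j in Z, j <> a) h(x_j - x_a) [1] [x_a - x_0 + m] / [x_a - x_0]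
       = - [m] prod_(j in Z) h(x_j - x_0),   h(u) = [u + 1] / [- u],   m = #Z.
   The latter follows by induction on m from the three-term identity for theta,
   hence from [s + t] [s - t] = f(s) g(t) - g(s) f(t), which is the product of two
   Laurent series: the Jacobi triple product writes theta as the limit of finite
   q-binomial sums, and each pair (m, k) of exponents is either (s + t, s - t) or (s + t + 1, s - t). *)

From HB Require Import structures.
Require Import Defs.
From mathcomp Require Import all_boot all_order all_algebra.
From mathcomp Require Import perm.
From mathcomp Require Import ring lra zify.

Set Implicit Arguments.
Unset Strict Implicit.
Unset Printing Implicit Defensive.

Import Order.TTheory GRing.Theory Num.Theory.
Local Open Scope ring_scope.

(** * Laplace expansions from the exchange relations *)

(** The minor is given by the sum that alternates its rows, so adjacent columns can be compared at
    once, whereas a row has to be moved past a whole product; this is why rows need relation (4).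
    For a single remaining row that relation is singular, and the 2 by 2 case is relation (5)
    itself, whose two sides are the two expansions of a 2 by 2 minor. In the summed relation (4) the
    [alpha] terms give all summands but one of an expansion of the large minor, along a column on
    one side and along a row on the other. The [beta] terms give the missing summand provided that
    their coefficients add up, which is what the summation identity states. Coefficients do not
    commute with generators, but [e_ab] only shifts by [omega(a)] and [omega(b)], and such a shift
    fixes [zeta_ij] unless its index is [i] or [j]; so a signum passes unchanged once that index has
    been removed from its two sets. Factors are cancelled in the algebra only when they are images
    of invertible functions. *)

Section Signum.
Variables (K : comNzRingType) (T : finType) (w : T -> T -> K).

(** [K] is only a commutative ring here, so inverses are explicit witnesses; their images under [l]
    and [r] are what can be cancelled in the noncommutative algebra. *)
Definition invertible (f : K) : Prop := exists g, f * g = 1.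

Lemma invertible1 : invertible 1.
Proof. by exists 1; rewrite mulr1. Qed.

Lemma invertibleM f g : invertible f -> invertible g -> invertible (f * g).
Proof. by move=> [f' ff'] [g' gg']; exists (f' * g'); rewrite mulrACA ff' gg' mulr1. Qed.

Lemma invertible_prod (I : finType) (P : pred I) (F : I -> K) :
  (forall i, P i -> invertible (F i)) -> invertible (\prod_(i | P i) F i).
Proof. by move=> uF; apply: big_ind => //; [exact: invertible1|exact: invertibleM]. Qed.

(** One product serves for both signums: if [w] vanishes on the diagonal, a common element of [I]
    and [J] contributes a zero factor, so disjointness need not be tested. *)
Definition signum (I J : {set T}) : K := \prod_(i in I) \prod_(j in J) w i j.

Lemma signum0l J : signum set0 J = 1.
Proof. by rewrite /signum big_set0. Qed.

Lemma signum0r I : signum I set0 = 1.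
Proof. by rewrite /signum big1 // => i _; rewrite big_set0. Qed.

Lemma signum11 a c : signum [set a] [set c] = w a c.
Proof. by rewrite /signum !big_set1. Qed.

Lemma signumU1l a (I J : {set T}) : a \notin I -> signum (a |: I) J = signum [set a] J * signum I J.
Proof. by move=> aI; rewrite /signum big_setU1 //= big_set1. Qed.

Lemma signumU1r a (I J : {set T}) : a \notin J -> signum I (a |: J) = signum I [set a] * signum I J.
Proof.
move=> aJ; rewrite /signum -big_split; apply: eq_bigr => i _.
by rewrite big_setU1 //= big_set1.
Qed.

Lemma signumD1l a (I J : {set T}) : a \in I -> signum I J = signum [set a] J * signum (I :\ a) J.
Proof. by move=> aI; rewrite -signumU1l ?setD11 // setD1K. Qed.

Lemma signumD1r a (I J : {set T}) : a \in J -> signum I J = signum I [set a] * signum I (J :\ a).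
Proof. by move=> aJ; rewrite -signumU1r ?setD11 // setD1K. Qed.

Lemma signum_meet (I J : {set T}) a : (forall i, w i i = 0) -> a \in I -> a \in J -> signum I J = 0.
Proof. by move=> w0 aI aJ; rewrite (signumD1l _ aI) (signumD1r _ aJ) signum11 w0 !mul0r. Qed.

Lemma signumUr (I J1 J2 : {set T}) : [disjoint J1 & J2] ->
  signum I (J1 :|: J2) = signum I J1 * signum I J2.
Proof.
move=> dJ; rewrite /signum -big_split; apply: eq_bigr => i _ /=.
by rewrite -bigU //; apply: eq_bigl => j; rewrite !inE.
Qed.

(** Used with the shift by [- omega(a)], which changes [zeta_ij] only if [a] is [i] or [j]; it lets
    signums pass generators. *)
Lemma signum_fixed (s : {rmorphism K -> K}) a (I J : {set T}) :
    (forall i j, a != i -> a != j -> s (w i j) = w i j) ->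
  a \notin I -> a \notin J -> s (signum I J) = signum I J.
Proof.
move=> sw aI aJ; rewrite rmorph_prod; apply: eq_bigr => i iI.
rewrite rmorph_prod; apply: eq_bigr => j jJ; apply: sw.
  by apply: contraNneq aI => ->.
by apply: contraNneq aJ => ->.
Qed.

Lemma signum_invertible (I J : {set T}) : (forall i j, i != j -> invertible (w i j)) ->
  [disjoint I & J] -> invertible (signum I J).
Proof.
move=> uw dIJ; apply: invertible_prod => i iI; apply: invertible_prod => j jJ.
by apply: uw; apply: contraTneq jJ => <-; rewrite (disjointFr dIJ).
Qed.

Lemma signum1_invertible a (J : {set T}) : (forall i j, i != j -> invertible (w i j)) ->
  a \notin J -> invertible (signum [set a] J).
Proof. by move=> uw aJ; apply: signum_invertible => //; rewrite disjoints1. Qed.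

End Signum.

(* Abstractly, e a b k is e_ab(q^(2k) z), D I J k is the minor at q^(2k) z,
   x a c and y a c are [zeta_ac + 1] and 1 / [zeta_ac] off the diagonal, l and r
   are the two embeddings of the coefficients, sh a is the shift by - omega(a),
   and kappa m * x a c * y a c and beta m a c are alpha and beta at q^(-2m). *)
Section Laplace.
Variables (A : nzRingType) (K : comNzRingType) (n : nat).
Local Notation T := 'I_n.
Variables (l r : {rmorphism K -> A}) (sh : T -> {rmorphism K -> K}).
Variable e : T -> T -> nat -> A.
Variables (x y : T -> T -> K) (kappa : nat -> K) (beta : nat -> T -> T -> K).
Variable D : {set T} -> {set T} -> nat -> A.

Local Notation sl := (signum (fun i j => x j i)).
Local Notation sr := (signum y).

Hypothesis double_eq0 : forall u : A, u + u = 0 -> u = 0.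
Hypothesis lrC : forall f g, l f * r g = r g * l f.
Hypothesis e_l : forall a b k f, e a b k * l f = l (sh a f) * e a b k.
Hypothesis e_r : forall a b k f, e a b k * r f = r (sh b f) * e a b k.
Hypothesis x0 : forall a, x a a = 0.
Hypothesis y0 : forall a, y a a = 0.
Hypothesis xV : forall a c, a != c -> invertible (x a c).
Hypothesis yV : forall a c, a != c -> invertible (y a c).
Hypothesis yN : forall a c, y c a = - y a c.
Hypothesis shx : forall a i j, a != i -> a != j -> sh a (x i j) = x i j.
Hypothesis shy : forall a i j, a != i -> a != j -> sh a (y i j) = y i j.

(** [X] and [Y] are, up to coefficients, the two expansions of the 2 by 2 minor with rows [a], [c]
    and columns [b], [d]: [X] alternates the rows, [Y] the columns. [XY] identifies them and comes
    from relation (5). *)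
Let X a c b d k := e a b k * e c d k.+1 - e c b k * e a d k.+1.
Let Y a c b d k := r (x d b) * e a b k.+1 * e c d k + r (x b d) * e a d k.+1 * e c b k.

Hypothesis X_diag : forall a c b k, a != c -> X a c b b k = 0.
Hypothesis Y_diag : forall a b d k, b != d -> Y a a b d k = 0.
Hypothesis XY : forall a c b d k, a != c -> b != d ->
  l (x c a * y a c) * X a c b d k = r (y b d) * Y a c b d k.

Hypothesis kappaV : forall m, (1 < m)%N -> invertible (kappa m).
Hypothesis kappa_lr : forall m, l (kappa m) = r (kappa m).
Hypothesis exchange : forall a c b d k m, (1 < m)%N -> a != c -> b != d ->
  l (kappa m * x a c * y a c) * e a b k * e c d (k + m)
    + l (beta m a c) * e c b k * e a d (k + m)
  = r (kappa m * x b d * y b d) * e c d (k + m) * e a b k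
    + r (beta m d b) * e c b (k + m) * e a d k.
(** The left side is the total coefficient of the [beta] terms of the summed exchange relation, the
    right side the coefficient of the summand that its [alpha] terms leave out. *)
Hypothesis beta_sum : forall (Z : {set T}) a0, (1 < #|Z|)%N -> a0 \notin Z ->
  \sum_(a in Z) sr [set a] (Z :\ a) * sl [set a] (Z :\ a) * beta #|Z| a a0
  = kappa #|Z| * sl [set a0] Z * sr [set a0] Z.

Hypothesis D00 : forall k, D set0 set0 k = 1.
Hypothesis Dcard : forall (I J : {set T}) k, #|I| != #|J| -> D I J k = 0.
Hypothesis D_expand_first : forall (I J : {set T}) (b : T) k, (forall j, j \in J -> (b < j)%N) ->
  r (sr [set b] J) * D I (b |: J) k =
  \sum_(a in I) l (sr [set a] (I :\ a)) * e a b k * D (I :\ a) J k.+1.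

Lemma l_inj f u v : invertible f -> l f * u = l f * v -> u = v.
Proof.
move=> [g fg] /(congr1 ( *%R (l g))).
by rewrite !mulrA -rmorphM mulrC fg rmorph1 !mul1r.
Qed.

Lemma r_inj f u v : invertible f -> r f * u = r f * v -> u = v.
Proof.
move=> [g fg] /(congr1 ( *%R (r g))).
by rewrite !mulrA -rmorphM mulrC fg rmorph1 !mul1r.
Qed.

(** [Y] is symmetric in the columns and [y b d] is antisymmetric, so [XY] makes [X]
    antisymmetric. *)
Lemma X_skew a c b d k : a != c -> X a c b d k + X a c d b k = 0.
Proof.
move=> ac; have [->|bd] := eqVneq b d; first by rewrite !X_diag // addr0.
have db : d != b by rewrite eq_sym.
apply: (@l_inj (x c a * y a c)).
  by apply: invertibleM; [apply: xV; rewrite eq_sym|exact: yV].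
rewrite mulr0 mulrDr !XY // (yN b d) rmorphN mulNr.
have -> : Y a c d b k = Y a c b d k by rewrite /Y addrC.
by rewrite subrr.
Qed.

(** Dually, [X] and [y a c] both change sign under exchange of the rows; only the factors [x a c]
    and [x c a] remain to tell the two orders apart. *)
Lemma Y_swap a c b d k : a != c -> b != d ->
  l (x a c) * Y a c b d k = l (x c a) * Y c a b d k.
Proof.
move=> ac bd; have ca : c != a by rewrite eq_sym.
apply: (r_inj (yV bd)).
rewrite !mulrA -!lrC -!mulrA -!XY // !mulrA -!rmorphM.
have -> : X c a b d k = - X a c b d k by rewrite /X opprB.
by rewrite mulrN -mulNr -rmorphN (yN a c); congr (l _ * _); ring.
Qed.

(** Twice the sum over ordered pairs is a sum of symmetrized terms. Hence a comparison after
    symmetrization is enough when there is no 2-torsion. *)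
Lemma sum_pairs_eq (V : zmodType) (Z : {set T}) (F G : T -> T -> V) :
    (forall u : V, u + u = 0 -> u = 0) ->
    (forall a c, a \in Z -> c \in Z -> a != c -> F a c + F c a = G a c + G c a) ->
  \sum_(a in Z) \sum_(c in Z :\ a) F a c = \sum_(a in Z) \sum_(c in Z :\ a) G a c.
Proof.
move=> d0 FG; apply/eqP; rewrite -subr_eq0; apply/eqP/d0.
rewrite -sumrB.
have -> : \sum_(a in Z) (\sum_(c in Z :\ a) F a c - \sum_(c in Z :\ a) G a c) =
   \sum_(a in Z) \sum_(c in Z | c != a) (F a c - G a c).
  apply: eq_bigr => a aZ; rewrite -sumrB; apply: eq_bigl => c.
  by rewrite in_setD1 andbC.
rewrite [X in X + _](exchange_big_dep (mem Z)) /=; last by move=> a c _ /andP[].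
rewrite -big_split big1 //= => a aZ.
rewrite [X in X + _](eq_bigl (fun c => (c \in Z) && (c != a))); last first.
  by move=> c; rewrite aZ eq_sym.
rewrite -big_split big1 //= => c /andP[cZ ca].
by rewrite addrACA FG // -opprD subrr.
Qed.

Lemma sh_sl a (I J : {set T}) : a \notin I -> a \notin J -> sh a (sl I J) = sl I J.
Proof. by apply: signum_fixed => i j ai aj; exact: shx. Qed.

Lemma sh_sr a (I J : {set T}) : a \notin I -> a \notin J -> sh a (sr I J) = sr I J.
Proof. by apply: signum_fixed => i j ai aj; exact: shy. Qed.

Lemma setD1C (I : {set T}) a c : I :\ a :\ c = I :\ c :\ a.
Proof. by rewrite !setDDl setUC. Qed.

Lemma notin_D1 (I : {set T}) a c : a != c -> a \notin I :\ a :\ c.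
Proof. by move=> ac; rewrite !inE eqxx andbF. Qed.

(** Up to coefficients in [rho], the minor with columns [b], [d] and [N], expanded along [b] and
    then along [d]. *)
Let XD (I N : {set T}) b d k :=
  \sum_(a in I) \sum_(c in I :\ a)
    l (sr [set a] (I :\ a) * sr [set c] (I :\ a :\ c)) *
      (e a b k * e c d k.+1 * D (I :\ a :\ c) N k.+2).

(** The terms of the row pairs [(a, c)] and [(c, a)] combine into one [X a c b d k], because
    [y a c = - y c a]. *)
Lemma XD_skew I N b d k : XD I N b d k = - XD I N d b k.
Proof.
rewrite -sumrN; under [RHS]eq_bigr do rewrite -sumrN.
apply: sum_pairs_eq => // a c aI cI ac; have ca : c != a by rewrite eq_sym.
have pairF b1 d1 :
    l (sr [set a] (I :\ a) * sr [set c] (I :\ a :\ c)) *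
      (e a b1 k * e c d1 k.+1 * D (I :\ a :\ c) N k.+2)
  + l (sr [set c] (I :\ c) * sr [set a] (I :\ c :\ a)) *
      (e c b1 k * e a d1 k.+1 * D (I :\ c :\ a) N k.+2)
  = l (y a c * (sr [set a] (I :\ a :\ c) * sr [set c] (I :\ a :\ c)))
      * X a c b1 d1 k * D (I :\ a :\ c) N k.+2.
  rewrite (@signumD1r _ _ y c [set a] (I :\ a)) ?inE ?ca //.
  rewrite (@signumD1r _ _ y a [set c] (I :\ c)) ?inE ?ac // !signum11.
  rewrite (setD1C I c a) (yN a c).
  set t1 := signum _ _ _; set t2 := signum _ _ _.
  rewrite (_ : - y a c * t2 * t1 = - (y a c * (t1 * t2))); last by ring.
  by rewrite rmorphN mulNr -[y a c * t1 * t2]mulrA -mulrBr -mulrBl [LHS]mulrA.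
by rewrite pairF -opprD pairF -mulNr -mulrN; congr (_ * _ * _); apply/eqP;
   rewrite -subr_eq0 opprK; apply/eqP; exact: X_skew.
Qed.

Lemma XD_diag I N b k : XD I N b b k = 0.
Proof. by apply: double_eq0; rewrite {1}XD_skew addNr. Qed.

(** Let [d] be the least column of [J]. Expanding the small minors along [d] gives [XD], [XD_skew]
    exchanges [b] with [d], and the result is folded back: first along [b] by induction, then along
    [d], which has become the first column. *)
Lemma D_expand I b (J : {set T}) k :
  r (sr [set b] J) * D I (b |: J) k =
  \sum_(a in I) l (sr [set a] (I :\ a)) * e a b k * D (I :\ a) J k.+1.
Proof.
have [m] := ubnP #|J|; elim: m => // m IH in I b J k *; rewrite ltnS => Jm.
have [/set0Pn[j0 j0J]|/negbNE/eqP->] := boolP (J != set0); last first.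
  by apply: D_expand_first => j; rewrite inE.
pose d := [arg min_(j < j0 in J) (j : nat)].
have [dJ dmin] : d \in J /\ forall j, j \in J -> (d <= j)%N.
  by rewrite /d; case: arg_minnP.
have [bd|db] := ltnP b d.
  by apply: D_expand_first => j /dmin; exact: leq_trans.
pose N := J :\ d; have dN : d \notin N by rewrite !inE eqxx.
have JE : J = d |: N by rewrite setD1K.
have dmin' j : j \in N -> (d < j)%N.
  rewrite !inE => /andP[jd /dmin]; rewrite leq_eqVlt => /orP[/eqP/val_inj dj|//].
  by rewrite dj eqxx in jd.
have Nm : (#|N| < m)%N by rewrite (leq_trans _ Jm) // (cardsD1 d J) dJ.
have uN : invertible (sr [set d] N) by apply: signum1_invertible.
have [v uv] := uN.
have foldJ c : D c J k.+1 = \sum_(a in c) r v * (l (sr [set a] (c :\ a)) *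
    (e a d k.+1 * D (c :\ a) N k.+2)).
  rewrite -mulr_sumr; under eq_bigr do rewrite mulrA.
  by rewrite -D_expand_first // mulrA -rmorphM mulrC uv rmorph1 mul1r -JE.
(* The inverse [v] of the signum of [d] is carried to the left of [e a b k], which turns it into
   [sh b v]. *)
have -> : \sum_(a in I) l (sr [set a] (I :\ a)) * e a b k * D (I :\ a) J k.+1
    = r (sh b v) * XD I N b d k.
  rewrite mulr_sumr; apply: eq_bigr => a aI; rewrite foldJ !mulr_sumr.
  apply: eq_bigr => c; rewrite !inE => /andP[ca cI].
  have ac : a != c by rewrite eq_sym.
  rewrite !mulrA -[_ * e a b k * r v]mulrA e_r !mulrA lrC -!mulrA; congr (_ * _).
  rewrite rmorphM -!mulrA; congr (_ * _); rewrite !mulrA e_l sh_sr //.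
    by rewrite inE.
  exact: notin_D1.
have [bd|bd] := eqVneq b d.
  by rewrite bd XD_diag mulr0 (signum_meet y0 (set11 d) dJ) rmorph0 mul0r.
rewrite XD_skew.
have -> : XD I N d b k = \sum_(a in I) l (sr [set a] (I :\ a)) * e a d k *
    (r (sr [set b] N) * D (I :\ a) (b |: N) k.+1).
  apply: eq_bigr => a aI; rewrite IH // mulr_sumr; apply: eq_bigr => c.
  rewrite !inE => /andP[ca cI]; have ac : a != c by rewrite eq_sym.
  rewrite rmorphM -!mulrA; congr (_ * _); rewrite !mulrA e_l sh_sr //.
    by rewrite inE.
  exact: notin_D1.
have [bN|bN] := boolP (b \in N).
  rewrite (signum_meet y0 (set11 b) bN) rmorph0.
  rewrite big1 ?oppr0 ?mulr0; last by move=> a _; rewrite mul0r mulr0.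
  have bJ : b \in J by rewrite JE setU1r.
  by rewrite (signum_meet y0 (set11 b) bJ) rmorph0 mul0r.
(* An inverse of a fixed element is fixed; the excluded cases [b = d] and [b \in N] were those in
   which both sides vanish. *)
have shv : sh b v = v.
  have sv : sr [set d] N * sh b v = 1.
    by rewrite -[X in X * _](sh_sr _ bN) ?inE // -rmorphM uv rmorph1.
  by rewrite -[RHS]mulr1 -sv mulrA (mulrC v) uv mul1r.
rewrite shv.
have -> : \sum_(a in I) l (sr [set a] (I :\ a)) * e a d k *
    (r (sr [set b] N) * D (I :\ a) (b |: N) k.+1) =
    r (sr [set b] N * sr [set d] (b |: N)) * D I (b |: J) k.
  rewrite JE setUCA rmorphM -mulrA D_expand_first; last first.
    move=> j; rewrite in_setU1 => /orP[/eqP->|/dmin'//].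
    by rewrite ltn_neqAle db andbT eq_sym.
  rewrite mulr_sumr; apply: eq_bigr => a aI.
  by rewrite !mulrA -[_ * e a d k * r _]mulrA e_r !mulrA lrC sh_sr // inE eq_sym.
rewrite JE signumU1r // signumU1r // !signum11 mulrN [r v * _]mulrA -rmorphM -mulNr -rmorphN.
congr (r _ * _).
rewrite (yN b d).
transitivity (sr [set d] N * v * (y b d * sr [set b] N)); last by ring.
by rewrite uv mul1r.
Qed.

Lemma D11 a b k : D [set a] [set b] k = e a b k.
Proof.
have := D_expand [set a] b set0 k.
rewrite setU0 signum0r rmorph1 mul1r => ->.
by rewrite big_set1 setDv signum0r rmorph1 mul1r D00 mulr1.
Qed.

(** The counterpart of [XD] for an expansion along row [a] and then row [c]; here the outer
    generator carries the larger argument. *)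
Let YD a c (N J : {set T}) k h :=
  \sum_(b in J) \sum_(d in J :\ b)
    r (sl [set b] (J :\ b) * sl [set d] (J :\ b :\ d)) *
      (e a b h.+1 * e c d h * D N (J :\ b :\ d) k).

Lemma YD_pair a c (N J : {set T}) k h b d : b \in J -> d \in J -> b != d ->
    r (sl [set b] (J :\ b) * sl [set d] (J :\ b :\ d)) *
      (e a b h.+1 * e c d h * D N (J :\ b :\ d) k)
  + r (sl [set d] (J :\ d) * sl [set b] (J :\ d :\ b)) *
      (e a d h.+1 * e c b h * D N (J :\ d :\ b) k)
  = r (sl [set b] (J :\ b :\ d) * sl [set d] (J :\ b :\ d))
      * Y a c b d h * D N (J :\ b :\ d) k.
Proof.
move=> bJ dJ bd; have db : d != b by rewrite eq_sym.
rewrite (@signumD1r _ _ _ d [set b] (J :\ b)) ?inE ?db //.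
rewrite (@signumD1r _ _ _ b [set d] (J :\ d)) ?inE ?bd // !signum11.
rewrite (setD1C J d b).
set t1 := signum _ _ _; set t2 := signum _ _ _.
rewrite (_ : x d b * t1 * t2 = t1 * t2 * x d b); last by ring.
rewrite (_ : x b d * t2 * t1 = t1 * t2 * x b d); last by ring.
by rewrite /Y !(rmorphM r) !mulrDr mulrDl !mulrA.
Qed.

Lemma YD_swap a c N J k h : a != c -> l (x a c) * YD a c N J k h = l (x c a) * YD c a N J k h.
Proof.
move=> ac; rewrite !mulr_sumr; under eq_bigr do rewrite mulr_sumr.
under [RHS]eq_bigr do rewrite mulr_sumr.
apply: sum_pairs_eq => // b d bJ dJ bd.
rewrite -!mulrDr !YD_pair // !mulrA !lrC -!mulrA; congr (_ * _).
by rewrite !mulrA Y_swap.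
Qed.

Lemma YD_diag a N J k h : YD a a N J k h = 0.
Proof.
rewrite (_ : 0 = \sum_(b in J) \sum_(d in J :\ b) (0 : A)); last first.
  by rewrite big1 // => b _; rewrite big1.
apply: sum_pairs_eq => // b d bJ dJ bd.
by rewrite YD_pair // Y_diag // mulr0 mul0r addr0.
Qed.

Lemma cards2_exists (J : {set T}) : #|J| = 2 -> exists b d, b != d /\ J = [set b; d].
Proof. by move=> /eqP/cards2P[b [d [bd ->]]]; exists b, d. Qed.

Let expandl a (I J : {set T}) k :=
  \sum_(b in J) r (sl [set b] (J :\ b)) * e a b (k + #|I|) * D I (J :\ b) k.

(** A row expansion is carried past the generator [e a' b h]. As [b] is not in [J], the signums of
    columns are fixed, and only the coefficient in [lambda] is shifted. *)
Lemma expandl_mul (N J : {set T}) c (a' b : T) k h : b \notin J ->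
    l (sl [set c] N) * D (c |: N) J k = expandl c N J k ->
  \sum_(d in J) r (sl [set d] (J :\ d)) *
      (e a' b h * e c d (k + #|N|) * D N (J :\ d) k)
  = l (sh a' (sl [set c] N)) * e a' b h * D (c |: N) J k.
Proof.
move=> bJ IH; rewrite -e_l -mulrA IH mulr_sumr; apply: eq_bigr => d dJ.
have bd : b != d by apply: contraNneq bJ => ->.
rewrite !mulrA e_r sh_sl //; first by rewrite inE.
by rewrite !inE negb_and bJ orbT.
Qed.

Lemma coef_l f g u v e1 e2 e3 e4 t :
  l f * r g * ((l u * e1 * e2 + l v * e3 * e4) * t) =
  l (f * u) * (r g * (e1 * e2 * t)) + l (f * v) * (r g * (e3 * e4 * t)).
Proof.
rewrite !rmorphM mulrDl mulrDr -!mulrA; congr (_ + _);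
  by congr (_ * _); rewrite !mulrA lrC.
Qed.

Lemma coef_r f g u v e1 e2 e3 e4 t :
  l f * r g * ((r u * e1 * e2 + r v * e3 * e4) * t) =
  r (g * u) * (l f * (e1 * e2 * t)) + r (g * v) * (l f * (e3 * e4 * t)).
Proof.
rewrite lrC !rmorphM mulrDl mulrDr -!mulrA; congr (_ + _);
  by congr (_ * _); rewrite !mulrA lrC.
Qed.

(** The exchange relation for rows [c], [a] and columns [b1], [b] is multiplied by signums and by
    the minor without these rows and columns, and summed over [c] in [I] and [b] in [J :\ b1]. One
    side sums to the minor, the other to its row expansion, both times the same invertible
    factor. *)
Lemma exchange_step a (I J : {set T}) b1 k : (1 < #|I|)%N -> a \notin I -> b1 \in J ->
    #|J| = #|I|.+1 ->
    (forall c (N J' : {set T}) k', (#|N| < #|I|)%N ->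
       l (sl [set c] N) * D (c |: N) J' k' = expandl c N J' k') ->
  l (sl [set a] I) * D (a |: I) J k = expandl a I J k.
Proof.
move=> I1 aI b1J cJ IH; pose h := #|I|; pose J1 := J :\ b1.
have JE : J = b1 |: J1 by rewrite setD1K.
have b1J1 : b1 \notin J1 by rewrite !inE eqxx.
have cJ1 : #|J1| = h by move: cJ; rewrite (cardsD1 b1 J) b1J add1n => -[].
have sizeI c : c \in I -> (#|I :\ c| < #|I|)%N by move=> cI; rewrite (cardsD1 c I) cI.
(* The argument [k + h] in the exchange relation is the one that a row expansion of minors at [k.+1]
   with one row fewer requires. *)
have kE c : c \in I -> (k.+1 + #|I :\ c| = k + h)%N.
  by move=> cI; rewrite /h (cardsD1 c I) cI add1n addSnnS.
pose t c b := D (I :\ c) (J1 :\ b) k.+1.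
(* Summation over [b] is a row expansion of a smaller minor, known by induction. The [alpha] terms
   then give the rows [c] of the expansion along [b1], and the [beta] terms give its row [a]. *)
have lhs : \sum_(c in I) \sum_(b in J1) l (sr [set c] (I :\ c)) * r (sl [set b] (J1 :\ b)) *
      ((l (kappa h * x c a * y c a) * e c b1 k * e a b (k + h)
        + l (beta h c a) * e a b1 k * e c b (k + h)) * t c b)
   = l (kappa h * sl [set a] I) * (r (sr [set b1] J1) * D (a |: I) J k).
  rewrite JE D_expand big_setU1 //= setU1K //.
  rewrite mulrDr !mulrA -rmorphM -beta_sum // rmorph_sum !mulr_suml mulr_sumr -big_split /=.
  apply: eq_bigr => c cI; have ca : c != a by apply: contraNneq aI => <-.
  have cIc : c \notin I :\ c by rewrite !inE eqxx.
  have aIc : a \notin I :\ c by rewrite !inE negb_and aI orbT.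
  under eq_bigr do rewrite coef_l.
  rewrite big_split /= -!mulr_sumr -(kE c cI).
  rewrite !expandl_mul //; try by apply: IH; exact: sizeI.
  have -> : sh c (sl [set a] (I :\ c)) = sl [set a] (I :\ c) by rewrite sh_sl // inE.
  have -> : sh a (sl [set c] (I :\ c)) = sl [set c] (I :\ c).
    by rewrite sh_sl // inE eq_sym.
  rewrite setD1K // addrC !mulrA -!rmorphM.
  congr (_ * _ * _ + _ * _ * _); first by congr (l _); rewrite -/h; ring.
    rewrite (_ : (a |: I) :\ c = a |: (I :\ c)); last first.
      by apply/setP => i; rewrite !inE; case: (eqVneq i c) => // ->; rewrite (negPf ca).
    rewrite signumU1r // (@signumD1r _ _ _ c _ I) // !signum11; congr (l _); ring.
  congr D; apply/setP => i.
  by rewrite !inE; case: (eqVneq i c) => // ->; rewrite (negPf ca).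
(* Here the inner sum runs over [c] and is a column expansion. The [alpha] terms give the columns
   [b] of the expansion along row [a], and the [beta] terms the column [b1]. *)
have rhs : \sum_(c in I) \sum_(b in J1) l (sr [set c] (I :\ c)) * r (sl [set b] (J1 :\ b)) *
      ((r (kappa h * x b1 b * y b1 b) * e a b (k + h) * e c b1 k
        + r (beta h b b1) * e a b1 (k + h) * e c b k) * t c b)
   = r (kappa h * sr [set b1] J1) * expandl a I J k.
  rewrite exchange_big /= /expandl JE big_setU1 //= setU1K //.
  rewrite mulrDr !mulrA -rmorphM -cJ1.
  rewrite (_ : kappa #|J1| * sr [set b1] J1 * sl [set b1] J1 =
     kappa #|J1| * sl [set b1] J1 * sr [set b1] J1); last by ring.
  rewrite -beta_sum ?cJ1 // rmorph_sum !mulr_suml mulr_sumr -big_split /=.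
  apply: eq_bigr => b bJ1; have bb1 : b != b1 by apply: contraNneq b1J1 => <-.
  under eq_bigr do rewrite coef_r.
  rewrite big_split /= -!mulr_sumr.
  have fold b' d : d \notin J1 :\ b -> b' \notin J1 :\ b -> b' != d ->
     \sum_(c in I) l (sr [set c] (I :\ c)) * (e a b' (k + h) * e c d k * t c b) =
     r (sr [set d] (J1 :\ b)) * e a b' (k + h) * D I (d |: J1 :\ b) k.
    move=> dJ bJ bd.
    have sE : sh b' (sr [set d] (J1 :\ b)) = sr [set d] (J1 :\ b).
      by rewrite sh_sr // inE.
    rewrite -[X in r X * _]sE -e_r -mulrA D_expand mulr_sumr.
    apply: eq_bigr => c cI; rewrite !mulrA e_l sh_sr //.
      by rewrite inE; apply: contraNneq aI => ->.
    by rewrite !inE negb_and aI orbT.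
  have b1Jb : b1 \notin J1 :\ b by rewrite !inE eqxx andbF.
  have bJb : b \notin J1 :\ b by rewrite !inE eqxx.
  rewrite !fold // 1?eq_sym // setD1K // [LHS]addrC !mulrA -!rmorphM.
  congr (_ * _ * _ + _ * _ * _); first by congr (r _); ring.
    rewrite (_ : (b1 |: J1) :\ b = b1 |: (J1 :\ b)); last first.
      by apply/setP => i; rewrite !inE; case: (eqVneq i b) => // ->; rewrite (negPf bb1).
    rewrite signumU1r // (@signumD1r _ _ _ b _ J1) // !signum11; congr (r _); ring.
  congr D; apply/setP => i; rewrite !inE.
  by case: (eqVneq i b) => // ->; rewrite (negPf bb1).
apply: (l_inj (kappaV I1)); apply: (@r_inj (sr [set b1] J1)).
  exact: signum1_invertible.
rewrite !mulrA -!lrC [in RHS]lrC.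
(* As [kappa] has the same image under [l] and [r], it can be merged with the coefficient in [rho]
   on the right. *)
rewrite {2}kappa_lr.
have -> : l (kappa #|I|) * r (sr [set b1] J1) * l (sl [set a] I) * D (a |: I) J k =
  l (kappa h * sl [set a] I) * (r (sr [set b1] J1) * D (a |: I) J k).
  by rewrite rmorphM !mulrA -[in LHS](mulrA (l _) (r _)) -lrC !mulrA.
rewrite -lhs.
have -> : r (sr [set b1] J1) * r (kappa #|I|) * expandl a I J k =
  r (kappa h * sr [set b1] J1) * expandl a I J k by rewrite -rmorphM mulrC.
rewrite -rhs; apply: eq_bigr => c cI; apply: eq_bigr => b bJ1.
have ca : c != a by apply: contraNneq aI => <-.
have b1b : b1 != b by apply: contraNneq b1J1 => ->.
by rewrite exchange.
Qed.

Lemma D_expandl a (I J : {set T}) k :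
  l (sl [set a] I) * D (a |: I) J k = expandl a I J k.
Proof.
have [m] := ubnP #|I|; elim: m => // m IH in I J a k *; rewrite ltnS => Im.
have foldl c (N : {set T}) b a' h : (#|N| < m)%N ->
    r (sl [set b] (J :\ b)) * e a' b h * (l (sl [set c] N) * D (c |: N) (J :\ b) k) =
    \sum_(d in J :\ b) r (sl [set b] (J :\ b) * sl [set d] (J :\ b :\ d)) *
      (e a' b h * e c d (k + #|N|) * D N (J :\ b :\ d) k).
  move=> Nm; rewrite !mulrA -[_ * _ * l _]mulrA e_l !mulrA -mulrA -mulrA.
  rewrite [l _ * _]mulrA -(@expandl_mul _ (J :\ b)) ?inE ?eqxx //; last exact: IH.
  rewrite mulr_sumr; apply: eq_bigr => d _.
  by rewrite rmorphM !mulrA.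
have [aI|aI] := boolP (a \in I).
  rewrite (signum_meet _ (set11 a) aI) // rmorph0 mul0r; apply/esym.
  (* The second row [c] is taken different from [a] whenever possible. After the rows are exchanged
     by [YD_swap], the inner sum is then an expansion along [a] of a minor containing row [a], which
     vanishes by induction. Otherwise [YD_diag] applies. *)
  have [c [cI caP]] : exists c, c \in I /\ (c = a \/ (a != c /\ a \in I :\ c)).
    have [/set0Pn[c]|/negbNE/eqP Ia] := boolP (I :\ a != set0).
      rewrite !inE => /andP[ca cI]; exists c; split=> //; right.
      by rewrite !inE eq_sym ca.
    by exists a; split=> //; left.
  pose N := I :\ c; have cN : c \notin N by rewrite !inE eqxx.
  have IE : I = c |: N by rewrite setD1K.
  have IN : #|I| = #|N|.+1 by rewrite (cardsD1 c I) cI.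
  have Nm : (#|N| < m)%N by rewrite -IN.
  have [v uv] : invertible (sl [set c] N).
    by apply: signum1_invertible => // i j ij; apply: xV; rewrite eq_sym.
  have foldD b : D I (J :\ b) k = l v * (l (sl [set c] N) * D (c |: N) (J :\ b) k).
    by rewrite mulrA -rmorphM mulrC uv rmorph1 mul1r -IE.
  have -> : expandl a I J k = l (sh a v) * YD a c N J k (k + #|N|).
    rewrite mulr_sumr; apply: eq_bigr => b bJ.
    rewrite -addnS -IN -foldl // foldD !mulrA -[_ * e a b _ * l v]mulrA e_l.
    by rewrite !mulrA lrC.
  have [->|[ac aN]] := caP; first by rewrite YD_diag mulr0.
  suff -> : YD a c N J k (k + #|N|) = 0 by rewrite mulr0.
  apply: (l_inj (xV ac)); rewrite mulr0 YD_swap // [X in _ * X](_ : _ = 0) ?mulr0 //.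
  rewrite /YD big1 // => b bJ.
  by rewrite -foldl // (signum_meet _ (set11 a) aN) // rmorph0 mul0r mulr0.
have [cJ|cJ] := eqVneq #|J| #|I|.+1; last first.
  rewrite Dcard ?mulr0; last by rewrite cardsU1 aI eq_sym.
  rewrite /expandl big1 // => b bJ; rewrite Dcard ?mulr0 //.
  by apply: contraNneq cJ => ->; rewrite (cardsD1 b J) bJ.
have [/eqP|Ipos] := posnP #|I|.
  rewrite cards_eq0 => /eqP IE; move: cJ; rewrite IE cards0 => /eqP/cards1P[b ->].
  rewrite /expandl big_set1 setDv signum0r signum0r setU0 D11 D00 cards0 addn0.
  by rewrite !rmorph1 !mul1r mulr1.
have [I1|] := ltnP 1 #|I|.
  have /set0Pn[b bJ] : J != set0 by rewrite -card_gt0 cJ.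
  by apply: (@exchange_step _ _ _ b) => // c N J' k' /leq_trans/(_ Im); exact: IH.
(* For two rows the claim is [XY]: the column expansion of the minor is [X], and the row expansion
   is [Y]. *)
rewrite leq_eqVlt ltnS leqNgt Ipos orbF => /eqP cI1.
move: cJ; rewrite cI1 => /cards2_exists[b [d [bd JE]]].
have /cards1P[c IE] := introT eqP cI1.
have ac : a != c by move: aI; rewrite IE inE.
have db : d != b by rewrite eq_sym.
have JDb : J :\ b = [set d].
  by apply/setP => i; rewrite JE !inE; case: (eqVneq i b) => // ->; rewrite (negPf bd).
have JDd : J :\ d = [set b].
  apply/setP => i; rewrite JE !inE; case: (eqVneq i d) => [->|]; last by rewrite orbF.
  by rewrite (negPf db).
have IDa : (a |: I) :\ a = [set c] by rewrite setU1K // IE.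
have IDc : (a |: I) :\ c = [set a].
  apply/setP => i; rewrite IE !inE; case: (eqVneq i c) => [->|]; last by rewrite orbF.
  by rewrite eq_sym (negPf ac).
rewrite /expandl cI1 addn1 JE big_setU1 ?inE //= big_set1 -JE JDb JDd IE !D11 !signum11.
rewrite -/(Y a c b d k) -IE.
apply: (r_inj (yV bd)); rewrite -XY //.
rewrite !mulrA -lrC -mulrA.
have -> : r (y b d) * D (a |: I) J k = l (y a c) * X a c b d k.
  have := D_expand (a |: I) b [set d] k.
  rewrite signum11 -JE => ->; move: IDa IDc; rewrite IE => IDa IDc.
  rewrite big_setU1 ?inE //= big_set1 IDa IDc !signum11 !D11.
  by rewrite (yN a c) rmorphN !mulNr -mulrA -mulrA -mulrBr.
by rewrite mulrA -rmorphM.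
Qed.

(** Choosing a pair with union [I] and an [a] in its first member amounts to choosing [a] and a pair
    with union [I :\ a], except when [a] is also in the second member; those terms are zero by
    assumption. *)
Lemma setU_exchange (I : {set T}) (G : T -> {set T} -> {set T} -> A) :
    (forall (a : T) (I1 I2 : {set T}), a \in I2 -> G a I1 I2 = 0) ->
  \sum_(P : {set T} * {set T} | P.1 :|: P.2 == I) \sum_(a in P.1) G a (P.1 :\ a) P.2
  = \sum_(a in I) \sum_(P : {set T} * {set T} | P.1 :|: P.2 == I :\ a) G a P.1 P.2.
Proof.
move=> G0; rewrite (exchange_big_dep (mem I)) /=; last first.
  by move=> P a /eqP<- aP; rewrite inE aP.
apply: eq_bigr => a aI.
rewrite (bigID (fun P : {set T} * {set T} => a \in P.2)) /= big1 ?add0r; last first.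
  by move=> P /andP[_]; exact: G0.
rewrite (reindex_onto (fun P : {set T} * {set T} => (a |: P.1, P.2))
  (fun P : {set T} * {set T} => (P.1 :\ a, P.2))) /=; last first.
  by case=> I1 I2 /= /andP[/andP[_ aI1] _]; rewrite setD1K.
apply: eq_big => -[I1 I2] /=; last first.
  by move=> /andP[_ /eqP[->]].
rewrite !inE eqxx /= andbT; apply/andP/eqP => [[/andP[/eqP<- aI2] /eqP[I1E]]|IE].
  have aI1 : a \notin I1 by rewrite -I1E !inE eqxx.
  by rewrite -setUA setU1K // inE negb_or aI1.
have aI12 : a \notin I1 :|: I2 by rewrite IE !inE eqxx.
move: aI12; rewrite inE negb_or => /andP[aI1 aI2].
by rewrite aI2 -setUA IE setD1K // setU1K // !eqxx.
Qed.

Lemma meetP (I J : {set T}) : reflect (exists2 a, a \in I & a \in J) (~~ [disjoint I & J]).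
Proof.
rewrite -setI_eq0; apply: (iffP (set0Pn _)) => [[a]|[a aI aJ]].
  by rewrite inE => /andP[]; exists a.
by exists a; rewrite inE aI aJ.
Qed.

(** The factor [signum w I1 I2] makes both sides vanish unless the union is disjoint. *)
Lemma signum_split (w : T -> T -> K) a (I I1 I2 : {set T}) : (forall i, w i i = 0) ->
    I1 :|: I2 = I ->
  signum w [set a] I1 * signum w [set a] I2 * signum w I1 I2 =
  signum w [set a] I * signum w I1 I2.
Proof.
move=> w0 <-; have [dI|/meetP[c c1 c2]] := boolP [disjoint I1 & I2].
  by rewrite signumUr.
by rewrite (signum_meet w0 c1 c2) !mulr0.
Qed.

(** Induction on [J1]: after multiplication by the signum of a column [b] against the rest, every
    left factor is expanded along [b]. Exchanging the sums leaves the induction hypothesis inside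
    the expansion of the whole minor along [b]. *)
Lemma laplace_columns (J1 J2 I : {set T}) k :
  r (sr J1 J2) * D I (J1 :|: J2) k =
  \sum_(P : {set T} * {set T} | P.1 :|: P.2 == I)
     l (sr P.1 P.2) * D P.1 J1 k * D P.2 J2 (k + #|J1|).
Proof.
have [m] := ubnP #|J1|; elim: m => // m IH in J1 I k *; rewrite ltnS => Jm.
have [/set0Pn[b bJ1]|/negbNE/eqP->] := boolP (J1 != set0); last first.
  rewrite signum0l rmorph1 mul1r set0U (bigD1 (set0, I)) /= ?set0U // big1 ?addr0.
    by rewrite signum0l rmorph1 mul1r D00 mul1r cards0 addn0.
  move=> [I1 I2] /= /andP[/eqP IE ne0]; rewrite (@Dcard I1) ?mulr0 ?mul0r //.
  rewrite cards0 cards_eq0; apply: contraNneq ne0 => I10.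
  by rewrite -IE I10 set0U.
pose N := J1 :\ b; have bN : b \notin N by rewrite !inE eqxx.
have JE : J1 = b |: N by rewrite setD1K.
have cJ : #|J1| = #|N|.+1 by rewrite (cardsD1 b J1) bJ1.
apply: (@r_inj (sr [set b] N)); first exact: signum1_invertible.
rewrite mulr_sumr.
(* The factor for [[set a]] and [I2] is the part of [sr P.1 P.2] that belongs to [a]; it also makes
   [G] vanish for [a] in [I2]. *)
pose G a (I1 I2 : {set T}) := l (sr [set a] I1 * sr [set a] I2) * e a b k *
   (l (sr I1 I2) * D I1 N k.+1 * D I2 J2 (k.+1 + #|N|)).
transitivity (\sum_(P : {set T} * {set T} | P.1 :|: P.2 == I)
    \sum_(a in P.1) G a (P.1 :\ a) P.2); last first.
  apply: eq_bigr => -[I1 I2] /= _.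
  rewrite !mulrA -lrC -[_ * r _ * D _ _ _]mulrA JE D_expand -JE mulr_sumr mulr_suml.
  apply: eq_bigr => a aI1; rewrite /G cJ addSnnS !mulrA; congr (_ * _ * _).
  have [aI2|aI2] := boolP (a \in I2).
    by rewrite (signum_meet _ aI1 aI2) // (signum_meet _ (set11 a) aI2) // mulr0 !rmorph0 !mul0r.
  rewrite -[_ * e a b k * l _]mulrA e_l sh_sr ?inE ?eqxx // !mulrA -!rmorphM.
  by rewrite (signumD1l _ _ aI1); congr (l _ * _); ring.
rewrite setU_exchange; last first.
  by move=> a I1 I2 aI2; rewrite /G (signum_meet _ (set11 a) aI2) // mulr0 rmorph0 !mul0r.
transitivity (r (sh b (sr N J2)) * \sum_(a in I) l (sr [set a] (I :\ a)) * e a b k *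
    D (I :\ a) (N :|: J2) k.+1).
  rewrite -D_expand JE -setUA !mulrA -!rmorphM; congr (r _ * _).
  rewrite signumU1l //.
  have [dNJ|/meetP[c cN cJ2]] := boolP [disjoint N & J2]; last first.
    by rewrite (signum_meet _ cN cJ2) // rmorph0 !mulr0 mul0r.
  rewrite signumUr //.
  have [bJ2|bJ2] := boolP (b \in J2).
    by rewrite (signum_meet _ (set11 b) bJ2) // !(mulr0, mul0r).
  by rewrite sh_sr //; ring.
rewrite mulr_sumr; apply: eq_bigr => a aI.
transitivity (l (sr [set a] (I :\ a)) * e a b k * (r (sr N J2) * D (I :\ a) (N :|: J2) k.+1)).
  by rewrite !mulrA -[_ * e a b k * r _]mulrA e_r !mulrA lrC.
rewrite IH -?cJ // mulr_sumr; apply: eq_bigr => -[I1 I2] /= /eqP IE.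
have aI1 : a \notin I1 :|: I2 by rewrite IE !inE eqxx.
move: (aI1); rewrite inE negb_or => /andP[a1 a2].
rewrite /G !mulrA -![_ * e a b k * l _]mulrA e_l sh_sr // !mulrA -!rmorphM.
by rewrite (signum_split _ y0 IE).
Qed.

(** The same induction with [D_expandl]. The row that is split off stands leftmost with the largest
    argument, so the factor of [I1] is the one at the shifted point. *)
Lemma laplace_rows (I1 I2 J : {set T}) k :
  l (sl I1 I2) * D (I1 :|: I2) J k =
  \sum_(P : {set T} * {set T} | P.1 :|: P.2 == J)
     r (sl P.1 P.2) * D I1 P.1 (k + #|I2|) * D I2 P.2 k.
Proof.
have [m] := ubnP #|I1|; elim: m => // m IH in I1 J *; rewrite ltnS => Im.
have [/set0Pn[a aI1]|/negbNE/eqP->] := boolP (I1 != set0); last first.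
  rewrite signum0l rmorph1 mul1r set0U (bigD1 (set0, J)) /= ?set0U // big1 ?addr0.
    by rewrite signum0l rmorph1 mul1r D00 mul1r.
  move=> [J1 J2] /= /andP[/eqP JE ne0]; rewrite (@Dcard set0) ?mulr0 ?mul0r //.
  rewrite cards0 eq_sym cards_eq0; apply: contraNneq ne0 => J10.
  by rewrite -JE J10 set0U.
pose N := I1 :\ a; have aN : a \notin N by rewrite !inE eqxx.
have IE : I1 = a |: N by rewrite setD1K.
have cI : #|I1| = #|N|.+1 by rewrite (cardsD1 a I1) aI1.
have xV' i j : i != j -> invertible (x j i) by move=> ij; apply: xV; rewrite eq_sym.
apply: (@l_inj (sl [set a] N)); first exact: signum1_invertible.
rewrite mulr_sumr; pose h := (k + #|I2| + #|N|)%N.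
pose G b (J1 J2 : {set T}) := r (sl [set b] J1 * sl [set b] J2) * e a b h *
   (r (sl J1 J2) * D N J1 (k + #|I2|) * D I2 J2 k).
transitivity (\sum_(P : {set T} * {set T} | P.1 :|: P.2 == J)
    \sum_(b in P.1) G b (P.1 :\ b) P.2); last first.
  apply: eq_bigr => -[J1 J2] /= _.
  rewrite !mulrA lrC -[_ * l _ * D _ _ _]mulrA IE D_expandl mulr_sumr mulr_suml.
  apply: eq_bigr => b bJ1; rewrite /G !mulrA; congr (_ * _ * _).
  have [bJ2|bJ2] := boolP (b \in J2).
    by rewrite (signum_meet _ bJ1 bJ2) // (signum_meet _ (set11 b) bJ2) // mulr0 !rmorph0 !mul0r.
  rewrite -[_ * e a b h * r _]mulrA e_r sh_sl ?inE ?eqxx // !mulrA -!rmorphM.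
  by rewrite (signumD1l _ _ bJ1); congr (r _ * _); ring.
rewrite setU_exchange; last first.
  by move=> b J1 J2 bJ2; rewrite /G (signum_meet _ (set11 b) bJ2) // mulr0 rmorph0 !mul0r.
transitivity (l (sh a (sl N I2)) * \sum_(b in J) r (sl [set b] (J :\ b)) * e a b h *
    D (N :|: I2) (J :\ b) k).
  have [dNI|/meetP[c cN cI2]] := boolP [disjoint N & I2]; last first.
    by rewrite IE signumU1l // (signum_meet _ cN cI2) // !(mulr0, rmorph0, mul0r).
  have := D_expandl a (N :|: I2) J k.
  rewrite /expandl cardsU disjoint_setI0 // cards0 subn0 [(#|N| + _)%N]addnC addnA => <-.
  rewrite IE -setUA !mulrA -!rmorphM; congr (l _ * _).
  rewrite signumU1l // signumUr //.
  have [aI2|aI2] := boolP (a \in I2).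
    by rewrite (signum_meet _ (set11 a) aI2) // !(mulr0, mul0r).
  by rewrite sh_sl //; ring.
rewrite mulr_sumr; apply: eq_bigr => b bJ.
transitivity (r (sl [set b] (J :\ b)) * e a b h * (l (sl N I2) * D (N :|: I2) (J :\ b) k)).
  by rewrite !mulrA -[_ * e a b h * l _]mulrA e_l !mulrA lrC.
rewrite IH -?cI // mulr_sumr; apply: eq_bigr => -[J1 J2] /= /eqP JE.
have bJ1 : b \notin J1 :|: J2 by rewrite JE !inE eqxx.
move: (bJ1); rewrite inE negb_or => /andP[b1 b2].
rewrite /G !mulrA -![_ * e a b h * r _]mulrA e_r sh_sl // !mulrA -!rmorphM.
by rewrite (signum_split _ _ JE).
Qed.

End Laplace.

(** * Alternating sums and the expansion along the first column *)

Section ExtendPerm.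
Variables (d : nat) (T : finType) (f : 'I_d -> T).
Hypothesis f_inj : injective f.

(** Minors sum over permutations of the whole index set that fix the complement of [I], alternants
    over ['S_d]. Conjugation by the parametrization [f], extended by the identity, relates the
    two. *)
Definition extend_fun (s : 'S_d) (t : T) : T :=
  if [pick i | f i == t] is Some i then f (s i) else t.

Lemma extend_fun_in s i : extend_fun s (f i) = f (s i).
Proof.
rewrite /extend_fun; case: pickP => [j /eqP/f_inj->//|/(_ i)].
by rewrite eqxx.
Qed.

Lemma extend_fun_out s t : t \notin codom f -> extend_fun s t = t.
Proof.
move=> tf; rewrite /extend_fun; case: pickP => // j /eqP jt.
by rewrite -jt codom_f in tf.
Qed.

Lemma extend_fun_inj s : injective (extend_fun s).
Proof.
apply: (can_inj (g := extend_fun s^-1)) => t.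
have [/codomP[i ->]|tf] := boolP (t \in codom f); last by rewrite !extend_fun_out.
by rewrite !extend_fun_in permK.
Qed.

Definition extend_perm s : {perm T} := perm (@extend_fun_inj s).

Lemma extend_permE s i : extend_perm s (f i) = f (s i).
Proof. by rewrite permE extend_fun_in. Qed.

Lemma extend_perm_out s t : t \notin codom f -> extend_perm s t = t.
Proof. by move=> tf; rewrite permE extend_fun_out. Qed.

Lemma extend_perm_inj : injective extend_perm.
Proof.
move=> s t st; apply/permP => i; apply: f_inj.
by rewrite -!extend_permE st.
Qed.

Lemma extend_permM s t : extend_perm (s * t)%g = (extend_perm s * extend_perm t)%g.
Proof.
apply/permP => u; rewrite permM.
have [/codomP[i ->]|uf] := boolP (u \in codom f); last by rewrite !extend_perm_out.
by rewrite !extend_permE permM.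
Qed.

Lemma extend_perm1 : extend_perm 1%g = 1%g.
Proof.
apply/permP => u; rewrite perm1.
have [/codomP[i ->]|uf] := boolP (u \in codom f); last by rewrite extend_perm_out.
by rewrite extend_permE perm1.
Qed.

Lemma extend_tperm i j : extend_perm (tperm i j) = tperm (f i) (f j).
Proof.
apply/permP => u.
have [/codomP[k ->]|uf] := boolP (u \in codom f).
  rewrite extend_permE; case: tpermP => [->|->|ki kj]; rewrite ?tpermL ?tpermR //.
  by rewrite tpermD // (inj_eq f_inj) eq_sym; apply/eqP.
rewrite extend_perm_out // tpermD //; apply: contraNneq uf => <-; exact: codom_f.
Qed.

(** The extension is multiplicative and sends transpositions to transpositions. *)
Lemma odd_extend_perm s : extend_perm s = s :> bool.
Proof.
case: (prod_tpermP s) => ts -> dts; rewrite odd_perm_prod //.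
have -> : extend_perm (\prod_(t <- ts) tperm t.1 t.2) =
   (\prod_(t <- [seq (f u.1, f u.2) | u <- ts]) tperm t.1 t.2)%g.
  elim: ts {dts} => [|u ts IH]; first by rewrite !big_nil extend_perm1.
  by rewrite /= !big_cons extend_permM extend_tperm IH.
rewrite odd_perm_prod ?size_map // all_map; apply: sub_all dts => u.
by rewrite /dpair /= (inj_eq f_inj).
Qed.

(** The extension is injective into the permutations supported on [I], and there are [d!] on both
    sides. *)
Lemma sum_perm_on (V : nmodType) (I : {set T}) (G : {perm T} -> V) :
  I = [set f i | i : 'I_d] ->
  \sum_(s : {perm T} | perm_on I s) G s = \sum_(s : 'S_d) G (extend_perm s).
Proof.
move=> IE; rewrite -[RHS](big_imset G (in2W extend_perm_inj)) /=.
apply: eq_bigl => s.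
suff -> : [set extend_perm t | t : 'S_d] = [set s | perm_on I s] by rewrite inE.
apply/eqP; rewrite eqEcard; apply/andP; split.
  apply/subsetP => _ /imsetP[t _ ->]; rewrite inE; apply/subsetP => u.
  rewrite inE; apply: contraR => uI; rewrite extend_perm_out //.
  apply: contraNN uI => /codomP[i ->]; rewrite IE; exact: imset_f.
rewrite [in leqRHS]card_imset; last exact: extend_perm_inj.
by rewrite cardsE card_perm IE card_imset // card_ord card_Sn.
Qed.

End ExtendPerm.

Section Alternant.
Variables (A : nzRingType) (T : Type) (e : T -> T -> nat -> A).

Definition alternant d (a b : 'I_d -> T) k : A :=
  \sum_(s : 'S_d) (-1) ^+ s * \prod_(i < d) e (a (s i)) (b i) (k + i).

(** The permutations are grouped by the image [i] of [ord0]. The factor of the first column stands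
    leftmost, so no generators have to be interchanged. *)
Lemma alternant_expand d (a b : 'I_d.+1 -> T) k :
  alternant a b k =
  \sum_(i < d.+1) (-1) ^+ i * (e (a i) (b ord0) k *
     alternant (a \o lift i) (b \o lift ord0) k.+1).
Proof.
have inj : injective (fun x : 'I_d.+1 * 'S_d => lift_perm ord0 x.1 x.2).
  move=> [i s] [j t] /= E; have ij : i = j by rewrite -(lift_perm_id ord0 i s) E lift_perm_id.
  rewrite -ij in E *; congr (_, _); apply/permP => u.
  by apply: (@lift_inj _ i); rewrite -!(lift_perm_lift ord0) E.
have bij : bijective (fun x : 'I_d.+1 * 'S_d => lift_perm ord0 x.1 x.2).
  by apply: inj_card_bij => //; rewrite card_prod card_ord !card_Sn factS.
rewrite /alternant (reindex _ (onW_bij _ bij)) /=.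
rewrite -(pair_bigA _ (fun i s => (-1) ^+ (lift_perm ord0 i s : bool) *
   \prod_(j < d.+1) e (a (lift_perm ord0 i s j)) (b j) (k + j))) /=.
apply: eq_bigr => i _; rewrite !mulr_sumr; apply: eq_bigr => s _.
rewrite odd_lift_perm big_ord_recl lift_perm_id addn0 signr_addb /=.
rewrite (eq_bigr (fun j => e ((a \o lift i) (s j)) ((b \o lift ord0) j) (k.+1 + j))); last first.
  by move=> j _; rewrite lift_perm_lift /= /bump leq0n addnA addn1.
have cs : e (a i) (b ord0) k * (-1) ^+ s = (-1) ^+ s * e (a i) (b ord0) k.
  exact: commr_sign.
by rewrite signr_odd -!mulrA; congr (_ * _); rewrite !mulrA cs.
Qed.
End Alternant.

Section Increasing.
Variables (n : nat).

Definition increasing d (a : 'I_d -> 'I_n) := forall i j : 'I_d, (i < j)%N -> (a i < a j)%N.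

Lemma increasing_inj d (a : 'I_d -> 'I_n) : increasing a -> injective a.
Proof.
move=> ia i j aij; apply: val_inj; case: (ltngtP i j) => // /ia; rewrite aij ltnn //.
Qed.

Lemma increasing_lift d (a : 'I_d.+1 -> 'I_n) i : increasing a -> increasing (a \o lift i).
Proof.
move=> ia j k jk; apply: ia => /=; rewrite /bump.
case: (leqP i j) => ij; case: (leqP i k) => ik; rewrite ?add0n ?add1n ?ltnS //; last exact: ltnW.
by have := leq_trans ik (leq_trans ij (ltnW jk)); rewrite ltnn.
Qed.

(** It matches the sign of [alternant_expand] with that of [pair_prodD1]. *)
Lemma increasing_count d (a : 'I_d -> 'I_n) i : increasing a ->
  #|[set j in [set a k | k : 'I_d] | (j < a i)%N]| = i.
Proof.
move=> ia; have ai := increasing_inj ia.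
have -> : [set j in [set a k | k : 'I_d] | (j < a i)%N] = [set a k | k : 'I_d & (k < i)%N].
  apply/setP => j; rewrite !inE; apply/andP/imsetP => [[/imsetP[k _ ->] kai]|[k]].
    exists k => //; rewrite inE; case: (ltngtP k i) => // [/ia|/val_inj ki].
      by rewrite ltnNge ltnW.
    by rewrite ki ltnn in kai.
  by rewrite inE => /ia ki ->; rewrite ki imset_f.
rewrite card_imset // -[RHS](card_ord i).
have wi : (i <= d)%N by exact: ltnW.
have -> : [set k : 'I_d | (k < i)%N] = [set widen_ord wi k | k : 'I_i].
  apply/setP => k; rewrite inE; apply/idP/imsetP => [ki|[l _ ->]]; last exact: (ltn_ord l).
  by exists (Ordinal ki) => //; apply: val_inj.
by rewrite card_imset // => k l /(congr1 val) /= /val_inj.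
Qed.

Lemma sorted_enum_ord m : sorted (fun j k : 'I_m => (j < k)%N) (enum 'I_m).
Proof.
have -> : (fun j k : 'I_m => (j < k)%N) = relpre (val : 'I_m -> nat) ltn by [].
by rewrite -sorted_map val_enum_ord iota_ltn_sorted.
Qed.

Lemma sorted_enum (I : {set 'I_n}) : sorted (fun j k : 'I_n => (j < k)%N) (enum I).
Proof.
rewrite {1}/enum_mem; apply: sorted_filter => [u v w|]; first exact: ltn_trans.
by have := sorted_enum_ord n; rewrite enumT.
Qed.

Lemma increasing_enum (I : {set 'I_n}) (a : 'I_#|I| -> 'I_n) :
  increasing a -> I = [set a i | i : 'I_#|I|] -> a =1 enum_val.
Proof.
move=> ia IE i; have ai := increasing_inj ia.
have srt := sorted_enum I.
have srt' : sorted (fun j k : 'I_n => (j < k)%N) (codom a).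
  rewrite codomE sorted_map; apply: sub_sorted (sorted_enum_ord _) => j k; exact: ia.
have E : enum I = codom a.
  apply: (irr_sorted_eq (leT := fun j k : 'I_n => (j < k)%N)) => //.
  - by move=> u v w; exact: ltn_trans.
  - by move=> u; exact: ltnn.
  by move=> u; rewrite mem_enum {1}IE; apply/imsetP/codomP => [[k _ ->]|[k ->]]; exists k.
have x0 := a i.
rewrite (enum_val_nth x0) E codomE (nth_map i) ?size_enum_ord //.
by rewrite nth_ord_enum.
Qed.

Lemma increasing_enum_val (I : {set 'I_n}) : increasing (enum_val : 'I_#|I| -> 'I_n).
Proof.
move=> i j ij; rewrite (enum_val_nth (enum_val i)) (enum_val_nth (enum_val i) j).
have srt := sorted_enum I.
apply: (sorted_ltn_nth _ _ srt) => //; last 2 first.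
- by rewrite inE -cardE.
- by rewrite inE -cardE.
by move=> u v w; exact: ltn_trans.
Qed.

Lemma increasing_exists (I : {set 'I_n}) d : #|I| = d ->
  exists2 a : 'I_d -> 'I_n, increasing a & I = [set a i | i : 'I_d].
Proof.
move=> <-; exists enum_val; first exact: increasing_enum_val.
apply/setP => t; apply/idP/imsetP => [tI|[i _ ->]]; last exact: enum_valP.
by exists (enum_rank_in tI t); rewrite ?enum_rankK_in.
Qed.

End Increasing.

(** * Expansion of a minor along its first column *)

Section MinorExpansion.
Variables (A : nzRingType) (K : comNzRingType) (n : nat).
Local Notation T := 'I_n.
Variables (l r : {rmorphism K -> A}) (sh : T -> {rmorphism K -> K}).
Variable e : T -> T -> nat -> A.
Variable y : T -> T -> K.
Variable D : {set T} -> {set T} -> nat -> A.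
Variable Fp : {set T} -> K.

Local Notation sr := (signum y).

Hypothesis lrC : forall f g, l f * r g = r g * l f.
Hypothesis e_l : forall a b k f, e a b k * l f = l (sh a f) * e a b k.
Hypothesis e_r : forall a b k f, e a b k * r f = r (sh b f) * e a b k.
Hypothesis yN : forall a c, y c a = - y a c.
Hypothesis shy : forall a i j, a != i -> a != j -> sh a (y i j) = y i j.

(** For [y j k = 1 / [zeta_jk]] this is the reciprocal of [F^I]. *)
Definition pair_prod (I : {set T}) : K := \prod_(j in I) \prod_(k in I | (j < k)%N) y j k.

Hypothesis FpV : forall I, Fp I * pair_prod I = 1.
Hypothesis Dcard : forall (I J : {set T}) k, #|I| != #|J| -> D I J k = 0.
Hypothesis D_alternant : forall d (a b : 'I_d -> T) k, increasing a -> increasing b ->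
  D [set a i | i : 'I_d] [set b i | i : 'I_d] k =
  r (Fp [set b i | i : 'I_d]) * l (pair_prod [set a i | i : 'I_d]) * alternant e a b k.

(** Writing every factor that involves [a] as [y a k] costs one sign for each element of [I] below
    [a]. *)
Lemma pair_prodD1 (I : {set T}) a : a \in I ->
  pair_prod I = (-1) ^+ #|[set j in I | (j < a)%N]| * sr [set a] (I :\ a) * pair_prod (I :\ a).
Proof.
move=> aI; pose g (j k : T) : K := if (j < k)%N then y j k else 1.
have gE J : pair_prod J = \prod_(j in J) \prod_(k in J) g j k.
  by apply: eq_bigr => j _; rewrite big_mkcondr.
rewrite !gE (big_setD1 a) //= (big_setD1 a) //= {1}/g ltnn mul1r.
rewrite [X in _ * X](eq_bigr (fun j => g j a * \prod_(k in I :\ a) g j k)); last first.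
  by move=> j _; rewrite (big_setD1 a).
rewrite big_split /= mulrA; congr (_ * _).
rewrite -big_split /= /signum big_set1.
have -> : (-1) ^+ #|[set j in I | (j < a)%N]| =
    \prod_(k in I :\ a) (if (k < a)%N then -1 else 1) :> K.
  rewrite -prodr_const -[RHS]big_mkcondr; apply: eq_bigl => k; rewrite !inE.
  by case: (eqVneq k a) => [->|_] /=; rewrite ?ltnn ?andbF.
rewrite -big_split /=; apply: eq_bigr => k; rewrite !inE => /andP[ka _].
rewrite /g; case: (ltngtP a k) => [ak|ak|/val_inj ak]; last by rewrite ak eqxx in ka.
  by rewrite mulr1 mul1r.
by rewrite mul1r mulN1r (yN a k).
Qed.

Lemma sh_pair_prod a (I : {set T}) : a \notin I -> sh a (pair_prod I) = pair_prod I.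
Proof.
move=> aI; rewrite /pair_prod rmorph_prod; apply: eq_bigr => j jI.
rewrite rmorph_prod; apply: eq_bigr => k /andP[kI _].
by apply: shy; apply: contraNneq aI => ->.
Qed.

Lemma sh_Fp a (I : {set T}) : a \notin I -> sh a (Fp I) = Fp I.
Proof.
move=> aI; have FV := FpV I.
have : sh a (Fp I) * pair_prod I = 1.
  by rewrite -[X in _ * X](sh_pair_prod aI) -rmorphM FV rmorph1.
by move=> E; rewrite -[LHS]mulr1 -FV mulrCA E mulr1.
Qed.

Lemma D_expand_first (I J : {set T}) (b : T) k : (forall j : T, j \in J -> (b < j)%N) ->
  r (sr [set b] J) * D I (b |: J) k =
  \sum_(a in I) l (sr [set a] (I :\ a)) * e a b k * D (I :\ a) J k.+1.
Proof.
move=> bJ; have bnJ : b \notin J by apply/negP => /bJ; rewrite ltnn.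
have [cI|cI] := eqVneq #|I| #|J|.+1; last first.
  rewrite Dcard ?mulr0; last by rewrite cardsU1 bnJ.
  rewrite big1 // => a aI; rewrite Dcard ?mulr0 //; apply: contraNneq cI => <-.
  by rewrite (cardsD1 a I) aI.
have [d cJ] : exists d, #|J| = d by exists #|J|.
rewrite cJ in cI.
have [a ia IE] := increasing_exists cI.
have [b' ib' JE] := increasing_exists cJ.
pose bb (i : 'I_(d.+1)) := if unlift ord0 i is Some j then b' j else b.
have bb0 : bb ord0 = b by rewrite /bb unlift_none.
have bbl j : bb (lift ord0 j) = b' j by rewrite /bb liftK.
have ibb : increasing bb.
  move=> i j; case: (unliftP ord0 i) => [i' ->|->]; case: (unliftP ord0 j) => [j' ->|->] //.
    by rewrite !bbl => ij; apply: ib'.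
  by rewrite bb0 bbl => _; apply: bJ; rewrite JE imset_f.
have bJE : b |: J = [set bb i | i : 'I_(d.+1)].
  apply/setP => t; rewrite in_setU1; apply/orP/imsetP => [[/eqP->|tJ]|[i _ ->]].
  - by exists ord0; rewrite ?bb0.
  - by move: tJ; rewrite {1}JE => /imsetP[j _ ->]; exists (lift ord0 j); rewrite ?bbl.
  case: (unliftP ord0 i) => [j ->|->]; [right|left]; last by rewrite bb0.
  by rewrite bbl JE imset_f.
have ainj := increasing_inj ia.
rewrite bJE {1}IE D_alternant // -bJE -IE alternant_expand bb0 !mulrA -rmorphM.
(* As [b] precedes all of [J], no sign occurs. *)
have -> : sr [set b] J * Fp (b |: J) = Fp J.
  have := pair_prodD1 (setU11 b J); rewrite setU1K //.
  rewrite (_ : #|[set j in b |: J | (j < b)%N]| = 0%N) ?expr0 ?mul1r => [PE|]; last first.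
    apply/eqP; rewrite cards_eq0; apply/eqP/setP => j; rewrite !inE.
    case: (eqVneq j b) => [->|_] /=; first by rewrite ltnn.
    by apply/negbTE/negP => /andP[/bJ bj jb]; have := ltn_trans bj jb; rewrite ltnn.
  have h1 := FpV (b |: J); have h2 := FpV J; rewrite PE in h1.
  move: (sr _ _) (Fp (b |: J)) (Fp J) (pair_prod J) h1 h2 => u v w t vut wt.
  have E : u * v * (w * t) = w * (v * (u * t)) by ring.
  by rewrite -[LHS]mulr1 -wt E vut mulr1.
rewrite [in RHS]IE big_imset /=; last exact: in2W.
rewrite mulr_sumr; apply: eq_bigr => i _.
have aiI : a i \in I by rewrite IE imset_f.
have IaE : I :\ a i = [set (a \o lift i) j | j : 'I_d].
  apply/setP => t; rewrite IE !inE; apply/andP/imsetP => [[ta /imsetP[j _ tj]]|[j _ ->]].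
    rewrite tj in ta *; case: (unliftP i j) ta => [j' ->|->]; last by rewrite eqxx.
    by move=> _; exists j'.
  by rewrite /= (inj_eq ainj) eq_sym neq_lift; split=> //; apply: imset_f.
have bb'E : alternant e (a \o lift i) (bb \o lift ord0) k.+1 = alternant e (a \o lift i) b' k.+1.
  apply: eq_bigr => s _; congr (_ * _); apply: eq_bigr => j _.
  by rewrite /= bbl.
rewrite -IE bb'E [in RHS]IaE JE D_alternant //; last exact: increasing_lift.
rewrite -JE -IaE.
have aiIa : a i \notin I :\ a i by rewrite !inE eqxx.
rewrite !mulrA -[_ * e (a i) b k * r _]mulrA e_r sh_Fp // !mulrA lrC.
rewrite -[_ * e (a i) b k * l _]mulrA e_l sh_pair_prod // !mulrA.
rewrite -[r _ * l _ * l _]mulrA -rmorphM.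
(* Exactly [i] elements of [I] lie below [a i], so this sign cancels the one from
   [alternant_expand]. *)
have -> : pair_prod I = (-1) ^+ i * (sr [set a i] (I :\ a i) * pair_prod (I :\ a i)).
  rewrite (pair_prodD1 aiI) -mulrA; congr (_ ^+ _ * _).
  by rewrite IE increasing_count.
set u := sr _ _ * pair_prod _.
have -> : l ((-1) ^+ i * u) = (-1) ^+ i * l u by rewrite rmorphM rmorphXn rmorphN1.
have cs (v : A) : v * (-1) ^+ i = (-1) ^+ i * v by exact: commr_sign.
by rewrite -mulrA -cs !mulrA -[_ * (-1) ^+ i * (-1) ^+ i]mulrA -expr2 sqrr_sign mulr1.
Qed.

End MinorExpansion.

(** * The summation identity and the finite triple product *)

Section BracketSum.
Variables (F : fieldType) (br : F -> F).
Hypothesis br0 : br 0 = 0.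
Hypothesis brN : forall x, br (- x) = - br x.
Hypothesis three_term : forall m s t,
  br (m - 1) * br t * (br (s + m) * br (s - t - 1)) =
  br m * br (t + 1) * (br (s - t) * br (s + m - 1))
  - br 1 * br (t + m) * (br s * br (s - t + m - 1)).
Hypothesis br_nat : forall m, br m.+1%:R != 0.

Let h u := br (u + 1) / br (- u).

(** One point [c] is removed. With [s = x a - x0] and [t = x c - x0], the three-term identity splits
    the summand of every other [a] into the corresponding summands for [Z :\ c] at the base points
    [x c] and [x0]. *)
Lemma bracket_sum (T : finType) (x : T -> F) (Z : {set T}) (x0 : F) :
    {in Z &, forall a b, a != b -> br (x a - x b) != 0} ->
    {in Z, forall a, br (x a - x0) != 0} ->
  \sum_(a in Z) (\prod_(j in Z :\ a) h (x j - x a)) * br 1 * (br (x a - x0 + #|Z|%:R) / br (x a - x0))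
  = - br #|Z|%:R * \prod_(j in Z) h (x j - x0).
Proof.
have [m] := ubnP #|Z|; elim: m => // m IH in Z x0 *; rewrite ltnS => Zm xZ xx0.
have [Z0|Zpos] := posnP #|Z|.
  move/eqP: (Z0); rewrite cards_eq0 => /eqP->.
  by rewrite !big_set0 cards0 mulr0n br0 oppr0 mul0r.
have [c cZ] : exists c, c \in Z by apply/set0Pn; rewrite -card_gt0.
pose Z' := Z :\ c; have cZ' : c \notin Z' by rewrite !inE eqxx.
have cardZ : #|Z| = #|Z'|.+1 by rewrite (cardsD1 c Z) cZ.
have Z'Z a : a \in Z' -> a \in Z by rewrite inE => /andP[].
have t0 := xx0 c cZ.
have ht : h (x c - x0) = - (br (x c - x0 + 1) / br (x c - x0)).
  by rewrite /h brN invrN mulrN.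
rewrite (big_setD1 c) //= -/Z' [in RHS](big_setD1 c) //= -/Z' ht.
have IHx y : {in Z', forall a, br (x a - y) != 0} ->
    \sum_(a in Z') (\prod_(j in Z' :\ a) h (x j - x a)) * br 1 *
      (br (x a - y + #|Z'|%:R) / br (x a - y)) = - br #|Z'|%:R * \prod_(j in Z') h (x j - y).
  move=> xy; apply: IH => //; first by rewrite -cardZ.
  by move=> a b /Z'Z aZ /Z'Z bZ; exact: xZ.
(* A single point is treated apart, since the inductive step divides by [br #|Z'|%:R]. *)
have [Z'0|Z'pos] := posnP #|Z'|.
  move/eqP: (Z'0); rewrite cards_eq0 => /eqP Z'E.
  by rewrite cardZ Z'E cards0 !big_set0 addr0 !mul1r mulr1 mulrN mulNr opprK.
have m0 : br #|Z'|%:R != 0 by case: #|Z'| Z'pos => // k _; exact: br_nat.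
pose t := x c - x0; rewrite -/t in t0 ht *.
apply: (mulfI m0); apply: (mulfI t0).
(* The part with base point [x c] cancels the summand of [c] itself; the part with base point [x0]
   is the required product. *)
have sumE : br t * (br #|Z'|%:R * \sum_(a in Z') (\prod_(j in Z :\ a) h (x j - x a)) * br 1 *
      (br (x a - x0 + #|Z|%:R) / br (x a - x0)))
  = br 1 * br (t + #|Z|%:R) * (- br #|Z'|%:R * \prod_(j in Z') h (x j - x c))
    - br #|Z|%:R * br (t + 1) * (- br #|Z'|%:R * \prod_(j in Z') h (x j - x0)).
  rewrite -!IHx; last 2 first.
  - by move=> a /Z'Z; exact: xx0.
  - by move=> a aZ'; apply: xZ => //; [exact: Z'Z|apply: contraNneq cZ' => <-].
  rewrite mulr_sumr !mulr_sumr -sumrB; apply: eq_bigr => a aZ'.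
  have ac : a != c by apply: contraNneq cZ' => <-.
  have ZaE : Z :\ a :\ c = Z' :\ a by rewrite /Z' !setDDl setUC.
  rewrite (big_setD1 c) /= ?inE 1?eq_sym ?ac // ZaE.
  pose s := x a - x0.
  have s0 : br s != 0 by apply: xx0; exact: Z'Z.
  have st0 : br (s - t) != 0.
    by rewrite /s /t opprB addrA subrK; apply: xZ => //; exact: Z'Z.
  have -> : h (x c - x a) = - (br (s - t - 1) / br (s - t)).
    rewrite /h (_ : x c - x a + 1 = - (s - t - 1)); last by rewrite /s /t; ring.
    by rewrite (_ : - (x c - x a) = s - t) ?brN ?mulNr // /s /t; ring.
  have -> : x a - x c = s - t by rewrite /s /t; ring.
  rewrite -/s; have := three_term #|Z|%:R s t.
  have -> : #|Z|%:R - 1 = #|Z'|%:R :> F by rewrite cardZ -natr1 addrK.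
  have -> : s - t + #|Z|%:R - 1 = s - t + #|Z'|%:R by rewrite cardZ -natr1; ring.
  have -> : s + #|Z|%:R - 1 = s + #|Z'|%:R by rewrite cardZ -natr1; ring.
  move: s0 st0 (\prod_(j in Z' :\ a) _) => s0 st0 u tt.
  apply: (mulfI s0); apply: (mulfI st0).
  transitivity (- u * br 1 * (br #|Z'|%:R * br t * (br (s + #|Z|%:R) * br (s - t - 1)))).
    by field; rewrite s0 st0.
  by rewrite tt; field; rewrite s0 st0.
rewrite [in LHS]mulrDr [in LHS]mulrDr sumE; field.
by [].
Qed.

End BracketSum.

Lemma bin2D m k : 'C(m + k, 2) = ('C(m, 2) + 'C(k, 2) + m * k)%N.
Proof.
elim: k => [|k IH]; first by rewrite addn0 muln0 bin0n !addn0.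
by rewrite addnS !binS !bin1 IH; lia.
Qed.

Lemma mul_bin2 m : (m * m = 'C(m, 2) + 'C(m, 2) + m)%N.
Proof. by elim: m => // m IH; rewrite binS bin1 mulSn mulnS IH; lia. Qed.

Lemma sum_fold (F : fieldType) (f : nat -> F) m : \sum_(0 <= i < (2 * m).+1) f i =
  f m + \sum_(1 <= k < m.+1) (f (m + k)%N + f (m - k)%N).
Proof.
elim: m f => [|m IH] f; first by rewrite muln0 big_nat1 big_geq // addr0.
rewrite (_ : (2 * m.+1).+1 = ((2 * m).+1).+2)%N; last by lia.
rewrite big_nat_recr //= big_nat_recl //= IH [in RHS]big_nat_recr //=.
rewrite subnn (_ : m.+1 + m.+1 = (2 * m).+2)%N; last by lia.
rewrite (_ : \sum_(1 <= k < m.+1) (f (m + k).+1 + f (m - k).+1) =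
  \sum_(1 <= k < m.+1) (f (m.+1 + k)%N + f (m.+1 - k)%N)); first by ring.
by apply: eq_big_nat => k /andP[_]; rewrite ltnS => km; rewrite addSn subSn.
Qed.

(** * Gaussian binomials and the finite triple product *)

Section FiniteTripleProduct.
Variables (F : fieldType) (p : F).

(** The q-Pochhammer symbol (p; p)_n; [qbin] is the Gaussian binomial coefficient. *)
Definition poch n : F := \prod_(0 <= j < n) (1 - p ^+ j.+1).

Definition qbin m i : F := if (i <= m)%N then poch m / (poch i * poch (m - i)) else 0.

Hypothesis poch_neq0 : forall n, poch n != 0.

Lemma pochS n : poch n.+1 = poch n * (1 - p ^+ n.+1).
Proof. by rewrite /poch big_nat_recr. Qed.

Lemma poch_factor_neq0 n : 1 - p ^+ n.+1 != 0.
Proof. by have := poch_neq0 n.+1; rewrite pochS mulf_eq0 negb_or => /andP[]. Qed.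

Lemma qbin0 m : qbin m 0 = 1.
Proof. by rewrite /qbin subn0 {2}/poch big_geq // mul1r divff. Qed.

Lemma qbinn m : qbin m m = 1.
Proof. by rewrite /qbin leqnn subnn [poch 0]big_geq // mulr1 divff. Qed.

Lemma qbin_gt m i : (m < i)%N -> qbin m i = 0.
Proof. by move=> mi; rewrite /qbin leqNgt mi. Qed.

Lemma qbinS m i : (i <= m)%N -> qbin m.+1 i.+1 = qbin m i.+1 + p ^+ (m - i) * qbin m i.
Proof.
rewrite leq_eqVlt => /predU1P[->|im].
  by rewrite (@qbin_gt m m.+1) // subnn expr0 add0r mul1r !qbinn.
rewrite /qbin ltnS (ltnW im) im subSS.
have -> : (m - i = (m - i.+1).+1)%N by lia.
rewrite !pochS.
have -> : p ^+ m.+1 = p ^+ (m - i.+1).+1 * p ^+ i.+1 by rewrite -exprD; congr (_ ^+ _); lia.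
have := poch_neq0 i; have := poch_neq0 (m - i.+1).
have := poch_factor_neq0 i; have := poch_factor_neq0 (m - i.+1).
set a := p ^+ _; set b := p ^+ _ => *; field.
by do !(apply/andP; split).
Qed.

(** The q-binomial theorem, by the Pascal rule [qbinS]. *)
Lemma qbinomial x m : \prod_(0 <= j < m) (1 - x * p ^+ j) =
  \sum_(0 <= i < m.+1) (-1) ^+ i * p ^+ 'C(i, 2) * qbin m i * x ^+ i.
Proof.
elim: m => [|m IH]; first by rewrite big_geq // big_nat1 qbin0 !mulr1.
rewrite big_nat_recr //= IH mulrBr mulr1 [RHS]big_nat_recl // qbin0.
under [X in _ = _ + X]eq_big_nat => i im.
  rewrite qbinS // mulrDr mulrDl; over.
rewrite big_split /= addrA; congr (_ + _).
  transitivity (\sum_(0 <= i < m.+2) (-1) ^+ i * p ^+ 'C(i, 2) * qbin m i * x ^+ i).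
    by rewrite [RHS]big_nat_recr //= qbin_gt // mulr0 mul0r addr0.
  rewrite [LHS]big_nat_recl //. by rewrite qbin0.
rewrite mulr_suml -sumrN. apply: eq_big_nat => i /= im.
have -> : p ^+ m = p ^+ (m - i) * p ^+ i by rewrite -exprD subnK.
rewrite binS bin1 exprD !exprS; ring.
Qed.

Lemma qbin_double m k : (k <= m)%N -> qbin (2 * m) (m + k) = qbin (2 * m) (m - k).
Proof.
move=> km; rewrite /qbin.
have -> : (m + k <= 2 * m)%N by lia.
have -> : (m - k <= 2 * m)%N by lia.
have -> : (2 * m - (m + k) = m - k)%N by lia.
have -> : (2 * m - (m - k) = m + k)%N by lia.
by rewrite [poch (m + k) * _]mulrC.
Qed.

Hypothesis p_neq0 : p != 0.

(** Paired with [z ^+ k] and with [(p / z) ^+ k] it gives both halves of the series: the factor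
    [p ^+ k] accounts for the exponent ['C(k.+1, 2)] of the negative powers. *)
Definition jcoef k : F := (-1) ^+ k * p ^+ 'C(k, 2).

(** The factor [c] turns each [1 - p ^+ j.+1 / z] into [1 - z / p ^+ j.+1]. The product becomes one
    q-binomial product of [2 * m] factors starting at [z / p ^+ m], and the sum is folded about its
    middle term. *)
Lemma finite_triple_product z m : z != 0 ->
  \prod_(0 <= j < m) ((1 - z * p ^+ j) * (1 - p ^+ j.+1 / z)) =
  qbin (2 * m) m
    + \sum_(1 <= k < m.+1) qbin (2 * m) (m + k) * (jcoef k * (z ^+ k + (p / z) ^+ k)).
Proof.
move=> z0; pose c := \prod_(0 <= j < m) (- z / p ^+ j.+1).
have cE k : \prod_(0 <= j < k) (- z / p ^+ j.+1) = (- z) ^+ k / p ^+ 'C(k.+1, 2).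
  elim: k => [|k IH]; first by rewrite big_geq // divr1.
  by rewrite big_nat_recr //= IH [in RHS]binS bin1 exprD [(- z) ^+ k.+1]exprSr invfM mulrACA.
have c0 : c != 0 by rewrite /c cE mulf_neq0 ?invr_neq0 ?expf_neq0 ?oppr_eq0.
apply: (mulfI c0).
transitivity (\prod_(0 <= j < 2 * m) (1 - z / p ^+ m * p ^+ j)).
  rewrite [RHS](@big_cat_nat _ _ _ m) /=; [|lia|lia].
  rewrite big_split /= [LHS]mulrCA [LHS]mulrC; congr (_ * _).
    rewrite [RHS]big_nat_rev /= -big_split /=; apply: eq_big_nat => j /= jm.
    have -> : p ^+ m = p ^+ (m - j.+1) * p ^+ j.+1 by rewrite -exprD subnK.
    rewrite add0n; field.
    by rewrite z0 !expf_neq0.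
  rewrite -{2}[m]add0n big_addn (_ : 2 * m - m = m)%N; last by lia.
  apply: eq_big_nat => j /= jm; rewrite exprD; field.
  by rewrite expf_neq0.
rewrite qbinomial sum_fold mulrDr mulr_sumr /c cE; congr (_ + _).
  rewrite exprMn exprVn -exprM binS bin1 exprD [(- z) ^+ m]exprNn.
  have -> : p ^+ (m * m) = p ^+ 'C(m, 2) * p ^+ 'C(m, 2) * p ^+ m.
    by rewrite -!exprD -mul_bin2.
  field.
  by rewrite !expf_neq0.
apply: eq_big_nat => k /andP[k0]; rewrite ltnS => km.
rewrite -qbin_double // /jcoef.
have [j mE] : exists j, m = (j + k)%N by exists (m - k)%N; rewrite subnK.
rewrite mE addnK binS bin1 !bin2D.
have skk : (-1) ^+ k * (-1) ^+ k = 1 :> F by rewrite -exprD -signr_odd oddD addbb.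
rewrite [(- z) ^+ (j + k)]exprNn !exprMn !exprVn -!exprM.
rewrite (_ : (j + k) * (j + k + k) = j * j + j * k + j * k + j * k + k * k + k * k)%N; last by nia.
rewrite (_ : (j + k) * j = j * j + j * k)%N; last by nia.
rewrite mulnDl !mul_bin2 !exprD.
set u := p ^+ 'C(j, 2); set v := p ^+ 'C(k, 2); set w := p ^+ (j * k).
set sj := (-1) ^+ j; set sk := (-1) ^+ k; set q := qbin _ _.
rewrite -[X in _ + X = _]mulr1 -skk -/sk.

field.
by rewrite !expf_neq0.
Qed.

End FiniteTripleProduct.

(** * The theta function *)

From mathcomp Require Import complex.
From mathcomp Require Import all_classical all_reals all_analysis.
Import numFieldNormedType.Exports.
Local Open Scope classical_set_scope.
Local Open Scope ring_scope.
Local Open Scope complex_scope.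

(** * Dominated convergence and infinite products over the complex numbers *)

Section ComplexSeries.
Variable R : realType.
Local Notation C := R[i].

(** The norm of a complex number is again complex; its real part allows estimates in the ordered
    field [R]. *)
Definition modulus (z : C) : R := complex.Re `|z|.

Lemma modulusE z : `|z| = (modulus z)%:C.
Proof. by rewrite /modulus normc_def /=. Qed.

Lemma modulus_ge0 z : 0 <= modulus z.
Proof. by rewrite -lecR -modulusE; exact: normr_ge0. Qed.

Lemma modulusM z w : modulus (z * w) = modulus z * modulus w.
Proof. by apply: complexI; rewrite rmorphM /= -!modulusE normrM. Qed.

Lemma modulus1 : modulus 1 = 1.
Proof. by apply: complexI; rewrite -modulusE normr1. Qed.

Lemma modulus0 : modulus 0 = 0.
Proof. by apply: complexI; rewrite -modulusE normr0. Qed.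

Lemma modulusN z : modulus (- z) = modulus z.
Proof. by apply: complexI; rewrite -!modulusE normrN. Qed.

Lemma modulusX z n : modulus (z ^+ n) = modulus z ^+ n.
Proof. by apply: complexI; rewrite rmorphXn /= -!modulusE normrX. Qed.

Lemma modulusV z : modulus z^-1 = (modulus z)^-1.
Proof. by apply: complexI; rewrite fmorphV /= -!modulusE normfV. Qed.

Lemma modulusD z w : modulus (z + w) <= modulus z + modulus w.
Proof. by rewrite -lecR rmorphD /= -!modulusE ler_normD. Qed.

Lemma modulusB z w : modulus z - modulus w <= modulus (z - w).
Proof. by rewrite -lecR rmorphB /= -!modulusE lerB_dist. Qed.

Lemma modulusBC z w : modulus (z - w) = modulus (w - z).
Proof. by rewrite -opprB modulusN. Qed.

Lemma modulus_sum (I : Type) (s : seq I) (P : pred I) (F : I -> C) :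
  modulus (\sum_(i <- s | P i) F i) <= \sum_(i <- s | P i) modulus (F i).
Proof.
by rewrite -lecR rmorph_sum /= -modulusE (le_trans (ler_norm_sum _ _ _)).
Qed.

Lemma modulus_prod (I : Type) (s : seq I) (P : pred I) (F : I -> C) :
  modulus (\prod_(i <- s | P i) F i) = \prod_(i <- s | P i) modulus (F i).
Proof. by elim/big_ind2: _ => [|x a y b <- <-|//]; rewrite ?modulus1 ?modulusM. Qed.

Lemma modulus_real (x : R) : modulus x%:C = `|x|.
Proof. by rewrite /modulus normc_def /= expr0n addr0 sqrtr_sqr. Qed.

Lemma modulus_eq0 z : (modulus z == 0) = (z == 0).
Proof.
apply/eqP/eqP => [z0|->]; last exact: modulus0.
by apply: normr0_eq0; rewrite modulusE z0.
Qed.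

Lemma modulus_gt0 z : (0 < modulus z) = (z != 0).
Proof. by rewrite lt_def modulus_ge0 andbT modulus_eq0. Qed.

Lemma modulus_Re z : `|complex.Re z| <= modulus z.
Proof. by rewrite -lecR -modulusE normc_ge_Re. Qed.

Lemma modulus_Im z : `|complex.Im z| <= modulus z.
Proof.
rewrite /modulus normc_def /= -[leLHS]sqrtr_sqr ler_wsqrtr //.
by rewrite lerDr sqr_ge0.
Qed.

Lemma modulus_le_ReIm z : modulus z <= `|complex.Re z| + `|complex.Im z|.
Proof.
rewrite [z in leLHS]complexE (le_trans (modulusD _ _)) // modulusM !modulus_real.
by rewrite (_ : modulus 'i = 1) ?mul1r // /modulus normc_def /= expr0n expr1n add0r sqrtr1.
Qed.

Lemma gt0_complexE (e : C) : 0 < e -> exists2 r : R, 0 < r & e = r%:C.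
Proof.
case: e => a b; rewrite ltcE /= => /andP[/eqP-> a0].
by exists a => //; rewrite -complexr0.
Qed.

Lemma cvg_modulusP (u : nat -> C) (l : C) : (u @ \oo --> l) <->
  (forall e : R, 0 < e -> exists N, forall n, (N <= n)%N -> modulus (l - u n) <= e).
Proof.
split=> [/cvgrPdist_le H e e0|H].
  have := H e%:C; rewrite ltcR => /(_ e0)[N _ HN]; exists N => n Nn.
  by have := HN n Nn; rewrite modulusE lecR.
apply/cvgrPdist_le => e /gt0_complexE[r r0 ->].
have [N HN] := H r r0; exists N => // n /= Nn; rewrite modulusE lecR; exact: HN.
Qed.

Lemma cvg_complex_unique (u : nat -> C) (a b : C) : u @ \oo --> a -> u @ \oo --> b -> a = b.
Proof. by move=> ua ub; apply: (cvg_unique _ ua ub); exact: norm_hausdorff. Qed.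

Lemma cvg_complex_lim (u : nat -> C) (l : C) : u @ \oo --> l -> lim (u @ \oo) = l.
Proof. by move=> ul; apply/cvg_lim => //; exact: norm_hausdorff. Qed.

Lemma cvg_ReIm (u : nat -> C) (a b : R) :
  (fun n => complex.Re (u n)) @ \oo --> a -> (fun n => complex.Im (u n)) @ \oo --> b ->
  u @ \oo --> a +i* b.
Proof.
move=> /cvgrPdist_le ua /cvgrPdist_le ub; apply/cvg_modulusP => e e0.
have e2 : 0 < e / 2 by rewrite divr_gt0.
have [N _ HN] := ua _ e2; have [M _ HM] := ub _ e2.
exists (maxn N M) => n; rewrite geq_max => /andP[/HN /= h1 /HM /= h2].
apply: (le_trans (modulus_le_ReIm _)).
by case: (u n) h1 h2 => c d /= h1 h2; rewrite [e]splitr lerD.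
Qed.

Definition rapid (v : nat -> C) := exists Q : R, forall k, modulus (v k) <= Q * 2^-1 ^+ k.

Lemma half_series_cvg (Q : R) (f : nat -> R) : (forall k, `|f k| <= Q * 2^-1 ^+ k) ->
  cvg (series f @ \oo).
Proof.
move=> fQ; apply: normed_cvg; apply: (@series_le_cvg _ _ (geometric Q 2^-1)).
- by move=> k /=.
- by move=> k; apply: le_trans (fQ k).
- by move=> k /=.
by apply: is_cvg_geometric_series; rewrite ger0_norm ?invr_ge0 // invf_lt1 // ltr1n.
Qed.

Lemma rapid_cvg v : rapid v -> cvg (series v @ \oo).
Proof.
move=> [Q vQ].
have cR : cvg (series (fun k => complex.Re (v k)) @ \oo).
  by apply: (@half_series_cvg Q) => k; apply: le_trans (vQ k); exact: modulus_Re.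
have cI : cvg (series (fun k => complex.Im (v k)) @ \oo).
  by apply: (@half_series_cvg Q) => k; apply: le_trans (vQ k); exact: modulus_Im.
apply/cvg_ex; eexists; apply: (cvg_ReIm (u := series v)).
  rewrite (_ : (fun n => _) = series (fun k => complex.Re (v k))); first exact: cR.
  by apply/funext => n; rewrite /series /= raddf_sum.
rewrite (_ : (fun n => _) = series (fun k => complex.Im (v k))); first exact: cI.
by apply/funext => n; rewrite /series /= raddf_sum.
Qed.

Lemma geometric_tail (Q t : R) m n : 0 <= Q -> 0 <= t < 1 ->
  \sum_(m <= k < n) Q * t ^+ k <= Q * t ^+ m / (1 - t).
Proof.
move=> Q0 /andP[t0 t1]; have t10 : 0 < 1 - t by rewrite subr_gt0.
have pos k : 0 <= Q * t ^+ k / (1 - t) by rewrite divr_ge0 ?mulr_ge0 ?exprn_ge0 // ltW.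
have [nm|/ltnW mn] := leqP n m; first by rewrite big_geq.
suff -> : \sum_(m <= k < n) Q * t ^+ k = Q * t ^+ m / (1 - t) - Q * t ^+ n / (1 - t).
  by rewrite lerBlDr lerDl.
rewrite -opprB -(telescope_sumr (fun k => Q * t ^+ k / (1 - t)) mn) -sumrN.
apply: eq_bigr => k _; rewrite exprS; field.
by rewrite gt_eqF.
Qed.

Lemma geometric_small (Q t e : R) : 0 <= t < 1 -> 0 < e ->
  exists m, forall k, (m <= k)%N -> Q * t ^+ k <= e.
Proof.
move=> /andP[t0 t1] e0; have t1' : `|t| < 1 by rewrite ger0_norm.
have /cvgrPdist_le/(_ e e0)[m _ Hm] := cvg_geometric Q t1'.
exists m => k /Hm /=; rewrite sub0r normrN; apply: le_trans; exact: ler_norm.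
Qed.

Lemma cvg_reindex (u : nat -> C) (l : C) (f : nat -> nat) : u @ \oo --> l ->
  (forall m, exists N, forall n, (N <= n)%N -> (m <= f n)%N) -> (u \o f) @ \oo --> l.
Proof.
move=> /cvg_modulusP ul fo; apply/cvg_modulusP => e /ul[m Hm].
by have [N HN] := fo m; exists N => n /HN; exact: Hm.
Qed.

Lemma rapid_bound v : rapid v -> exists2 Q : R, 0 <= Q & forall k, modulus (v k) <= Q * 2^-1 ^+ k.
Proof.
move=> [Q vQ]; exists Q => //; have := vQ 0%N; rewrite expr0 mulr1.
by apply: le_trans; exact: modulus_ge0.
Qed.

Let half_lt1 : 0 <= (2^-1 : R) < 1.
Proof. by rewrite invr_ge0 ler0n invf_lt1 ?ltr1n ?ltr0n. Qed.

(** Dominated convergence for series whose weights [B N k] are bounded and tend, for each [k], to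
    the same limit [c]. *)
Lemma tannery (B : nat -> nat -> C) (v : nat -> C) (c s : C) (K : R) :
    (forall N k, (k <= N)%N -> modulus (B N k) <= K) ->
    (forall k, B^~ k @ \oo --> c) -> rapid v -> series v @ \oo --> s ->
  (fun N => \sum_(0 <= k < N.+1) B N k * v k) @ \oo --> c * s.
Proof.
move=> BK Bc /rapid_bound[Q Q0 vQ] /cvg_modulusP vs; apply/cvg_modulusP => e e0.
have K0 : 0 <= K by apply: le_trans (BK 0 0 (leqnn _)); exact: modulus_ge0.
pose K' := K + modulus c; have K'0 : 0 <= K' by rewrite addr_ge0 // modulus_ge0.
have e3 : 0 < e / 3 by rewrite divr_gt0.
have [m Hm] := geometric_small (K' * Q * 2) half_lt1 e3.
have [N1 HN1] : exists N, forall n, (N <= n)%N ->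
    modulus (0 - \sum_(0 <= k < m) (B n k - c) * v k) <= e / 3.
  suff /cvg_modulusP/(_ _ e3) : (fun n => \sum_(0 <= k < m) (B n k - c) * v k) @ \oo --> (0 : C).
    by [].
  elim: m {Hm} => [|m IH].
    by under eq_fun do rewrite big_geq //; exact: cvg_cst.
  under eq_fun do rewrite big_nat_recr //=.
  have t0 : (fun n => (B n m - c) * v m) @ \oo --> (0 : C).
    rewrite -(mul0r (v m)) -(subrr c); apply: cvgM; last exact: cvg_cst.
    by apply: cvgB; [exact: Bc|exact: cvg_cst].
  have h := cvgD IH t0; rewrite addr0 in h; exact: h.
have c1 : 0 < modulus c + 1 by rewrite ltr_wpDl // modulus_ge0.
have [N2 HN2] := vs (e / 3 / (modulus c + 1)) (divr_gt0 e3 c1).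
exists (maxn m (maxn N1 N2)) => n; rewrite !geq_max => /and3P[mn N1n N2n].
(* Three errors, each at most [e / 3]: the remainder of the series, the first [m] terms with [m]
   fixed, and the tail, which is dominated geometrically. *)
have -> : c * s - \sum_(0 <= k < n.+1) B n k * v k = c * (s - series v n.+1)
    + ((0 - \sum_(0 <= k < m) (B n k - c) * v k) + \sum_(m <= k < n.+1) (c - B n k) * v k).
  have E a b : \sum_(a <= k < b) (B n k - c) * v k
      = \sum_(a <= k < b) B n k * v k - c * \sum_(a <= k < b) v k.
    by rewrite mulr_sumr -sumrB; apply: eq_bigr => k _; rewrite mulrBl.
  have -> : \sum_(m <= k < n.+1) (c - B n k) * v k = - \sum_(m <= k < n.+1) (B n k - c) * v k.
    by rewrite -sumrN; apply: eq_bigr => k _; rewrite -mulNr opprB.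
  rewrite !E /series /= !(@big_cat_nat _ _ _ m 0 n.+1) //=; try exact: leqW.
  ring.
apply: (le_trans (modulusD _ _)); apply: (@le_trans _ _ (e / 3 + (e / 3 + e / 3))); last by lra.
apply: lerD.
  rewrite modulusM; have := HN2 n.+1 (leqW N2n); rewrite ler_pdivlMr // => H.
  apply: le_trans H; rewrite mulrC ler_wpM2l ?modulus_ge0 //; lra.
apply: (le_trans (modulusD _ _)); apply: lerD; first exact: HN1.
apply: (le_trans (modulus_sum _ _ _)).
apply: (@le_trans _ _ (\sum_(m <= k < n.+1) (K' * Q) * 2^-1 ^+ k)).
  rewrite !big_nat; apply: ler_sum => k /andP[_ kn]; rewrite modulusM -mulrA.
  apply: ler_pM => //; try exact: modulus_ge0.
  by rewrite modulusBC (le_trans (modulusD _ _)) // modulusN lerD // BK.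
apply: (le_trans (geometric_tail _ _ _ half_lt1)); first by rewrite mulr_ge0.
by have := Hm m (leqnn m); rewrite (_ : 1 - 2^-1 = 2^-1) ?invrK //; [lra|field].
Qed.

(** The tail is at least one minus the sum of the moduli of [w j], hence at least 1/2 from some
    index on; the finitely many earlier factors are nonzero. *)
Lemma prod_lower (w : nat -> C) (Q t : R) : 0 <= Q -> 0 <= t < 1 ->
    (forall j, modulus (w j) <= Q * t ^+ j) -> (forall j, w j != 1) ->
  exists2 d : R, 0 < d & forall N, d <= modulus (\prod_(0 <= j < N) (1 - w j)).
Proof.
move=> Q0 t01 wQ w1.
(* Truncation at 1 makes the partial products nonincreasing, so that a bound for late products also
   holds for early ones. *)
pose f j := Num.min 1 (modulus (1 - w j)).
have f0 j : 0 < f j by rewrite lt_min ltr01 modulus_gt0 subr_eq0 eq_sym w1.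
have f1 j : f j <= 1 by rewrite ge_min lexx.
have prod_ge0 m n : 0 <= \prod_(m <= j < n) f j by apply: prodr_ge0 => j _; exact: ltW.
have prod_le1 m n : \prod_(m <= j < n) f j <= 1.
  by apply: prodr_ile1 => j _; rewrite f1 ltW.
have fw m n : 1 - \sum_(m <= j < n) modulus (w j) <= \prod_(m <= j < n) f j.
  elim: n => [|n IH]; first by rewrite !big_geq // subr0.
  have [nm|mn] := ltnP n m; first by rewrite !big_geq // subr0.
  rewrite !big_nat_recr //=.
  have wn : 1 - modulus (w n) <= f n.
    rewrite le_min gerBl modulus_ge0 /= -[X in X - _]modulus1; exact: modulusB.
  have := prod_ge0 m n; have := f0 n; have := modulus_ge0 (w n).
  have : 0 <= \sum_(m <= j < n) modulus (w j) by apply: sumr_ge0 => j _; exact: modulus_ge0.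
  move: IH wn; set S := \sum_(_ <= _ < _) _; set P := \prod_(_ <= _ < _) _.
  set a := modulus _; set b := f n => h1 h2 h3 h4 h5 h6.
  have [a1|a1] := leP a 1; last by apply: (@le_trans _ _ 0); [lra|apply: mulr_ge0; lra].
  have [s1|s1] := leP S 1; last by apply: (@le_trans _ _ 0); [lra|apply: mulr_ge0; lra].
  apply: (@le_trans _ _ ((1 - S) * (1 - a))); last by apply: ler_pM; lra.
  nra.
have half0 : 0 < (2^-1 : R) by rewrite invr_gt0.
have [m Hm] := geometric_small (Q / (1 - t)) t01 half0.
have tail n : 2^-1 <= \prod_(m <= j < n) f j.
  apply: le_trans (fw m n).
  have : \sum_(m <= j < n) modulus (w j) <= 2^-1.
    apply: (@le_trans _ _ (\sum_(m <= j < n) Q * t ^+ j)); first exact: ler_sum.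
    apply: (le_trans (geometric_tail _ _ Q0 t01)).
    by rewrite mulrAC; exact: Hm.
  by move: (\sum_(_ <= _ < _) _) => S; lra.
exists (\prod_(0 <= j < m) f j * 2^-1).
  by rewrite mulr_gt0 // prodr_gt0.
move=> N; rewrite modulus_prod.
apply: (@le_trans _ _ (\prod_(0 <= j < N) f j)); last first.
  by apply: ler_prod => j _; rewrite ltW //= ge_min lexx orbT.
apply: (@le_trans _ _ (\prod_(0 <= j < maxn m N) f j)).
  rewrite [leRHS](@big_cat_nat _ _ _ m) //= ?leq_maxl //.
  by rewrite ler_wpM2l.
rewrite [leLHS](@big_cat_nat _ _ _ N) //= ?leq_maxr //.
by rewrite ger_pMr // prodr_gt0.
Qed.

(** The quotient of consecutive terms of [u] is [p ^+ k * (2 * r)], which is at most 1 from some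
    index [m] on. *)
Lemma theta_weight_bound (p r : R) : 0 < p < 1 -> 0 <= r ->
  exists2 Q : R, 0 <= Q & forall k, p ^+ 'C(k, 2) * r ^+ k <= Q * 2^-1 ^+ k.
Proof.
move=> /andP[p0 p1] r0; pose u k := p ^+ 'C(k, 2) * (2 * r) ^+ k.
have u0 k : 0 <= u k by rewrite mulr_ge0 ?exprn_ge0 ?mulr_ge0 // ltW.
have [|m Hm] := @geometric_small (2 * r) p 1 _ ltr01; first by rewrite p1 ltW.
pose Q := \sum_(0 <= k < m.+1) u k.
have uQ k : (k <= m)%N -> u k <= Q.
  move=> km; rewrite /Q (@big_cat_nat _ _ _ k) //= ?leqW // [X in _ + X]big_ltn ?ltnS //.
  by rewrite addrCA lerDl addr_ge0 // sumr_ge0.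
have Q0 : 0 <= Q by apply: le_trans (uQ 0%N _).
exists Q => // k; have -> : r ^+ k = (2 * r) ^+ k * 2^-1 ^+ k.
  by rewrite -exprMn; congr (_ ^+ _); field.
rewrite mulrA ler_wpM2r ?exprn_ge0 ?invr_ge0 // -/(u k).
have [/uQ//|/ltnW mk] := leqP k m.
rewrite -(subnK mk); elim: (k - m)%N => [|d IH]; first exact: uQ.
apply: le_trans IH; rewrite addSn /u binS bin1 exprD exprS.
have := Hm (d + m)%N (leq_addl _ _); have := u0 (d + m)%N; rewrite /u.
set a := p ^+ _; set b := (2 * r) ^+ _; set c := p ^+ _ => h1 h2.
rewrite (_ : a * c * (2 * r * b) = a * b * (2 * r * c)); last by ring.
by rewrite ler_piMr.
Qed.

End ComplexSeries.

Lemma cvgDC (R : realType) (u v : nat -> R[i]) (a b : R[i]) :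
  u @ \oo --> a -> v @ \oo --> b -> (fun n => u n + v n) @ \oo --> a + b.
Proof. by move=> ua vb; have h := cvgD ua vb; exact: h. Qed.

(** * Theta as a sum of two power series *)

Section ThetaLimit.
Variables (R : realType) (p : R).
Local Notation C := R[i].
Hypothesis p01 : 0 < p < 1.
Let P : C := p%:C.

Let p0 : 0 < p. Proof. by case/andP: p01. Qed.
Let p1 : p < 1. Proof. by case/andP: p01. Qed.
Let P0 : P != 0. Proof. by rewrite -modulus_gt0 modulus_real gtr0_norm. Qed.

Lemma modulusP_exp k : modulus (P ^+ k) = p ^+ k.
Proof. by rewrite modulusX modulus_real gtr0_norm. Qed.

Lemma pochE n : poch P n = (\prod_(0 <= j < n) (1 - p ^+ j.+1))%:C.
Proof.
rewrite /poch rmorph_prod; apply: eq_bigr => j _.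
by rewrite rmorphB rmorphXn rmorph1.
Qed.

Lemma poch_factor_gt0 j : 0 < 1 - p ^+ j.+1.
Proof. by rewrite subr_gt0 exprn_ilt1 // ltW. Qed.

Lemma poch_modulus n : modulus (poch P n) = \prod_(0 <= j < n) (1 - p ^+ j.+1).
Proof.
by rewrite pochE modulus_real gtr0_norm // prodr_gt0 // => j _; exact: poch_factor_gt0.
Qed.

Lemma poch_le1 n : modulus (poch P n) <= 1.
Proof.
rewrite poch_modulus; apply: prodr_ile1 => j _.
by rewrite ltW ?poch_factor_gt0 //= lerBlDr lerDl exprn_ge0 // ltW.
Qed.

Lemma pochP_neq0 n : poch P n != 0.
Proof.
by rewrite -modulus_gt0 poch_modulus prodr_gt0 // => j _; exact: poch_factor_gt0.
Qed.

Lemma poch_lower : exists2 d : R, 0 < d & forall n, d <= modulus (poch P n).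
Proof.
have [|||j|d d0 H] := @prod_lower R (fun j => P ^+ j.+1) 1 p.
- by [].
- by rewrite p1 ltW.
- by move=> j; rewrite modulusP_exp mul1r exprS ler_piMl ?exprn_ge0 // ltW.
- rewrite -subr_eq0 -opprB oppr_eq0 -modulus_gt0 -[1](rmorph1 (real_complex R)).
  rewrite -rmorphXn -rmorphB modulus_real gtr0_norm ?poch_factor_gt0 //.
by exists d.
Qed.

Lemma poch_cvg : exists2 L : C, L != 0 & poch P @ \oo --> L.
Proof.
have [d d0 dP] := poch_lower.
pose u n : R := \prod_(0 <= j < n) (1 - p ^+ j.+1).
have ucvg : cvg (u @ \oo).
  apply: nonincreasing_is_cvgn.
    apply/nonincreasing_seqP => n; rewrite /u big_nat_recr //= ler_piMr //.
      by apply: prodr_ge0 => j _; rewrite ltW ?poch_factor_gt0.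
    by rewrite lerBlDr lerDl exprn_ge0 // ltW.
  by exists d => _ [n _ <-]; rewrite /u -poch_modulus.
have Pcvg : poch P @ \oo --> (lim (u @ \oo))%:C.
  apply/cvg_modulusP => e e0; have /cvgrPdist_le/(_ e e0)[N _ HN] := ucvg.
  by exists N => n Nn; rewrite pochE -rmorphB modulus_real; exact: HN.
exists (lim (u @ \oo))%:C => //.
rewrite -modulus_gt0 modulus_real; apply: (lt_le_trans d0).
apply: le_trans (ler_norm _); apply: limr_ge => //; near=> n.
by rewrite /u -poch_modulus.
Unshelve. all: by end_near. Qed.

(** All three Pochhammer symbols tend to the same nonzero limit, so the limit of the quotient does
    not depend on [k], as [tannery] demands. *)
Lemma qbin_cvg : exists c : C, forall k, (fun N => qbin P (2 * N) (N + k)) @ \oo --> c.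
Proof.
have [L L0 PL] := poch_cvg; exists (L / (L * L)) => k.
have sub f : (forall m, exists N, forall n, (N <= n)%N -> (m <= f n)%N) ->
  (poch P \o f) @ \oo --> L by exact: cvg_reindex.
have h1 : (poch P \o (fun N => 2 * N)%N) @ \oo --> L by apply: sub => m; exists m => n; lia.
have h2 : (poch P \o (fun N => N + k)%N) @ \oo --> L by apply: sub => m; exists m => n; lia.
have h3 : (poch P \o (fun N => N - k)%N) @ \oo --> L.
  by apply: sub => m; exists (m + k)%N => n; lia.
have h : (fun N => poch P (2 * N) / (poch P (N + k) * poch P (N - k))) @ \oo --> L / (L * L).
  apply: cvgM; first exact: h1.
  by apply: cvgV; [rewrite mulf_neq0|apply: cvgM; [exact: h2|exact: h3]].
move/cvg_modulusP in h.
apply/cvg_modulusP => e e0; have [N HN] := h e e0.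
exists (maxn N k) => n; rewrite geq_max => /andP[Nn kn].
rewrite /qbin (_ : (n + k <= 2 * n)%N); last by lia.
rewrite (_ : (2 * n - (n + k) = n - k)%N); last by lia.
exact: HN.
Qed.

(* The constant term is halved because it occurs in both the series in z and the
   series in p / z. *)
Definition hcoef k : C := jcoef P k * (if k == 0%N then 2^-1 else 1).

Lemma hcoef_modulus k : modulus (hcoef k) <= p ^+ 'C(k, 2).
Proof.
rewrite /hcoef /jcoef !modulusM modulusP_exp modulusX modulusN modulus1 expr1n mul1r.
rewrite ler_piMr ?exprn_ge0 ?(ltW p0) //; case: ifP => _; last by rewrite modulus1.
by rewrite modulusV -[2](rmorph_nat (real_complex R)) modulus_real normr_nat invf_le1 // ler1n.
Qed.

(** Geometric domination at every radius, so that the power series with coefficients [a] converges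
    everywhere. *)
Definition entire_coef (a : nat -> C) := forall r : R, 0 <= r ->
  exists2 Q : R, 0 <= Q & forall k, modulus (a k) * r ^+ k <= Q * 2^-1 ^+ k.

Lemma hcoef_entire : entire_coef hcoef.
Proof.
move=> r r0; have [Q Q0 H] := theta_weight_bound p01 r0; exists Q => // k.
by apply: le_trans (H k); rewrite ler_wpM2r ?exprn_ge0 // hcoef_modulus.
Qed.

Lemma entire_rapid a z : entire_coef a -> rapid (fun k => a k * z ^+ k).
Proof.
move=> /(_ _ (modulus_ge0 z))[Q _ H]; exists Q => k.
by rewrite modulusM modulusX.
Qed.

Definition power_sum (a : nat -> C) (z : C) : C := lim (series (fun k => a k * z ^+ k) @ \oo).

Lemma power_sum_cvg a z : entire_coef a ->
  series (fun k => a k * z ^+ k) @ \oo --> power_sum a z.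
Proof. by move=> ea; apply: rapid_cvg; exact: entire_rapid. Qed.

Definition theta_trunc (z : C) (N : nat) : C :=
  \prod_(0 <= j < N) ((1 - z * p%:C ^+ j) * (1 - p%:C ^+ j.+1 / z)).

(** The limit of [finite_triple_product] by [tannery]. That [c] is independent of [z] allows it to
    be absorbed into the functions of [E_plucker]. *)
Lemma theta_cvg_series : exists c : C, forall z, z != 0 ->
  theta_trunc z @ \oo --> c * (power_sum hcoef z + power_sum hcoef (P / z)).
Proof.
have [c qc] := qbin_cvg; exists c => z z0.
have [d d0 dP] := poch_lower.
have h1 := power_sum_cvg (z := z) hcoef_entire.
have h2 := power_sum_cvg (z := P / z) hcoef_entire.
have hs : series (fun k => hcoef k * (z ^+ k + (P / z) ^+ k)) @ \oo -->
    power_sum hcoef z + power_sum hcoef (P / z).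
  have E : series (fun k => hcoef k * (z ^+ k + (P / z) ^+ k)) =
      (fun n => series (fun k => hcoef k * z ^+ k) n + series (fun k => hcoef k * (P / z) ^+ k) n).
    apply/funext => n; rewrite /series /= -big_split /=.
    by apply: eq_bigr => k _; rewrite mulrDr.
  rewrite E; exact: (cvgDC h1 h2).
have hr : rapid (fun k => hcoef k * (z ^+ k + (P / z) ^+ k)).
  have [Q1 H1] := entire_rapid z hcoef_entire; have [Q2 H2] := entire_rapid (P / z) hcoef_entire.
  exists (Q1 + Q2) => k; rewrite mulrDr mulrDl (le_trans (modulusD _ _)) //.
  exact: lerD (H1 k) (H2 k).
have bound N k : (k <= N)%N -> modulus (qbin P (2 * N) (N + k)) <= d^-1 * d^-1.
  move=> kN; rewrite /qbin; case: ifP => _; last by rewrite modulus0 mulr_ge0 // invr_ge0 ltW.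
  rewrite !modulusM modulusV modulusM -[leRHS]mul1r ler_pM ?modulus_ge0 ?poch_le1 //.
    by rewrite invr_ge0 mulr_ge0 ?modulus_ge0.
  by rewrite -invfM lef_pV2 ?posrE ?mulr_gt0 ?modulus_gt0 ?pochP_neq0 // ler_pM // ltW.
have := tannery bound qc hr hs.
rewrite (_ : (fun N => _) = theta_trunc z) //; apply/funext => N.
rewrite /theta_trunc -/P finite_triple_product //; last exact: pochP_neq0.
rewrite big_nat_recl //= addn0 /hcoef /jcoef /= !expr0 mul1r; congr (_ + _).
  by rewrite mul1r -mulr2n -[_ *+ 2]mulr_natr mul1r mulVf ?mulr1 // pnatr_eq0.
rewrite big_add1 /=; apply: eq_bigr => k _; by rewrite mulr1.
Qed.

End ThetaLimit.

(** * Holomorphy of power series *)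

Section Differentiability.
Variable R : realType.
Local Notation C := R[i].

Lemma cvgBC (u v : nat -> C) (a b : C) :
  u @ \oo --> a -> v @ \oo --> b -> (fun n => u n - v n) @ \oo --> a - b.
Proof. by move=> ua vb; have h := cvgB ua vb; exact: h. Qed.

Lemma cvgMC (u v : nat -> C) (a b : C) :
  u @ \oo --> a -> v @ \oo --> b -> (fun n => u n * v n) @ \oo --> a * b.
Proof. by move=> ua vb; have h := cvgM ua vb; exact: h. Qed.

Lemma cvg_modulus_le (u : nat -> C) (l : C) (b : R) :
  u @ \oo --> l -> (forall n, modulus (u n) <= b) -> modulus l <= b.
Proof.
move=> /cvg_modulusP ul ub; apply/ler_addgt0Pr => e /ul[N /(_ N (leqnn N))] h.
rewrite -[l](subrK (u N)) addrC (le_trans (modulusD _ _)) // lerD //.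
Qed.

Lemma cvg_modulus_ge (u : nat -> C) (l : C) (b : R) :
  u @ \oo --> l -> (forall n, b <= modulus (u n)) -> b <= modulus l.
Proof.
move=> /cvg_modulusP ul ub; apply/ler_addgt0Pr => e /ul[N /(_ N (leqnn N))] h.
apply: (le_trans (ub N)); rewrite -[u N](subrK l) (le_trans (modulusD _ _)) //.
by rewrite addrC lerD // modulusBC.
Qed.

Lemma quadratic_differentiable (f : C -> C) (x d : C) (M : R) :
  (forall h, modulus h <= 2^-1 -> modulus (f (x + h) - f x - h * d) <= M * modulus h ^+ 2) ->
  differentiable f x.
Proof.
move=> fM; apply/derivable1_diffP; apply/cvg_ex; exists d.
apply/cvgrPdist_le => e /gt0_complexE[r r0 ->].
pose dl := Num.min 2^-1 (r / (`|M| + 1)).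
have dl0 : 0 < dl by rewrite lt_min invr_gt0 ltr0n divr_gt0 // ltr_wpDl.
have dlC : 0 < dl%:C by rewrite ltcR.
near=> h.
have h0 : h != 0 by near: h; exact: nbhs_dnbhs_neq.
have hd : modulus h < dl.
  by rewrite -ltcR -modulusE; near: h; exact: dnbhs0_lt.
rewrite modulusE lecR /= [h *: 1]mulr1 [h + x]addrC.
change (modulus (d - h^-1 * (f (x + h) - f x)) <= r).
have hm : 0 < modulus h by rewrite modulus_gt0.
rewrite -(ler_pM2l hm) -modulusM.
have -> : h * (d - h^-1 * (f (x + h) - f x)) = - (f (x + h) - f x - h * d).
  by rewrite mulrBr mulrA divff // mul1r; ring.
rewrite modulusN; move: hd; rewrite lt_min => /andP[/ltW h2 hr].
apply: (le_trans (fM h h2)); rewrite expr2 mulrCA ler_wpM2l ?modulus_ge0 //.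
move: hr; rewrite ltr_pdivlMr ?ltr_wpDl // => hr.
apply: le_trans (ltW hr); rewrite mulrC ler_wpM2l ?modulus_ge0 //.
by rewrite (le_trans (ler_norm _)) // lerDl.
Unshelve. all: by end_near. Qed.

(** Passing from [k] to [k.+1] multiplies the remainder by [z + h] and adds
    [k%:R * (h ^+ 2 * z ^+ k.-1)]; the bound survives as [k ^ 2 + k] is at most [(k + 1) ^ 2]. *)
Lemma power_taylor (z h : C) (r : R) k : 1 <= r -> modulus z <= r -> modulus (z + h) <= r ->
  modulus ((z + h) ^+ k - z ^+ k - h * (k%:R * z ^+ k.-1)) <= modulus h ^+ 2 * (k%:R ^+ 2 * r ^+ k).
Proof.
move=> r1 zr zhr; have r0 : 0 <= r by apply: le_trans r1.
elim: k => [|k IH].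
  by rewrite !expr0 subrr mul0r mulr0 subr0 modulus0 !mulr_ge0 ?exprn_ge0 ?modulus_ge0.
have -> : (z + h) ^+ k.+1 - z ^+ k.+1 - h * (k.+1%:R * z ^+ k) =
    (z + h) * ((z + h) ^+ k - z ^+ k - h * (k%:R * z ^+ k.-1)) + k%:R * (h ^+ 2 * z ^+ k.-1).
  by case: k {IH} => [|k]; rewrite !exprS /= -?natr1; ring.
apply: (le_trans (modulusD _ _)); rewrite !modulusM.
have hk : modulus (k%:R : C) = k%:R.
  by rewrite -(rmorph_nat (real_complex R)) modulus_real normr_nat.
rewrite hk (_ : modulus h * modulus h = modulus h ^+ 2) //.
have zk : modulus (z ^+ k.-1) <= r ^+ k.
  rewrite modulusX; apply: (@le_trans _ _ (r ^+ k.-1)).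
    by rewrite lerXn2r // ?nnegrE ?modulus_ge0.
  by rewrite ler_weXn2l // leq_pred.
apply: (@le_trans _ _ (r * (modulus h ^+ 2 * (k%:R ^+ 2 * r ^+ k)) +
     k%:R * (modulus h ^+ 2 * r ^+ k))).
  apply: lerD; first by apply: ler_pM => //; exact: modulus_ge0.
  by do 2!rewrite ler_wpM2l ?exprn_ge0 ?modulus_ge0 //.
have rk : r ^+ k <= r ^+ k.+1 by rewrite ler_weXn2l.
apply: (@le_trans _ _ (modulus h ^+ 2 * ((k%:R ^+ 2 + k%:R) * r ^+ k.+1))).
  rewrite (_ : r * _ + _ = modulus h ^+ 2 * (k%:R ^+ 2 * r ^+ k.+1 + k%:R * r ^+ k)); last first.
    by rewrite [r ^+ k.+1]exprS; ring.
  by rewrite ler_wpM2l ?exprn_ge0 ?modulus_ge0 // mulrDl lerD2l ler_wpM2l.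
rewrite ler_wpM2l ?exprn_ge0 ?modulus_ge0 // ler_wpM2r ?exprn_ge0 //.
have : 0 <= k%:R :> R by []. rewrite -natr1; nra.
Qed.

(** The domination at radius [4 * r] absorbs the factor [k ^ 2], since [k] is less than [2 ^ k]. *)
Lemma entire_weight (a : nat -> C) (r : R) : entire_coef a -> 0 <= r ->
  exists2 Q : R, 0 <= Q & forall k, modulus (a k) * (k%:R ^+ 2 * r ^+ k) <= Q * 2^-1 ^+ k.
Proof.
move=> ea r0; have [Q Q0 H] := ea (4 * r) (mulr_ge0 (ler0n _ 4) r0).
exists Q => // k; apply: le_trans (H k); rewrite ler_wpM2l ?modulus_ge0 //.
rewrite exprMn ler_wpM2r ?exprn_ge0 //.
rewrite (_ : 4 = 2 ^+ 2 :> R); last by ring.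
rewrite -exprM mulnC exprM lerXn2r ?nnegrE ?exprn_ge0 //.
by rewrite -natrX ler_nat ltnW // ltn_expl.
Qed.

(** Termwise differentiation; the radius [modulus z + 1] bounds both [z] and [z + h] for the
    increments [h] in question. *)
Lemma power_sum_differentiable (a : nat -> C) z : entire_coef a ->
  differentiable (power_sum a) z.
Proof.
move=> ea; pose r := modulus z + 1.
have r1 : 1 <= r by rewrite lerDr modulus_ge0.
have r0 : 0 <= r by apply: le_trans r1.
have [Q Q0 HQ] := entire_weight ea r0.
have dr : rapid (fun k => a k * (k%:R * z ^+ k.-1)).
  exists Q => k; apply: le_trans (HQ k); rewrite modulusM ler_wpM2l ?modulus_ge0 //.
  rewrite modulusM -(rmorph_nat (real_complex R)) modulus_real normr_nat.
  case: k => [|k]; first by rewrite mul0r mulr_ge0 ?exprn_ge0.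
  rewrite modulusX /= ler_pM ?exprn_ge0 ?modulus_ge0 //.
    by rewrite ler_eXnr // ler1n.
  apply: (@le_trans _ _ (r ^+ k)); last by rewrite ler_weXn2l.
  by rewrite lerXn2r // ?nnegrE ?modulus_ge0 // lerDl.
have dcvg := rapid_cvg dr.
apply: (@quadratic_differentiable _ _ (lim (series (fun k => a k * (k%:R * z ^+ k.-1)) @ \oo)) (Q * 2)).
move=> h h2.
set d := lim _.
have hcvg : (fun n => series (fun k => a k * (z + h) ^+ k) n - series (fun k => a k * z ^+ k) n
    - h * series (fun k => a k * (k%:R * z ^+ k.-1)) n) @ \oo -->
    power_sum a (z + h) - power_sum a z - h * d.
  apply: cvgBC; first by apply: cvgBC; exact: power_sum_cvg.
  by apply: cvgMC; [exact: cvg_cst|exact: dcvg].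
apply: (cvg_modulus_le hcvg) => n; rewrite /series /= mulr_sumr -!sumrB.
apply: (le_trans (modulus_sum _ _ _)).
have h1 : modulus h <= 1 by apply: (le_trans h2); rewrite invf_le1 // ler1n.
apply: (@le_trans _ _ (\sum_(0 <= k < n) (modulus h ^+ 2 * Q) * 2^-1 ^+ k)).
  apply: ler_sum => k _.
  rewrite [h * _]mulrCA -!mulrBr modulusM.
  apply: (@le_trans _ _ (modulus (a k) * (modulus h ^+ 2 * (k%:R ^+ 2 * r ^+ k)))).
    rewrite ler_wpM2l ?modulus_ge0 //; apply: power_taylor => //; first by rewrite lerDl.
    by rewrite (le_trans (modulusD _ _)) // lerD2l.
  by rewrite mulrCA -mulrA ler_wpM2l ?exprn_ge0 ?modulus_ge0.
apply: (le_trans (@geometric_tail _ _ _ _ _ _ _)).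
- by rewrite mulr_ge0 ?exprn_ge0 ?modulus_ge0.
- by rewrite invr_ge0 ler0n invf_lt1 ?ltr1n ?ltr0n.
rewrite expr0 mulr1 (_ : (1 - 2^-1)^-1 = 2 :> R); last by field.
by rewrite le_eqVlt; apply/orP; left; apply/eqP; ring.
Qed.

End Differentiability.

(** * The complex exponential, and where theta does not vanish *)

Section ComplexExponential.
Variable R : realType.
Local Notation C := R[i].

Lemma cexpD (z w : C) : cexp (z + w) = cexp z * cexp w.
Proof.
case: z w => [a b] [c d]; rewrite /cexp /= expRD cosD sinD rmorphM /=.
rewrite mulrACA; congr (_ * _).
by apply/eqP; rewrite eq_complex /= [sin b * _ + _]addrC [cos b * sin d + _]addrC !eqxx.
Qed.

Lemma cexp0 : cexp (0 : C) = 1.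
Proof. by rewrite /cexp /= expR0 cos0 sin0 mul1r complexr0. Qed.

Lemma cexp_modulus (z : C) : modulus (cexp z) = expR (complex.Re z).
Proof.
rewrite /cexp modulusM modulus_real gtr0_norm ?expR_gt0 //.
by rewrite /modulus normc_def /= cos2Dsin2 sqrtr1 mulr1.
Qed.

Lemma cexp_neq0 (z : C) : cexp z != 0.
Proof. by rewrite -modulus_gt0 cexp_modulus expR_gt0. Qed.

(** Only the inequality [1 + x <= expR x] is used: at [x] it bounds from below, at [- x] from
    above. *)
Lemma expR_quadratic (x : R) : `|x| <= 2^-1 -> `|expR x - 1 - x| <= 2 * `|x| ^+ 2.
Proof.
move=> x2; have := expR_ge1Dx x; have := expR_ge1Dx (- x).
rewrite expRN real_normK ?num_real //; move: x2; rewrite ler_norml => /andP[x1 x2] h1 h2.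
have e0 := expR_gt0 x; rewrite ger0_norm; last by lra.
have : (1 - x) * expR x <= 1 by rewrite -ler_pdivlMr // mul1r.
set e := expR x in h1 h2 e0 * => h3.
have : e <= 1 + x + 2 * x ^+ 2; last by lra.
have x3 : 0 < 1 - x by lra.
rewrite -(ler_pM2l x3) (le_trans h3) //; nra.
Qed.

Lemma sin_le_id (y : R) : `|sin y| <= `|y|.
Proof.
wlog y0 : y / 0 <= y.
  move=> H; have [/H//|/ltW y0] := leP 0 y.
  by rewrite -normrN -sinN -[leRHS]normrN; apply: H; rewrite oppr_ge0.
have [|c _] := @MVT_segment R sin cos 0 y y0 (fun x _ => is_derive_sin x).
  exact/continuous_subspaceT/continuous_sin.
rewrite sin0 !subr0 => ->; rewrite normrM ler_piMl //.
by rewrite ler_norml cos_geN1 cos_le1.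
Qed.

Lemma cos_quadratic (y : R) : `|cos y - 1| <= `|y| ^+ 2.
Proof.
wlog y0 : y / 0 <= y.
  move=> H; have [/H//|/ltW y0] := leP 0 y.
  by rewrite -cosN -[`|y|]normrN; apply: H; rewrite oppr_ge0.
have [|c c0y] := @MVT_segment R cos (fun x => - sin x) 0 y y0 (fun x _ => is_derive_cos x).
  exact/continuous_subspaceT/continuous_cos.
rewrite cos0 subr0 => ->; rewrite normrM normrN expr2 ler_wpM2r //.
rewrite (le_trans (sin_le_id c)) //; move: c0y; rewrite in_itv /= => /andP[c0 cy].
by rewrite !ger0_norm.
Qed.

Lemma sin_quadratic (y : R) : `|y| <= 1 -> `|sin y - y| <= `|y| ^+ 2.
Proof.
wlog y0 : y / 0 <= y.
  move=> H; have [/H//|/ltW y0] := leP 0 y.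
  have := H (- y); rewrite oppr_ge0 sinN opprK [- sin y + y]addrC !normrN distrC.
  by move=> /(_ y0).
move=> y1; have [|c c0y] := @MVT_segment R sin cos 0 y y0 (fun x _ => is_derive_sin x).
  exact/continuous_subspaceT/continuous_sin.
rewrite sin0 !subr0 => ->.
rewrite -{2}[y]mul1r -mulrBl normrM expr2 ler_wpM2r //.
apply: (le_trans (cos_quadratic c)).
move: c0y y1; rewrite in_itv /= => /andP[c0 cy]; rewrite !ger0_norm // => y1.
by rewrite expr2; apply: (@le_trans _ _ (c * 1)); [rewrite ler_wpM2l // (le_trans cy)|rewrite mulr1].
Qed.

(** The estimates of the real and imaginary parts add up to 7 times the square of the modulus; 9
    leaves some slack. *)
Lemma cexp_quadratic (h : C) : modulus h <= 2^-1 ->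
  modulus (cexp h - 1 - h) <= 9 * modulus h ^+ 2.
Proof.
case: h => x y h2; have xh := modulus_Re (x +i* y); have yh := modulus_Im (x +i* y).
move: xh yh => /=; set m := modulus _ in h2 * => xm ym.
apply: (le_trans (modulus_le_ReIm _)); rewrite /cexp /= !(mul0r, mulr0, subr0, addr0, add0r).
have x2 := le_trans xm h2; have y2 := le_trans ym h2.
have y1 : `|y| <= 1 by apply: le_trans y2 _; lra.
have e1 := expR_quadratic x2; have c1 := cos_quadratic y; have s1 := sin_quadratic y1.
have c2 : `|cos y| <= 1 by rewrite ler_norml cos_geN1 cos_le1.
have s2 := sin_le_id y.
have e2 : `|expR x - 1| <= 2 * `|x|.
  rewrite -[expR x - 1](subrK x) (le_trans (ler_normD _ _)) //.
  have := normr_ge0 x; nra.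
have hx := normr_ge0 x; have hy := normr_ge0 y.
have -> : expR x * cos y - 1 - x = (expR x - 1 - x) * cos y + (1 + x) * (cos y - 1) by ring.
have -> : expR x * sin y - y = (expR x - 1) * sin y + (sin y - y) by ring.
have hx1 : `|1 + x| <= 2.
  by rewrite (le_trans (ler_normD _ _)) // normr1; lra.
have r1 : `|(expR x - 1 - x) * cos y + (1 + x) * (cos y - 1)| <= 2 * `|x| ^+ 2 + 2 * `|y| ^+ 2.
  rewrite (le_trans (ler_normD _ _)) // !normrM lerD //; last by apply: ler_pM.
  by rewrite -[leRHS]mulr1; apply: ler_pM.
have r2 : `|(expR x - 1) * sin y + (sin y - y)| <= 2 * `|x| * `|y| + `|y| ^+ 2.
  by rewrite (le_trans (ler_normD _ _)) // normrM lerD //; apply: ler_pM.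
apply: (le_trans (lerD r1 r2)).
have : `|x| ^+ 2 <= m ^+ 2 by rewrite lerXn2r // ?nnegrE (le_trans hx).
have : `|y| ^+ 2 <= m ^+ 2 by rewrite lerXn2r // ?nnegrE (le_trans hy).
have : `|x| * `|y| <= m * m by apply: ler_pM.
rewrite !expr2; nra.
Qed.

Lemma cexp_differentiable (z : C) : differentiable (@cexp R) z.
Proof.
apply: (@quadratic_differentiable _ _ _ (cexp z) (modulus (cexp z) * 9)) => h h2.
rewrite cexpD (_ : _ - _ - _ = cexp z * (cexp h - 1 - h)); last by ring.
by rewrite modulusM -mulrA ler_wpM2l ?modulus_ge0 // cexp_quadratic.
Qed.

Lemma theta_cvg (p : R) (p01 : 0 < p < 1) (z : C) : z != 0 ->
  theta_trunc p z @ \oo --> theta p z.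
Proof.
move=> z0; have [c /(_ z z0) H] := theta_cvg_series p01.
by rewrite /theta -/(theta_trunc p z) (cvg_complex_lim H).
Qed.

(** Off the powers of [p] no factor vanishes, and [prod_lower] keeps the partial products of both
    kinds of factors away from 0. *)
Lemma theta_neq0 (p : R) (p01 : 0 < p < 1) (z : C) : z != 0 ->
  (forall k : int, z != p%:C ^ k) -> theta p z != 0.
Proof.
move=> z0 zp; have /andP[p0 p1] := p01.
have P0 : p%:C != 0 :> C by rewrite -modulus_gt0 modulus_real gtr0_norm.
have pge : 0 <= p < 1 by rewrite p1 ltW.
have mz : 0 < modulus z by rewrite modulus_gt0.
have [||d1 d10 H1] := @prod_lower R (fun j => z * p%:C ^+ j) (modulus z) p (modulus_ge0 _) pge.
- by move=> j; rewrite modulusM modulusP_exp.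
- move=> j; apply: contraNneq (zp (- (j%:Z))) => zj.
  by rewrite -[p%:C ^ _]mul1r -zj -exprnN mulfK // expf_neq0.
have [|||d2 d20 H2] := @prod_lower R (fun j => p%:C ^+ j.+1 / z) (p / modulus z) p _ pge.
- by rewrite divr_ge0 // ltW.
- by move=> j; rewrite modulusM modulusP_exp // modulusV exprS mulrAC.
- move=> j; apply: contraNneq (zp j.+1) => zj.
  by rewrite -[z]mul1r -zj mulfVK.
rewrite -modulus_gt0; apply: (lt_le_trans (mulr_gt0 d10 d20)).
apply: (cvg_modulus_ge (theta_cvg p01 z0)) => N.
by rewrite /theta_trunc big_split modulusM ler_pM // ltW.
Qed.

End ComplexExponential.

(** * Bilateral series and the rearrangement of a double series *)

Section Bilateral.
Variable R : realType.
Local Notation C := R[i].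

Lemma sum_sublist (I : eqType) (V : nmodType) (r r1 : seq I) (F : I -> V) :
  uniq r -> uniq r1 -> {subset r1 <= r} ->
  \sum_(i <- r1) F i = \sum_(i <- r | i \in r1) F i.
Proof.
move=> ur ur1 sr; rewrite -[RHS]big_filter; apply: perm_big; apply: uniq_perm => //.
  exact: filter_uniq.
by move=> i; rewrite mem_filter; case: (boolP (i \in r1)) => // /sr ->.
Qed.

(** The difference runs over the points of [r1] outside [r0], whose weight is at most that of the
    points of [r] outside [r0]. *)
Lemma sum_between (I : eqType) (r r0 r1 : seq I) (F : I -> C) (w : I -> R) :
    uniq r -> uniq r0 -> uniq r1 -> {subset r0 <= r1} -> {subset r1 <= r} ->
    (forall i, modulus (F i) <= w i) ->
  modulus (\sum_(i <- r1) F i - \sum_(i <- r0) F i) <= \sum_(i <- r) w i - \sum_(i <- r0) w i.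
Proof.
move=> ur ur0 ur1 s01 s1 Fw.
have s0 : {subset r0 <= r} by move=> i /s01/s1.
have diff (V : zmodType) (a b : seq I) (G : I -> V) : uniq a -> uniq b -> {subset a <= b} ->
    \sum_(i <- b) G i - \sum_(i <- a) G i = \sum_(i <- b | i \notin a) G i.
  move=> ua ub ab; rewrite (sum_sublist G ub ua ab) [X in X - _](bigID (mem a)) /=.
  by rewrite addrAC subrr add0r.
rewrite !diff // (le_trans (modulus_sum _ _ _)) //.
apply: (@le_trans _ _ (\sum_(i <- r1 | i \notin r0) w i)); first exact: ler_sum.
rewrite -[leLHS]big_filter (sum_sublist w ur) ?filter_uniq //; last first.
  by move=> i; rewrite mem_filter => /andP[_ /s1].
rewrite [leRHS]big_mkcond [leLHS]big_mkcond; apply: ler_sum => i _; rewrite mem_filter.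
have wi : 0 <= w i by apply: le_trans (Fw i); exact: modulus_ge0.
by case: (i \in r0) => //=; case: (i \in r1).
Qed.

Definition zrange (N : nat) : seq int := [seq i%:Z - N%:Z | i <- index_iota 0 (2 * N).+1].

Lemma mem_zrange N (m : int) : (m \in zrange N) = (`|m| <= N%:Z).
Proof.
apply/mapP/idP => [ [j] |mN]; first by rewrite mem_index_iota => jN ->; lia.
by exists (`|(m + N%:Z)%R|%N); [rewrite mem_index_iota|]; lia.
Qed.

Lemma zrange_uniq N : uniq (zrange N).
Proof. by rewrite map_inj_uniq ?iota_uniq // => i j; lia. Qed.

Lemma zrange_fold (psi : int -> C) N : \sum_(i <- zrange N) psi i =
  \sum_(0 <= k < N.+1) (if k == 0%N then psi 0 else psi k%:Z + psi (- k%:Z)).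
Proof.
rewrite /zrange big_map (sum_fold (fun i => psi (i%:Z - N%:Z))) [RHS]big_nat_recl //=.
rewrite subrr big_add1 /=; congr (_ + _); rewrite !big_nat; apply: eq_bigr => k /andP[_ kN].
by congr (psi _ + psi _); lia.
Qed.

Definition birapid (psi : int -> C) (A p r : R) : Prop :=
  forall k : nat, modulus (psi k%:Z) <= A * (p ^+ 'C(k, 2) * r ^+ k) /\
                  modulus (psi (- k%:Z)) <= A * (p ^+ 'C(k, 2) * r ^+ k).

Lemma birapid_bound psi A p r : 0 < p < 1 -> 0 <= A -> 0 <= r -> birapid psi A p r ->
  exists2 Q : R, 0 <= Q & forall m, modulus (psi m) <= Q * 2^-1 ^+ `|m|%N.
Proof.
move=> p01 A0 r0 psib; have [Q Q0 H] := theta_weight_bound p01 r0.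
exists (A * Q) => [|m]; first exact: mulr_ge0.
have [h1 h2] := psib `|m|%N.
have h : modulus (psi m) <= A * (p ^+ 'C(`|m|%N, 2) * r ^+ `|m|%N).
  by case: (intP m) h1 h2 => [|k|k]; rewrite ?abszN //= => h1 h2; lia.
by apply: (le_trans h); rewrite -mulrA ler_wpM2l.
Qed.

Lemma bilateral_cvg psi Q : (forall m : int, modulus (psi m) <= Q * 2^-1 ^+ `|m|%N) ->
  exists l : C, (fun N => \sum_(i <- zrange N) psi i) @ \oo --> l.
Proof.
move=> H; pose v k := if k == 0%N then psi 0 else psi k%:Z + psi (- k%:Z).
have rv : rapid v.
  exists (Q + Q) => k; rewrite /v; have := H 0; have := H k%:Z; have := H (- k%:Z).
  rewrite abszN absz0 absz_nat expr0 mulr1 => h1 h2 h3.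
  have Q0 : 0 <= Q by apply: le_trans h3; exact: modulus_ge0.
  case: eqP => [->|_]; first by rewrite expr0 mulr1; lra.
  by rewrite mulrDl (le_trans (modulusD _ _)) // lerD.
exists (lim (series v @ \oo)).
have := rapid_cvg rv => h; have h' := cvg_reindex (f := succn) h.
under eq_fun do rewrite zrange_fold.
by apply: h' => m; exists m => k; exact: leqW.
Qed.

Definition box N : seq (int * int) := [seq (m, k) | m <- zrange N, k <- zrange N].

Lemma mem_box N x : (x \in box N) = (`|x.1| <= N%:Z) && (`|x.2| <= N%:Z).
Proof.
apply/allpairsP/andP => [ [[m k] /= [h1 h2 ->]]|[h1 h2]]; first by rewrite -!mem_zrange.
by exists x; rewrite !mem_zrange; split=> //; case: x h1 h2.
Qed.

Lemma box_uniq N : uniq (box N).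
Proof. by apply: allpairs_uniq; rewrite ?zrange_uniq // => -[? ?] [? ?]. Qed.

Lemma sum_box (V : pzRingType) N (f g : int -> V) :
  \sum_(x <- box N) f x.1 * g x.2 = (\sum_(m <- zrange N) f m) * \sum_(k <- zrange N) g k.
Proof.
by rewrite /box big_allpairs mulr_suml; apply: eq_bigr => m _; rewrite mulr_sumr.
Qed.

Definition even_pt (x : int * int) := (x.1 + x.2, x.1 - x.2).
Definition odd_pt (x : int * int) := (x.1 + x.2 + 1, x.1 - x.2).

(** [even_pt] reaches the pairs with even coordinate sum and [odd_pt] those with odd coordinate sum,
    so a sum over the diamond separates into two sums over boxes. *)
Definition diamond N := map even_pt (box N) ++ map odd_pt (box N).

Lemma diamond_uniq N : uniq (diamond N).
Proof.
rewrite cat_uniq !map_inj_uniq ?box_uniq ?andTb ?andbT.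
- apply/hasPn => _ /mapP[y _ ->]; apply/mapP => -[[a b] _]; case: y => c d [] /=; lia.
- by move=> [a b] [c d] [] /= h1 h2; congr (_, _); lia.
- by move=> [a b] [c d] [] /= h1 h2; congr (_, _); lia.
Qed.

Lemma box_diamond N : {subset box N <= diamond N}.
Proof.
move=> [m k]; rewrite mem_box /= => /andP[h1 h2]; rewrite mem_cat; apply/orP.
have [s [b [b01 smk]]] : exists s b : int, (b = 0 \/ b = 1) /\ m + k = 2 * s + b.
  exists ((m + k) %/ 2)%Z, ((m + k) %% 2)%Z; split; last by rewrite mulrC -divz_eq.
  have := modz_ge0 (m + k) (isT : (2 : int) != 0).
  have := ltz_mod (m + k) (isT : (2 : int) != 0); lia.
case: b01 => bE; [left|right]; apply/mapP.
  by exists (s, s - k); [rewrite mem_box /=; lia|rewrite /even_pt /=; congr (_, _); lia].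
by exists (s, s - k); [rewrite mem_box /=; lia|rewrite /odd_pt /=; congr (_, _); lia].
Qed.

Lemma diamond_box N : {subset diamond N <= box (2 * N).+1}.
Proof.
by move=> x; rewrite mem_cat => /orP[] /mapP[[a b]]; rewrite !mem_box /= => ab -> /=; lia.
Qed.

(** The diamond lies between the boxes of sizes [N] and [2 * N + 1]. The dominating double series
    converges along boxes, so its mass between these two tends to 0. *)
Lemma double_sum_cvg (f g : int -> C) (Q1 Q2 : R) :
    (forall m : int, modulus (f m) <= Q1 * 2^-1 ^+ `|m|%N) ->
    (forall m : int, modulus (g m) <= Q2 * 2^-1 ^+ `|m|%N) ->
  (fun N => \sum_(x <- diamond N) f x.1 * g x.2 - \sum_(x <- box N) f x.1 * g x.2) @ \oo --> (0 : C).
Proof.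
move=> fQ gQ.
pose w1 (m : int) : R := Q1 * 2^-1 ^+ `|m|%N; pose w2 (m : int) : R := Q2 * 2^-1 ^+ `|m|%N.
have wcvg (Q : R) : 0 <= Q ->
    exists l : C, (fun N => \sum_(i <- zrange N) (Q * 2^-1 ^+ `|i|%N)%:C) @ \oo --> l.
  move=> Q0; apply: (@bilateral_cvg _ Q) => m; rewrite modulus_real ger0_norm //.
  by rewrite mulr_ge0 // exprn_ge0 // invr_ge0.
have Q10 : 0 <= Q1 by have := fQ 0; rewrite mulr1; apply: le_trans; exact: modulus_ge0.
have Q20 : 0 <= Q2 by have := gQ 0; rewrite mulr1; apply: le_trans; exact: modulus_ge0.
have [l1 h1] := wcvg _ Q10; have [l2 h2] := wcvg _ Q20.
pose W N : C := \sum_(x <- box N) ((w1 x.1)%:C * (w2 x.2)%:C).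
have Wcvg : W @ \oo --> l1 * l2.
  rewrite (_ : W = (fun N => (\sum_(i <- zrange N) (w1 i)%:C) * (\sum_(i <- zrange N) (w2 i)%:C))).
    exact: cvgMC h1 h2.
  by apply/funext => N; exact: (sum_box N (fun m => (w1 m)%:C) (fun m => (w2 m)%:C)).
have W2cvg : (fun N => W (2 * N).+1) @ \oo --> l1 * l2.
  have := cvg_reindex (f := fun N => (2 * N).+1) Wcvg; apply => m; exists m => k; lia.
have Dcvg : (fun N => W (2 * N).+1 - W N) @ \oo --> (0 : C).
  by rewrite -(subrr (l1 * l2)); apply: cvgBC.
apply/cvg_modulusP => e e0.
move/cvg_modulusP : Dcvg => /(_ e e0)[N HN]; exists N => n /HN.
rewrite !sub0r !modulusN; apply: le_trans.
apply: (@le_trans _ _ (\sum_(x <- box (2 * n).+1) w1 x.1 * w2 x.2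
     - \sum_(x <- box n) w1 x.1 * w2 x.2)).
  apply: sum_between; rewrite ?box_uniq ?diamond_uniq //.
  - exact: box_diamond.
  - exact: diamond_box.
  - by move=> [a b] /=; rewrite modulusM ler_pM ?modulus_ge0.
rewrite (_ : W (2 * n).+1 - W n = (\sum_(x <- box (2 * n).+1) w1 x.1 * w2 x.2
     - \sum_(x <- box n) w1 x.1 * w2 x.2)%:C).
  by rewrite modulus_real ler_norm.
rewrite rmorphB /= !rmorph_sum /W.
by congr (_ - _); apply: eq_bigr => x _; rewrite -rmorphM.
Qed.

(** Shifting the window exchanges one boundary term for another, and both tend to 0. *)
Lemma zrange_shift (psi : int -> C) Q (l : C) :
    (forall m : int, modulus (psi m) <= Q * 2^-1 ^+ `|m|%N) ->
  (fun N => \sum_(i <- zrange N) psi i) @ \oo --> l ->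
  (fun N => \sum_(i <- zrange N) psi (i + 1)) @ \oo --> l.
Proof.
move=> psiQ H.
have Q0 : 0 <= Q by have := psiQ 0; rewrite mulr1; apply: le_trans; exact: modulus_ge0.
have E N : \sum_(i <- zrange N) psi (i + 1) =
    \sum_(i <- zrange N) psi i - (psi (- N%:Z) - psi (N%:Z + 1)).
  rewrite /zrange !big_map [in RHS]big_nat_recl //= [in LHS]big_nat_recr //= sub0r.
  rewrite (_ : (2 * N)%:Z - N%:Z + 1 = N%:Z + 1); last by lia.
  rewrite opprB addrA [psi _ + _ + _ in RHS]addrAC -addrA.
  rewrite (_ : \sum_(0 <= i < 2 * N) psi (i%:Z - N%:Z + 1) =
     \sum_(0 <= i < 2 * N) psi (i.+1%:Z - N%:Z)); first by ring.
  by apply: eq_bigr => i _; congr psi; lia.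
under eq_fun do rewrite E.
have d0 : (fun N => psi (- N%:Z) - psi (N%:Z + 1)) @ \oo --> (0 : C).
  apply/cvg_modulusP => e e0.
  have half01 : 0 <= (2^-1 : R) < 1 by rewrite invr_ge0 ler0n invf_lt1 ?ltr1n ?ltr0n.
  have [m Hm] := geometric_small (Q + Q) half01 e0.
  exists m => n mn; rewrite sub0r modulusN (le_trans (modulusD _ _)) // modulusN.
  apply: le_trans (Hm n mn); rewrite mulrDl lerD //.
    by apply: le_trans (psiQ _) _; rewrite abszN.
  apply: le_trans (psiQ _) _; rewrite ler_wpM2l //.
  rewrite (_ : `|(n%:Z + 1)%R|%N = n.+1); last by lia.
  by rewrite exprS ler_piMl ?exprn_ge0 ?invr_ge0 // invf_le1 ?ler1n.
have h := cvgBC H d0; rewrite subr0 in h; exact: h.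
Qed.

End Bilateral.

Lemma cvg_cstC (R : realType) (c : R[i]) : (fun _ : nat => c) @ \oo --> c.
Proof. exact: cvg_cst. Qed.
Arguments cvg_cstC {R} c.

Section ThetaPairs.
Variables (F : fieldType) (rp x y : F).
Hypotheses (rp0 : rp != 0) (x0 : x != 0) (y0 : y != 0).
Implicit Types m s t : int.

Let sgn2 m k (a b c d : F) :
  (-1) ^ m * a * b * ((-1) ^ k * c * d) = (-1) ^ (m + k) * (a * c) * (b * d).
Proof. by rewrite expfzDr ?oppr_eq0 ?oner_eq0 //; ring. Qed.

Let monomials m k : (x * y) ^ m * (x / y) ^ k = x ^ (m + k) * y ^ (m - k).
Proof. by rewrite !expfzMl exprz_inv !expfzDr //; ring. Qed.

Let sgn_even m : (-1 : F) ^ (2 * m) = 1.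
Proof. by rewrite -exprz_exp -exprnP sqrrN expr1n exp1rz. Qed.

Let rp_even m : rp ^ (2 * m) = (rp ^+ 2) ^ m.
Proof. by rewrite -exprz_exp -exprnP. Qed.

(** The squares of [s + t] and [s - t] add up to [2 s^2 + 2 t^2], which decouples [s] and [t]; the
    linear terms leave [- 2 s]. *)
Lemma theta_pair_even s t :
  (-1) ^ (s + t) * rp ^ ((s + t) * (s + t) - (s + t)) * (x * y) ^ (s + t) *
  ((-1) ^ (s - t) * rp ^ ((s - t) * (s - t) - (s - t)) * (x / y) ^ (s - t)) =
  (rp ^+ 2) ^ (s * s + -1 * s) * x ^ (2 * s) * ((rp ^+ 2) ^ (t * t + 0 * t) * y ^ (2 * t)).
Proof.
rewrite sgn2 monomials -!rp_even.
rewrite (_ : s + t + (s - t) = 2 * s); last by ring.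
rewrite (_ : s + t - (s - t) = 2 * t); last by ring.
rewrite sgn_even mul1r [RHS]mulrACA -!expfzDr //; congr (_ ^ _ * _); ring.
Qed.

(** The extra 1 in the first index changes the linear part of the exponent from [- 2 s] to [2 t],
    reverses the sign and leaves one factor [x * y]. *)
Lemma theta_pair_odd s t :
  (-1) ^ (s + t + 1) * rp ^ ((s + t + 1) * (s + t + 1) - (s + t + 1)) * (x * y) ^ (s + t + 1) *
  ((-1) ^ (s - t) * rp ^ ((s - t) * (s - t) - (s - t)) * (x / y) ^ (s - t)) =
  - (x * y * ((rp ^+ 2) ^ (s * s + 0 * s) * x ^ (2 * s) * ((rp ^+ 2) ^ (t * t + 1 * t) * y ^ (2 * t)))).
Proof.
rewrite sgn2 monomials -!rp_even.
rewrite (_ : s + t + 1 + (s - t) = 2 * s + 1); last by ring.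
rewrite (_ : s + t + 1 - (s - t) = 2 * t + 1); last by ring.
rewrite [(-1) ^ _]expfzDr ?oppr_eq0 ?oner_eq0 // sgn_even mul1r expr1z mulN1r mulNr.
rewrite [x ^ (_ + 1)]expfzDr // [y ^ (_ + 1)]expfzDr // !expr1z.
transitivity (- (rp ^ (2 * (s * s + 0 * s)) * rp ^ (2 * (t * t + 1 * t)) *
                 (x ^ (2 * s) * x * (y ^ (2 * t) * y)))); last by ring.
by rewrite -!expfzDr //; congr (- (_ ^ _ * _)); ring.
Qed.
End ThetaPairs.

(** * The product of two theta series *)

Section ThetaProduct.
Variables (R : realType) (p : R).
Local Notation C := R[i].
Hypothesis p01 : 0 < p < 1.
Let P : C := p%:C.

Let p0 : 0 < p. Proof. by case/andP: p01. Qed.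
Let p1 : p < 1. Proof. by case/andP: p01. Qed.
Let P0 : P != 0. Proof. by rewrite -modulus_gt0 modulus_real gtr0_norm. Qed.

Variable rp : C.
Hypothesis rp2 : rp ^+ 2 = P.

Let rp0 : rp != 0.
Proof. by apply: contraNneq P0 => rpE; rewrite -rp2 rpE expr0n. Qed.

Let rp_even (m : int) : rp ^ (2 * m) = P ^ m.
Proof. by rewrite -exprz_exp -rp2. Qed.

Lemma modulus_exprz (z : C) (m : int) : modulus (z ^ m) = modulus z ^ m.
Proof. by case: m => m; rewrite /exprz ?modulusV modulusX. Qed.

Lemma modulusP_exprz_le (k : nat) (m : int) : 'C(k, 2)%:Z <= m -> modulus (P ^ m) <= p ^+ 'C(k, 2).
Proof.
case: m => // m; rewrite lez_nat => km; rewrite modulus_exprz modulus_real gtr0_norm //.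
by rewrite /exprz ler_wiXn2l // ltW.
Qed.

Lemma intbin2 (k : nat) : k%:Z * k%:Z = 2 * 'C(k, 2)%:Z + k%:Z.
Proof. have := mul_bin2 k; lia. Qed.

(* rp is a square root of p, so that rp ^ (m * m - m) = p ^ (m (m - 1) / 2). *)
Definition theta_term (z : C) (m : int) : C := (-1) ^ m * rp ^ (m * m - m) * z ^ m.

Definition gauss_term (b : int) (x : C) (m : int) : C := P ^ (m * m + b * m) * x ^ (2 * m).

Lemma theta_term_bound z : z != 0 ->
  exists2 Q : R, 0 <= Q & forall m, modulus (theta_term z m) <= Q * 2^-1 ^+ `|m|%N.
Proof.
move=> z0; have mz : 0 < modulus z by rewrite modulus_gt0.
pose r := modulus z + p / modulus z.
have pz : 0 <= p / modulus z by rewrite divr_ge0 // ltW.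
have r0 : 0 <= r by rewrite addr_ge0 ?modulus_ge0.
have rz k : modulus z ^+ k <= r ^+ k by rewrite lerXn2r ?nnegrE ?modulus_ge0 // lerDl.
have rpz k : (p / modulus z) ^+ k <= r ^+ k.
  by rewrite lerXn2r ?nnegrE // lerDr modulus_ge0.
have sgn (m : int) : modulus ((-1 : C) ^ m) = 1 by rewrite modulus_exprz modulusN modulus1 exp1rz.
apply: (@birapid_bound _ _ 1 p r) => [//|//|//|k].
rewrite /theta_term !modulusM.
rewrite (sgn k%:Z) (sgn (- k%:Z)) !mul1r.
rewrite (_ : k%:Z * k%:Z - k%:Z = 2 * 'C(k, 2)%:Z); last by rewrite intbin2; ring.
rewrite (_ : - k%:Z * - k%:Z - - k%:Z = 2 * ('C(k, 2)%:Z + k%:Z)); last first.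
  by rewrite mulrNN intbin2; ring.
rewrite !rp_even !modulus_exprz modulus_real (gtr0_norm p0); split.
  by apply: ler_wpM2l; [rewrite exprn_ge0 // ltW|exact: rz].
rewrite expfzDr ?gt_eqF // -mulrA -exprnN; apply: ler_wpM2l; first by rewrite exprn_ge0 // ltW.
by rewrite -exprnP -exprVn -exprMn; exact: rpz.
Qed.

Lemma gauss_term_bound (b : int) x : x != 0 -> `|b| <= 1 ->
  exists2 Q : R, 0 <= Q & forall m, modulus (gauss_term b x m) <= Q * 2^-1 ^+ `|m|%N.
Proof.
move=> x0 b1; have mx : 0 < modulus x by rewrite modulus_gt0.
pose r := modulus x ^+ 2 + (modulus x ^+ 2)^-1.
have r0 : 0 <= r by rewrite addr_ge0 ?invr_ge0 ?exprn_ge0 ?modulus_ge0.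
apply: (@birapid_bound _ _ 1 p r) => [//|//|//|k].
rewrite /gauss_term !modulusM !mul1r.
have kk := intbin2 k.
split; apply: ler_pM; rewrite ?modulus_ge0 //.
- by apply: modulusP_exprz_le; rewrite kk; nia.
- rewrite modulus_exprz -exprz_exp -!exprnP lerXn2r ?nnegrE ?exprn_ge0 ?modulus_ge0 //.
  by rewrite lerDl invr_ge0 exprn_ge0 // modulus_ge0.
- by apply: modulusP_exprz_le; rewrite mulrNN kk; nia.
rewrite modulus_exprz -exprz_exp -exprnP -exprnN -exprVn.
rewrite lerXn2r ?nnegrE ?invr_ge0 ?exprn_ge0 ?modulus_ge0 //.
by rewrite lerDr exprn_ge0 // modulus_ge0.
Qed.

Definition gauss_sum (b : int) (x : C) : C :=
  lim ((fun N => \sum_(m <- zrange N) gauss_term b x m) @ \oo).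

Lemma gauss_cvg b x : x != 0 -> `|b| <= 1 ->
  (fun N => \sum_(m <- zrange N) gauss_term b x m) @ \oo --> gauss_sum b x.
Proof.
move=> x0 b1; have [Q Q0 H] := gauss_term_bound x0 b1.
have [l Hl] := bilateral_cvg H.
by rewrite /gauss_sum (cvg_complex_lim Hl).
Qed.

Definition theta_sum (z : C) : C := power_sum (hcoef p) z + power_sum (hcoef p) (P / z).

Lemma theta_sum_cvg z : z != 0 ->
  (fun N => \sum_(m <- zrange N) theta_term z m) @ \oo --> theta_sum z.
Proof.
move=> z0.
have h1 := cvg_reindex (f := succn) (power_sum_cvg (z := z) (hcoef_entire p01)).
have h2 := cvg_reindex (f := succn) (power_sum_cvg (z := P / z) (hcoef_entire p01)).
have sc m : exists N, forall n, (N <= n)%N -> (m <= n.+1)%N by exists m => n; exact: leqW.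
have h := cvgDC (h1 sc) (h2 sc).
rewrite (_ : (fun N => _) = (fun N =>
   series (fun k => hcoef p k * z ^+ k) N.+1 + series (fun k => hcoef p k * (P / z) ^+ k) N.+1)).
  exact: h.
apply/funext => N; rewrite zrange_fold /series /= -big_split /=.
apply: eq_bigr => -[_|k _].
  rewrite /theta_term /hcoef /jcoef /= !expr0 !mul1r.
  by rewrite expr0z; field.
rewrite /= /hcoef /jcoef /= mulr1 -mulrDr /theta_term.
set K := k.+1.
rewrite (_ : K%:Z * K%:Z - K%:Z = 2 * 'C(K, 2)%:Z); last by rewrite intbin2; ring.
rewrite (_ : - K%:Z * - K%:Z - - K%:Z = 2 * ('C(K, 2)%:Z + K%:Z)); last first.
  by rewrite mulrNN intbin2; ring.
rewrite !rp_even expfzDr // -!exprnN -!exprnP.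
rewrite (_ : (-1) ^- K = (-1) ^+ K :> C); last by rewrite -exprVn invrN invr1.
rewrite -/P exprMn exprVn; ring.
Qed.

(** The product of partial sums runs over a box; up to a vanishing error it may be taken over a
    diamond, where the even and the odd points each give a product of two Gauss sums. *)
Lemma theta_product x y : x != 0 -> y != 0 ->
  theta_sum (x * y) * theta_sum (x / y) =
  x * (x * gauss_sum 1 x) * gauss_sum 0 y - x * gauss_sum 0 x * (y * gauss_sum 1 y).
Proof.
move=> x0 y0.
have xy0 : x * y != 0 by rewrite mulf_neq0.
have xVy0 : x / y != 0 by rewrite mulf_neq0 ?invr_eq0.
have [Q1 _ H1] := theta_term_bound xy0; have [Q2 _ H2] := theta_term_bound xVy0.
have D := double_sum_cvg H1 H2.
have Bx := cvgMC (theta_sum_cvg xy0) (theta_sum_cvg xVy0).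
have S := cvgDC D Bx; rewrite add0r in S.
have N1 : `|-1 : int| <= 1 by [].
have g1x := gauss_cvg x0 (isT : `|1 : int| <= 1); have g0x := gauss_cvg x0 (isT : `|0 : int| <= 1).
have g1y := gauss_cvg y0 (isT : `|1 : int| <= 1); have g0y := gauss_cvg y0 (isT : `|0 : int| <= 1).
(* Replacing [m] by [m + 1] turns the linear coefficient -1 into 1 at the cost of [x ^ 2]; this
   leaves only the sums for 0 and 1, as the antisymmetric form requires. *)
have gNx : (fun N => \sum_(m <- zrange N) gauss_term (-1) x m) @ \oo --> x * (x * gauss_sum 1 x).
  have gN := gauss_cvg x0 N1; have [Q _ HQ] := gauss_term_bound x0 N1.
  have sh := zrange_shift HQ gN.
  have E : (fun N => \sum_(i <- zrange N) gauss_term (-1) x (i + 1)) =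
     (fun N => (x * x) * \sum_(i <- zrange N) gauss_term 1 x i).
    apply/funext => N; rewrite mulr_sumr; apply: eq_bigr => m _; rewrite /gauss_term.
    rewrite (_ : (m + 1) * (m + 1) + -1 * (m + 1) = m * m + 1 * m); last by ring.
    rewrite (_ : 2 * (m + 1) = 2 * m + 2); last by ring.
    by rewrite [x ^ (_ + _)]expfzDr // (_ : x ^ (2 : int) = x * x) //; ring.
  rewrite E in sh; have sh' := cvgMC (cvg_cstC (x * x)) g1x.
  by have := cvg_complex_unique sh sh'; rewrite -mulrA => <-.
have L := cvgBC (cvgMC gNx g0y) (cvgMC (cvgMC (cvg_cstC x) g0x)
                                     (cvgMC (cvg_cstC y) g1y)).
apply: (cvg_complex_unique S).
rewrite (_ : (fun N => _) = (fun N =>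
    (\sum_(m <- zrange N) gauss_term (-1) x m) * (\sum_(m <- zrange N) gauss_term 0 y m)
  - x * (\sum_(m <- zrange N) gauss_term 0 x m) * (y * \sum_(m <- zrange N) gauss_term 1 y m))).
  exact: L.
apply/funext => N.
have B := sum_box N (theta_term (x * y)) (theta_term (x / y)).
have B1 := sum_box N (gauss_term (-1) x) (gauss_term 0 y).
have B2 := sum_box N (gauss_term 0 x) (gauss_term 1 y).
rewrite -B subrK -B1 mulrACA -B2 /diamond big_cat !big_map mulr_sumr -sumrN.
have Ee s t := theta_pair_even rp0 x0 y0 s t; have Eo s t := theta_pair_odd rp0 x0 y0 s t.
rewrite rp2 in Ee Eo.
apply: congr2; apply: eq_bigr => -[s t] _; [exact: Ee | exact: Eo].
Qed.
End ThetaProduct.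

(** * The bracket [E] and its three-term identity *)

Section EllipticBracket.
Variables (R : realType) (p q : R).
Local Notation C := R[i].
Hypothesis p01 : 0 < p < 1.
Hypothesis q01 : 0 < q < 1.
Hypothesis pq_generic : forall a b : int, p ^ a * q ^ b = 1 -> a = 0 /\ b = 0.

Let p0 : 0 < p. Proof. by case/andP: p01. Qed.
Let q0 : 0 < q. Proof. by case/andP: q01. Qed.
Let P0 : p%:C != 0 :> C. Proof. by rewrite -modulus_gt0 modulus_real gtr0_norm. Qed.
Let Q0 : q%:C != 0 :> C. Proof. by rewrite -modulus_gt0 modulus_real gtr0_norm. Qed.

Lemma qpowD (s t : C) : qpow q (s + t) = qpow q s * qpow q t.
Proof. by rewrite /qpow mulrDr cexpD. Qed.

Lemma qpow0 : qpow q (0 : C) = 1.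
Proof. by rewrite /qpow mulr0 cexp0. Qed.

Lemma qpow_neq0 (s : C) : qpow q s != 0.
Proof. exact: cexp_neq0. Qed.

Lemma qpowN (s : C) : qpow q (- s) = (qpow q s)^-1.
Proof.
apply: (mulfI (qpow_neq0 s)); rewrite -qpowD subrr qpow0 mulfV //; exact: qpow_neq0.
Qed.

Lemma qpow1 : qpow q (1 : C) = q%:C.
Proof.
rewrite /qpow /cexp mulr1 /= lnK ?posrE // cos0 sin0.
by rewrite (_ : 1 +i* 0 = 1) // mulr1.
Qed.

Lemma qpow_int (m : int) : qpow q (m%:~R : C) = q%:C ^ m.
Proof.
have nat k : qpow q (k%:R : C) = q%:C ^+ k.
  by elim: k => [|k IH]; [rewrite qpow0|rewrite -natr1 qpowD IH qpow1 exprSr].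
by case: m => m; rewrite ?NegzE ?mulrNz ?qpowN -?pmulrn nat // -exprnN.
Qed.

Lemma qpow_modulus (s : C) : modulus (qpow q s) = expR (ln q * complex.Re s).
Proof. by rewrite /qpow cexp_modulus; case: s => a b /=; rewrite mul0r subr0. Qed.

Lemma E_theta_sum : exists c : C, forall s, E p q s = c * (qpow q s * theta_sum p (qpow q (- 2 * s))).
Proof.
have [c H] := theta_cvg_series p01; exists c => s.
have z0 := qpow_neq0 (- 2 * s).
rewrite /E mulrCA; congr (_ * _).
exact: (cvg_complex_unique (theta_cvg p01 z0) (H _ z0)).
Qed.

Lemma qpow_differentiable (a s : C) : differentiable (fun s => qpow q (a * s)) s.
Proof.
apply: (@differentiable_comp _ _ _ _ (fun s : C => (ln q)%:C * (a * s)) (@cexp R)).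
  apply: differentiableM; first exact: differentiable_cst.
  by apply: differentiableM => //; exact: differentiable_cst.
exact: cexp_differentiable.
Qed.

Lemma E_differentiable (s : C) : differentiable (E p q) s.
Proof.
have [c H] := E_theta_sum.
rewrite (_ : E p q = (fun s => c * (qpow q (1 * s) *
   (power_sum (hcoef p) (qpow q (- 2 * s)) + power_sum (hcoef p) (p%:C * qpow q (2 * s)))))).
  have pd z : differentiable (power_sum (hcoef p)) z.
    by apply: power_sum_differentiable; exact: hcoef_entire.
  apply: differentiableM; first exact: differentiable_cst.
  apply: differentiableM; first exact: qpow_differentiable.
  have cd (f : C -> C) : differentiable f s ->
      differentiable (fun t : C => power_sum (hcoef p) (f t)) s.
    by move=> df; have h := differentiable_comp df (pd (f s)); exact: h.
  have d1 := cd _ (@qpow_differentiable (- 2) s).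
  have d2 : differentiable (fun t : C => power_sum (hcoef p) (p%:C * qpow q (2 * t))) s.
    apply: cd; apply: differentiableM; first exact: differentiable_cst.
    exact: qpow_differentiable.
  exact: (differentiableD d1 d2).
apply/funext => t; rewrite H mul1r /theta_sum; congr (_ * (_ * (_ + power_sum _ (_ * _)))).
by rewrite mulNr qpowN invrK.
Qed.

(** The prefactors of [E] multiply to [q^(2 s)], the inverse of [x]. This removes the one factor [x]
    that keeps [theta_product] from being antisymmetric. *)
Lemma E_plucker : exists f g : C -> C,
  forall s t, E p q (s + t) * E p q (s - t) = f s * g t - g s * f t.
Proof.
have [c H] := E_theta_sum.
have rp2 : ((Num.sqrt p)%:C : C) ^+ 2 = p%:C by rewrite -rmorphXn sqr_sqrtr // ltW.
pose G := gauss_sum p.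
exists (fun s => c ^+ 2 * (qpow q (- 2 * s) * G 1 (qpow q (- 2 * s)))).
exists (fun s => G 0 (qpow q (- 2 * s))) => s t.
set x := qpow q (- 2 * s); set y := qpow q (- 2 * t).
have x0 : x != 0 by exact: qpow_neq0.
have y0 : y != 0 by exact: qpow_neq0.
have := theta_product p01 rp2 x0 y0; rewrite -/G.
have -> : x * y = qpow q (- 2 * (s + t)) by rewrite mulrDr qpowD.
have -> : x / y = qpow q (- 2 * (s - t)) by rewrite mulrBr qpowD qpowN.
rewrite !H => TP.
set T1 := theta_sum p _ in TP *; set T2 := theta_sum p _ in TP *.
rewrite (_ : c * _ * _ = c ^+ 2 * (qpow q (s + t) * qpow q (s - t)) * (T1 * T2)); last first.
  by move: (T1) (T2) (qpow q (s + t)) (qpow q (s - t)) => u1 u2 u3 u4; ring.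
rewrite TP -qpowD (_ : s + t + (s - t) = - (- 2 * s)); last by ring.
rewrite qpowN -/x.
move: (G 1 x) (G 0 x) (G 1 y) (G 0 y) => a b d e'; field.
by [].
Qed.

Lemma E_neq0 (s : C) : (forall k : int, qpow q (- 2 * s) != p%:C ^ k) -> E p q s != 0.
Proof.
move=> H; rewrite /E mulf_neq0 ?qpow_neq0 //.
by apply: theta_neq0 => //; exact: qpow_neq0.
Qed.

Lemma real_complex_exprz (x : R) (m : int) : (x%:C : C) ^ m = (x ^ m)%:C.
Proof. by case: m => m; rewrite /exprz ?fmorphV rmorphXn. Qed.

Lemma pq_neq (a b : int) : (a != 0) || (b != 0) -> (p%:C : C) ^ a * q%:C ^ b != 1.
Proof.
move=> ab; rewrite !real_complex_exprz -rmorphM -[1](rmorph1 (real_complex R)).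
apply: contraTneq ab => /complexI/pq_generic[-> ->].
by [].
Qed.

Lemma E_int_neq0 (m : int) : m != 0 -> E p q (m%:~R : C) != 0.
Proof.
move=> m0; apply: E_neq0 => k; rewrite (_ : - 2 * m%:~R = (2 * - m)%:~R); last by rewrite intrM mulrNz mulrN mulNr.
rewrite qpow_int.
have m2 : (- k != 0) || (2 * - m != 0) by rewrite [2 * _ != 0]mulf_neq0 ?orbT // oppr_eq0.
have := pq_neq m2.
apply: contraNneq => ->.
by rewrite -expfzDr // addNr expr0z.
Qed.

Lemma E1_neq0 : E p q (1 : C) != 0.
Proof. exact: (E_int_neq0 (isT : (1 : int) != 0)). Qed.

(** At [s = t = 1/2] the right side of [E_plucker] vanishes, while [E] is nonzero at 1. *)
Lemma E0 : E p q (0 : C) = 0.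
Proof.
have [f [g fg]] := E_plucker.
have := fg 2^-1 2^-1; rewrite subrr [g _ * _]mulrC subrr.
rewrite (_ : 2^-1 + 2^-1 = 1 :> C); last by field.
by move=> /eqP; rewrite mulf_eq0 (negPf E1_neq0) => /eqP.
Qed.

(** Exchanging the arguments in [E_plucker] changes the sign; they are chosen with sum 1 and
    difference [s]. *)
Lemma EN (s : C) : E p q (- s) = - E p q s.
Proof.
have [f [g fg]] := E_plucker.
apply: (mulfI E1_neq0).
have h1 := fg ((1 + s) / 2) ((1 - s) / 2); have h2 := fg ((1 - s) / 2) ((1 + s) / 2).
move: h1 h2.
rewrite (_ : (1 + s) / 2 + (1 - s) / 2 = 1); last by field.
rewrite (_ : (1 - s) / 2 + (1 + s) / 2 = 1); last by field.
rewrite (_ : (1 + s) / 2 - (1 - s) / 2 = s); last by field.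
rewrite (_ : (1 - s) / 2 - (1 + s) / 2 = - s); last by field.
by move=> h1 h2; rewrite h2 mulrN h1; ring.
Qed.

(** The Plucker relation for the 2 by 2 minors formed by [f] and [g] at four points [a], [b], [c],
    [d], whose pairwise sums and differences are the twelve arguments of the brackets. *)
Lemma E_three_term (m s t : C) :
  E p q (m - 1) * E p q t * (E p q (s + m) * E p q (s - t - 1)) =
  E p q m * E p q (t + 1) * (E p q (s - t) * E p q (s + m - 1))
  - E p q 1 * E p q (t + m) * (E p q s * E p q (s - t + m - 1)).
Proof.
have [f [g fg]] := E_plucker.
pose a := (2 * s + m - 1 - t) / 2; pose b := (m + t + 1) / 2.
pose c := (m - 1 + t) / 2; pose d := (m - t - 1) / 2.
have ab := fg a b; have cd := fg c d; have ac := fg a c; have bd := fg b d.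
have ad := fg a d; have bc := fg b c.
rewrite (_ : a + b = s + m) in ab; last by rewrite /a /b; field.
rewrite (_ : a - b = s - t - 1) in ab; last by rewrite /a /b; field.
rewrite (_ : c + d = m - 1) in cd; last by rewrite /c /d; field.
rewrite (_ : c - d = t) in cd; last by rewrite /c /d; field.
rewrite (_ : a + c = s + m - 1) in ac; last by rewrite /a /c; field.
rewrite (_ : a - c = s - t) in ac; last by rewrite /a /c; field.
rewrite (_ : b + d = m) in bd; last by rewrite /b /d; field.
rewrite (_ : b - d = t + 1) in bd; last by rewrite /b /d; field.
rewrite (_ : a + d = s - t + m - 1) in ad; last by rewrite /a /d; field.
rewrite (_ : a - d = s) in ad; last by rewrite /a /d; field.
rewrite (_ : b + c = t + m) in bc; last by rewrite /b /c; field.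
rewrite (_ : b - c = 1) in bc; last by rewrite /b /c; field.
rewrite [E p q (s - t) * _]mulrC [E p q s * _]mulrC [E p q 1 * _]mulrC.
by rewrite ab cd ac bd ad bc; ring.
Qed.

Lemma theta_qpow (s : C) : theta p (qpow q (2 * s)) = - qpow q s * E p q s.
Proof.
rewrite -[E p q s]opprK mulrNN -EN /E mulrN mulNr opprK mulrA -qpowD subrr qpow0 mul1r.
by [].
Qed.

Lemma alphaE (s u : C) : alpha p q s (qpow q (2 * u)) =
  E p q u / E p q (u + 1) * E p q (s + 1) * (E p q s)^-1.
Proof.
rewrite /alpha -qpow1 -[qpow q 1 ^+ 2]/(qpow q 1 * qpow q 1) -!qpowD.
rewrite (_ : 1 + 1 + 2 * u = 2 * (u + 1)); last by ring.
rewrite !theta_qpow !qpowD.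
move: (qpow_neq0 u) (qpow_neq0 s) (qpow_neq0 1).
move: (qpow q u) (qpow q s) (qpow q 1) (E p q u) (E p q s) (E p q (u + 1)) (E p q (s + 1)).
move=> a b c e1 e2 e3 e4 a0 b0 c0; rewrite !invfM.
move: e3^-1 e2^-1 => d1 d2; field.
by rewrite a0 b0 c0.
Qed.

Lemma betaE (s u : C) : beta p q s (qpow q (2 * u)) =
  E p q 1 / E p q (u + 1) * E p q (s - u) * (E p q s)^-1.
Proof.
rewrite /beta -qpow1 -[qpow q 1 ^+ 2]/(qpow q 1 * qpow q 1) -!qpowD.
rewrite (_ : 1 + 1 + 2 * u = 2 * (u + 1)); last by ring.
rewrite (_ : -2 * s + 2 * u = 2 * - (s - u)); last by ring.
rewrite (_ : -2 * s = 2 * - s); last by ring.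
rewrite (_ : 1 + 1 = 2 * 1 :> C); last by ring.
rewrite !theta_qpow !EN !(qpowN, qpowD).
move: (qpow_neq0 u) (qpow_neq0 s) (qpow_neq0 1).
move: (qpow q u) (qpow q s) (qpow q 1) (E p q 1) (E p q s) (E p q (u + 1)) (E p q (s - u)).
move=> a b c e1 e2 e3 e4 a0 b0 c0; rewrite !invfM !invrN ?invrK.
move: e3^-1 e2^-1 => d1 d2; field.
by rewrite a0 b0 c0.
Qed.

End EllipticBracket.

(** * Meromorphic functions on the dual Cartan subalgebra *)

Import VectorInternalTheory.
Local Open Scope quotient_scope.

Section Translation.
Variables (R : realType) (V : vectType R[i]).
Local Notation W := 'rV[R[i]]_(dim V).

Lemma mer_ind (P : mero V -> Prop) :
  (forall f, meromorphic f -> P (mer f)) -> forall a, P a.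
Proof. by move=> IH; elim/mero_ind => f mf; rewrite -merE; exact: IH. Qed.

Lemma mer_eq (f g : V -> R[i]) : meromorphic f -> meromorphic g -> mero_eq f g ->
  mer f = mer g.
Proof. by move=> mf mg fg; rewrite !merE; exact: mero_piE. Qed.

Lemma translation_differentiable (w y : W) : differentiable (fun y : W => y + w) y.
Proof. by apply: differentiableD; [by [] | exact: differentiable_cst]. Qed.

Lemma open_translate (w : W) (U : set W) : open U -> open [set y : W | U (y + w)].
Proof.
by move=> oU; apply: (open_comp _ oU) => y _; exact: differentiable_continuous (translation_differentiable w y).
Qed.

Lemma differentiable_translate (w : W) (g : W -> R[i]) x :
  differentiable g (x + w) -> differentiable (fun y : W => g (y + w)) x.
Proof.
move=> dg; have := differentiable_comp (translation_differentiable w x) dg.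
by [].
Qed.

Lemma r2v_translate (x : W) (v : V) : r2v x + v = r2v (x + v2r v).
Proof. by rewrite linearD /= v2rK. Qed.

Lemma meromorphic_translate v (f : V -> R[i]) :
  meromorphic f -> meromorphic (fun x => f (x + v)).
Proof.
move=> mf x; pose w := v2r v.
have [U [g [h [[oU Ux] dg dh nh fE]]]] := mf (x + w).
exists [set y | U (y + w)], (fun y => g (y + w)), (fun y => h (y + w)); split.
- by split; first exact: open_translate.
- by move=> y Uy; apply: differentiable_translate; exact: dg.
- by move=> y Uy; apply: differentiable_translate; exact: dh.
- move=> O oO [y Oy] OU.
  have [||z Oz hz] := nh _ (open_translate (w := - w) oO).
  + by exists (y + w); rewrite /= addrK.
  + by move=> z /OU; rewrite /= subrK.
  by exists (z - w); rewrite ?subrK.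
- by move=> y Uy hy; rewrite r2v_translate; exact: fE.
Qed.

Lemma mero_eq_translate v (f g : V -> R[i]) : mero_eq f g ->
  mero_eq (fun x => f (x + v)) (fun x => g (x + v)).
Proof.
move=> [D [oD dD fg]]; exists [set y | D (y + v2r v)]; split.
- exact: open_translate.
- move=> O [y Oy] oO.
  have [|z [Oz Dz]] := dD _ _ (open_translate (w := - v2r v) oO).
    by exists (y + v2r v); rewrite /= addrK.
  by exists (z - v2r v); split=> //=; rewrite subrK.
- by move=> y Dy; rewrite r2v_translate; exact: fg.
Qed.

(** The choice of representative is immaterial by [mero_eq_translate]. *)
Definition mshift v (a : mero V) : mero V := mer (fun x => repr a (x + v)).

Lemma mshiftE v f : meromorphic f -> mshift v (mer f) = mer (fun x => f (x + v)).
Proof.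
move=> mf; apply: mer_eq; rewrite ?merE; try exact: meromorphic_translate.
  by apply: meromorphic_translate; exact: mero_valP.
by apply: (@mero_eq_translate _ (mero_val (repr _))); exact: mero_reprE.
Qed.

Lemma mshift_zmod v : zmod_morphism (mshift v).
Proof.
elim/mer_ind=> f mf; elim/mer_ind=> g mg.
have mN : meromorphic (fun x => - g x) by exact: meromorphic_opp.
have merN (h : V -> R[i]) : meromorphic h -> mer (fun x => - h x) = - mer h.
  move=> mh; apply/eqP; rewrite -addr_eq0 -merD ?meromorphic_opp //; last exact: meromorphic_opp.
  by rewrite (_ : (fun x => _) = fun=> 0) ?mer_cst //; apply/funext => x; rewrite addNr.
rewrite -merN // -merD // !mshiftE //; last exact: meromorphic_add.
have mfv := meromorphic_translate v mf; have mgv := meromorphic_translate v mg.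
by rewrite merD ?merN //; exact: meromorphic_opp.
Qed.

Lemma mshift_monoid v : monoid_morphism (mshift v).
Proof.
split; first by rewrite /= -[1]/(mcst V 1) -mer_cst mshiftE //; exact: meromorphic_cst.
elim/mer_ind=> f mf; elim/mer_ind=> g mg.
rewrite -merM // !mshiftE //; last exact: meromorphic_mul.
by rewrite (merM (meromorphic_translate v mf) (meromorphic_translate v mg)).
Qed.

HB.instance Definition _ v := GRing.isZmodMorphism.Build _ _ _ (mshift_zmod v).
HB.instance Definition _ v := GRing.isMonoidMorphism.Build _ _ _ (mshift_monoid v).

Lemma meromorphic_prod (I : Type) (s : seq I) (P : pred I) (F : I -> V -> R[i]) :
  (forall i, meromorphic (F i)) -> meromorphic (fun x => \prod_(i <- s | P i) F i x).
Proof.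
move=> mF; elim: s => [|i s IH].
  by under eq_fun do rewrite big_nil; exact: meromorphic_cst.
under eq_fun do rewrite big_cons.
by case: (P i) => //=; exact: (meromorphic_mul (mF i) IH).
Qed.

Lemma mer_prod (I : Type) (s : seq I) (P : pred I) (F : I -> V -> R[i]) :
  (forall i, meromorphic (F i)) ->
  mer (fun x => \prod_(i <- s | P i) F i x) = \prod_(i <- s | P i) mer (F i).
Proof.
move=> mF; elim: s => [|i s IH].
  by under eq_fun do rewrite big_nil; rewrite big_nil mer_cst.
under eq_fun do rewrite big_cons; rewrite big_cons.
by case: (P i) => //=; rewrite (merM (mF i) (meromorphic_prod _ _ mF)) IH.
Qed.

Lemma meromorphic_sum (I : Type) (s : seq I) (P : pred I) (F : I -> V -> R[i]) :
  (forall i, meromorphic (F i)) -> meromorphic (fun x => \sum_(i <- s | P i) F i x).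
Proof.
move=> mF; elim: s => [|i s IH].
  by under eq_fun do rewrite big_nil; exact: meromorphic_cst.
under eq_fun do rewrite big_cons.
by case: (P i) => //=; exact: (meromorphic_add (mF i) IH).
Qed.

Lemma mer_sum (I : Type) (s : seq I) (P : pred I) (F : I -> V -> R[i]) :
  (forall i, meromorphic (F i)) ->
  mer (fun x => \sum_(i <- s | P i) F i x) = \sum_(i <- s | P i) mer (F i).
Proof.
move=> mF; elim: s => [|i s IH].
  by under eq_fun do rewrite big_nil; rewrite big_nil mer_cst.
under eq_fun do rewrite big_cons; rewrite big_cons.
by case: (P i) => //=; rewrite (merD (mF i) (meromorphic_sum _ _ mF)) IH.
Qed.

End Translation.

Section Entire.
Variables (R : realType) (V : vectType R[i]).
Local Notation C := R[i].
Local Notation W := 'rV[C]_(dim V).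

Definition entire (f : V -> C) := forall y : W, differentiable (fun y => f (r2v y)) y.
(** The nonvanishing that [meromorphic] asks of denominators; an entire function with this property
    is invertible in [mero V]. *)
Definition generic_neq0 (f : V -> C) :=
  forall O : set W, open O -> O !=set0 -> exists2 y, O y & f (r2v y) != 0.

Lemma entire_meromorphic f : entire f -> meromorphic f.
Proof.
move=> ef x; exists setT, (fun y => f (r2v y)), (fun=> 1); split.
- by split=> //; exact: openT.
- by move=> y _; exact: ef.
- by move=> y _; exact: differentiable_cst.
- by move=> O _ [y Oy] _; exists y => //; exact: oner_neq0.
- by move=> y _ _; rewrite divr1.
Qed.

Lemma entire_inv_meromorphic f : entire f -> generic_neq0 f ->
  meromorphic (fun x => (f x)^-1).
Proof.
move=> ef nf x; exists setT, (fun=> 1), (fun y => f (r2v y)); split.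
- by split=> //; exact: openT.
- by move=> y _; exact: differentiable_cst.
- by move=> y _; exact: ef.
- by move=> O oO O0 _; exact: nf.
- by move=> y _ _; rewrite div1r.
Qed.

Lemma generic_neq0_mul f g : entire f -> generic_neq0 f -> generic_neq0 g ->
  generic_neq0 (fun x => f x * g x).
Proof.
move=> ef nf ng O oO O0.
have hf : holomorphic_on setT (fun y => f (r2v y)) by move=> y _; exact: ef.
have nf' O' : open O' -> O' !=set0 -> O' `<=` setT -> exists2 y : W, O' y & f (r2v y) != 0.
  by move=> oO' O0' _; exact: nf.
have ng' O' : open O' -> O' !=set0 -> O' `<=` setT -> exists2 y : W, O' y & g (r2v y) != 0.
  by move=> oO' O0' _; exact: ng.
by apply: (nonvanishing_mul hf nf' ng' oO O0); rewrite setTI.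
Qed.

Lemma generic_neq0_dense f : entire f -> generic_neq0 f ->
  open [set y : W | f (r2v y) != 0] /\ dense [set y : W | f (r2v y) != 0].
Proof.
move=> ef nf; split; last first.
  by move=> O O0 oO; have [y Oy fy] := nf O oO O0; exists y.
rewrite openE => y fy; rewrite /interior.
have hf : holomorphic_on setT (fun y => f (r2v y)) by move=> z _; exact: ef.
have [U [oU Uy _ Uf]] := holomorphic_neq0_open hf openT (fun _ _ => I) I fy.
by rewrite nbhsE; exists U.
Qed.

Lemma mer_mulV f : entire f -> generic_neq0 f ->
  mer f * mer (fun x => (f x)^-1) = 1.
Proof.
move=> ef nf; have mf := entire_meromorphic ef; have mfV := entire_inv_meromorphic ef nf.
rewrite -(merM mf mfV) -[1]/(mcst V 1) -mer_cst.
apply: mer_eq; [exact: meromorphic_mul | exact: meromorphic_cst |].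
have [oD dD] := generic_neq0_dense ef nf.
by exists [set y | f (r2v y) != 0]; split=> // y /= fy; rewrite mulfV.
Qed.

End Entire.

Section Zpair.
Variables (R : realType) (n : nat).
Local Notation C := R[i].
Local Notation V := (hdual R n).
Local Notation W := 'rV[C]_(dim V).

Lemma zpairD (u v : V) i j : zpair (u + v) i j = zpair u i j + zpair v i j.
Proof. by rewrite /zpair add_lfunE. Qed.

Lemma zpairZ c (u : V) i j : zpair (c *: u) i j = c * zpair u i j.
Proof. by rewrite /zpair scale_lfunE. Qed.

Lemma zpair_chain (u : V) i j k : zpair u i j + zpair u j k = zpair u i k.
Proof.
pose d a b : 'M[C]_n := delta_mx a a - delta_mx b b.
have uD x y : u (vsproj (cartan R n) x) + u (vsproj (cartan R n) y) = u (vsproj (cartan R n) (x + y)).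
  by rewrite [in RHS]linearD; exact: (esym (linearD u _ _)).
by rewrite /zpair uD addrA subrK.
Qed.

Lemma zpairxx (u : V) i : zpair u i i = 0.
Proof. by apply: (addrI (zpair u i i)); rewrite zpair_chain addr0. Qed.

Lemma zpairN (u : V) i j : zpair u j i = - zpair u i j.
Proof. by apply/eqP; rewrite -addr_eq0 zpair_chain zpairxx. Qed.

(** The function under [linfun] in [omega], named so that it can be declared linear and [lfunE] can
    evaluate it. *)
Definition diag_coord (a : 'I_n) (h : subvs_of (cartan R n)) : C^o := vsval h a a.

Lemma diag_coord_linear a : linear (diag_coord a).
Proof. by move=> c x y; rewrite /diag_coord linearP !mxE. Qed.

HB.instance Definition _ a := GRing.isLinear.Build _ _ _ _ _ (diag_coord_linear a).

Lemma zpair_omega (a i j : 'I_n) : zpair (omega R a) i j = (a == i)%:R - (a == j)%:R.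
Proof.
rewrite /zpair /omega.
have -> : linfun (fun h : subvs_of (cartan R n) => vsval h a a : C^o) = linfun (diag_coord a) by [].
have K := vsprojK (delta_sub_cartan R i j).
transitivity (vsval (vsproj (cartan R n) (delta_mx i i - delta_mx j j)) a a); first by rewrite lfunE.
rewrite K.
by rewrite !mxE !andbb.
Qed.

Lemma zpair_differentiable i j (y : W) : differentiable (fun y : W => zpair (r2v y : V) i j) y.
Proof.
rewrite (_ : (fun y => _) =
    \sum_(k < dim V) (fun y : W => y 0 k * zpair (r2v (delta_mx 0 k) : V) i j)); last first.
  apply/funext => x; rewrite fct_sumE {1}(row_sum_delta x).
  have -> : r2v (\sum_k x 0 k *: delta_mx 0 k) = \sum_k x 0 k *: r2v (delta_mx 0 k) :> V.
    by rewrite linear_sum; apply: eq_bigr => k _; rewrite linearZ.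
  rewrite (big_morph (fun u : V => zpair u i j) (id1 := 0) (op1 := +%R)).
  - by apply: eq_bigr => k _; rewrite zpairZ.
  - by move=> u v; exact: zpairD.
  - by rewrite -(scale0r (0 : V)) zpairZ mul0r.
apply: differentiable_sum => k; apply: differentiableM; last exact: differentiable_cst.
exact: differentiable_coord.
Qed.
End Zpair.

Section Atoms.
Variables (R : realType) (n : nat) (p q : R).
Local Notation C := R[i].
Local Notation V := (hdual R n).
Local Notation W := 'rV[C]_(dim V).
Hypothesis p01 : 0 < p < 1.
Hypothesis q01 : 0 < q < 1.
Hypothesis pq_generic : forall a b : int, p ^ a * q ^ b = 1 -> a = 0 /\ b = 0.

Lemma E_atom_entire i j s : entire (fun u : V => E p q (zpair u i j + s)).
Proof.
move=> y; have dz : differentiable (fun y : W => zpair (r2v y : V) i j + s) y.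
  by apply: differentiableD; [exact: zpair_differentiable | exact: differentiable_cst].
have h := differentiable_comp dz (E_differentiable q p01 (zpair (r2v y : V) i j + s)).
exact: h.
Qed.

Lemma ln_exprz (x : R) (k : int) : 0 < x -> ln (x ^ k) = k%:~R * ln x.
Proof.
move=> x0; case: k => k; first by rewrite -exprnP lnXn // -pmulrn mulr_natl.
by rewrite NegzE -exprnN lnV ?posrE ?exprn_gt0 // lnXn // mulrNz mulNr -pmulrn mulr_natl.
Qed.

Lemma E_zero (s : C) : E p q s = 0 ->
  exists k : int, ln q * (- 2 * complex.Re s) = k%:~R * ln p.
Proof.
case/andP: (p01) => p0 p1 E0'.
have ReE (w : C) : complex.Re (- 2 * w) = - 2 * complex.Re w by case: w => a b /=; ring.
have : ~ (forall k : int, qpow q (- 2 * s) != p%:C ^ k).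
  by move=> /(E_neq0 p01); rewrite E0' eqxx.
move=> /existsNP[k /negP]; rewrite negbK => /eqP/(congr1 (@modulus R)).
rewrite qpow_modulus modulus_exprz modulus_real gtr0_norm // => /(congr1 (@ln R)).
rewrite expRK ln_exprz // => e; by exists k; rewrite -e ReE.
Qed.

(* The zeros of E have real parts in an arithmetic progression, so that s and a
   close enough s + t are not both zeros. *)
Lemma E_near_neq0 (s : C) (d : R) : 0 < d -> exists2 t : R, `|t| < d & E p q (s + t%:C) != 0.
Proof.
case/andP: (p01) => p0 p1; case/andP: (q01) => q0 q1 d0.
have lp : ln p < 0 by apply: ln_lt0; exact/andP.
have lq : ln q < 0 by apply: ln_lt0; exact/andP.
pose t := Num.min (d / 2) (ln p / (2 * ln q) / 2).
have pq0 : 0 < ln p / (2 * ln q) by rewrite -mulrNN -invrN divr_gt0 //; lra.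
have t0 : 0 < t by rewrite lt_min; apply/andP; split; lra.
have td : t < d by rewrite gt_min; apply/orP; left; lra.
have tpq : t < ln p / (2 * ln q) by rewrite gt_min; apply/orP; right; lra.
have [Es|Es] := eqVneq (E p q s) 0; last by exists 0; rewrite ?normr0 ?addr0.
exists t; first by rewrite gtr0_norm.
apply/eqP => /E_zero[k1 k1E]; have [k0 k0E] := E_zero Es.
have kE : ln q * (- 2 * t) = (k1 - k0)%:~R * ln p.
  rewrite intrB mulrBl -k1E -k0E; case: (s) => a b /=; lra.
have kneg : (k1 - k0 < 0)%R.
  rewrite -(ltrz0 R) -(nmulr_lgt0 _ lp) -kE; nra.
have : (k1 - k0)%:~R <= - 1 :> R.
  by rewrite -[-1 : R]/((-1)%:~R) ler_int -ltzD1 addNr.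
have : ln q * (2 * t) > ln p.
  by have := tpq; rewrite -(ltr_nM2l (x := 2 * ln q)) ?pmulr_rlt0 // mulrC divfK; nra.
nra.
Qed.

(** Moving by [t] times [omega(i)] adds [t] to [zeta_ij], and [E_near_neq0] supplies arbitrarily
    small real [t] off the zeros. *)
Lemma E_atom_generic i j s : i != j -> generic_neq0 (fun u : V => E p q (zpair u i j + s)).
Proof.
move=> ij O oO [y Oy]; pose w : W := v2r (omega R i).
have nb : nbhs (0 : C) [set t : C | O (y + t *: w)].
  have ct : continuous (fun t : C => y + t *: w).
    move=> t; have sc : (fun t : C => t *: w) @ t --> t *: w by exact: scalel_continuous.
    by have h := cvgD (cvg_cst y) sc; exact: h.
  apply: (ct 0); rewrite scale0r addr0.
  by apply: open_nbhs_nbhs.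
have [e e0 eO] := nbhs_norm0P.1 nb.
have e0' : 0 < complex.Re e by move: e0 => /=; rewrite ltcE => /andP[].
have eE : e = (complex.Re e)%:C.
  by move: e0 => /=; rewrite ltcE => /andP[/eqP]; case: (e) => a b /= ->.
have [t tlt Et] := E_near_neq0 (zpair (r2v y) i j + s) e0'.
exists (y + t%:C *: w).
  by apply: eO; rewrite /= modulusE modulus_real eE ltcR.
rewrite linearD linearZ /= v2rK zpairD zpairZ zpair_omega eqxx (negPf ij) subr0 mulr1.
by rewrite addrAC.
Qed.

End Atoms.

(** * The relations of the elliptic algebra *)

Section Maps.
Variables (R : realType) (n : nat) (p q : R).
Local Notation C := R[i].
Local Notation V := (hdual R n).
Local Notation K := (mero V).
Local Notation A := (fell n p q).

Lemma fell_piD (x y : fexpr R n) : \pi_A (Xadd x y) = \pi_A x + \pi_A y.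
Proof. by rewrite [RHS]fell_add_pi. Qed.

Lemma fell_piM (x y : fexpr R n) : \pi_A (Xmul x y) = \pi_A x * \pi_A y.
Proof. by rewrite [RHS]fell_mul_pi. Qed.

Lemma fell_piB (x y : fexpr R n) : \pi_A (Xsub x y) = \pi_A x - \pi_A y.
Proof. by rewrite /Xsub fell_piD fell_piM. Qed.

Lemma fell_pi_rel (x y : fexpr R n) : fell_rel p q x y -> \pi_A x = \pi_A y.
Proof. by move=> xy; apply: fell_piE; apply: eqv_rel. Qed.

Definition lmap (f : K) : A := \pi_A (Xlam f).
Definition rmap (f : K) : A := \pi_A (Xrho f).

Lemma lmap_zmod : zmod_morphism lmap.
Proof.
move=> f g; apply/(addIr (lmap g)); rewrite subrK /lmap -fell_piD.
by apply/esym; rewrite -{1}(subrK g f); apply: fell_pi_rel; exact: rel_lamD.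
Qed.

Lemma lmap_monoid : monoid_morphism lmap.
Proof.
split; first by apply: (fell_pi_rel (rel_lam_cst _ _ _ _)).
by move=> f g; rewrite /lmap -fell_piM; apply: fell_pi_rel; exact: rel_lamM.
Qed.

Lemma rmap_zmod : zmod_morphism rmap.
Proof.
move=> f g; apply/(addIr (rmap g)); rewrite subrK /rmap -fell_piD.
by apply/esym; rewrite -{1}(subrK g f); apply: fell_pi_rel; exact: rel_rhoD.
Qed.

Lemma rmap_monoid : monoid_morphism rmap.
Proof.
split; first by apply: (fell_pi_rel (rel_rho_cst _ _ _ _)).
by move=> f g; rewrite /rmap -fell_piM; apply: fell_pi_rel; exact: rel_rhoM.
Qed.

HB.instance Definition _ := GRing.isZmodMorphism.Build _ _ _ lmap_zmod.
HB.instance Definition _ := GRing.isMonoidMorphism.Build _ _ _ lmap_monoid.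
HB.instance Definition _ := GRing.isZmodMorphism.Build _ _ _ rmap_zmod.
HB.instance Definition _ := GRing.isMonoidMorphism.Build _ _ _ rmap_monoid.

Lemma lrmapC f g : lmap f * rmap g = rmap g * lmap f.
Proof. by rewrite /lmap /rmap -!fell_piM; apply: fell_pi_rel; exact: rel_lam_rho. Qed.

Lemma lmap_cst c : lmap (mcst V c) = c *: 1.
Proof. by rewrite -[RHS]/(fell_cst _ _ _ c * 1) mulr1; apply: fell_pi_rel; exact: rel_lam_cst. Qed.

Lemma rmap_cst c : rmap (mcst V c) = c *: 1.
Proof. by rewrite -[RHS]/(fell_cst _ _ _ c * 1) mulr1; apply: fell_pi_rel; exact: rel_rho_cst. Qed.

Lemma fell_double_eq0 (u : A) : u + u = 0 -> u = 0.
Proof.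
rewrite -mulr2n -scaler_nat => u2.
have two0 : (2%:R : C) != 0 by rewrite pnatr_eq0.
by rewrite -[u]scale1r -(mulVf two0) -scalerA u2 scaler0.
Qed.

(** Coefficients are collected on the left, hence the shift opposite to the one in the defining
    relations. *)
Definition unshift (a : 'I_n) : {rmorphism K -> K} := mshift (- omega R a).

Lemma egen_lmap a b z f : z != 0 ->
  egen p q a b z * lmap f = lmap (unshift a f) * egen p q a b z.
Proof.
move=> z0; elim/mer_ind: f => f mf; rewrite /unshift /= mshiftE //.
have mf' := meromorphic_translate (- omega R a) mf.
have := fell_pi_rel (rel_lam_e p q a b z0 mf'); rewrite !fell_piM => ->.
by congr (_ * lmap (mer _)); apply/funext => u; rewrite addrK.
Qed.

Lemma egen_rmap a b z f : z != 0 ->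
  egen p q a b z * rmap f = rmap (unshift b f) * egen p q a b z.
Proof.
move=> z0; elim/mer_ind: f => f mf; rewrite /unshift /= mshiftE //.
have mf' := meromorphic_translate (- omega R b) mf.
have := fell_pi_rel (rel_rho_e p q a b z0 mf'); rewrite !fell_piM => ->.
by congr (_ * rmap (mer _)); apply/funext => u; rewrite addrK.
Qed.

End Maps.

(** * The structure functions as brackets *)

Section Coefficients.
Variables (R : realType) (n : nat) (p q : R).
Local Notation C := R[i].
Local Notation V := (hdual R n).
Local Notation K := (mero V).
Local Notation W := 'rV[C]_(dim V).
Local Notation br := (E p q).
Hypothesis p01 : 0 < p < 1.
Hypothesis q01 : 0 < q < 1.
Hypothesis pq_generic : forall a b : int, p ^ a * q ^ b = 1 -> a = 0 /\ b = 0.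

(* The signums vanish on sets that meet; accordingly xval is set to 0 on the
   diagonal, while yval is 0 there because 1 / E(0) = 1 / 0 = 0. *)
Definition xval a c (u : V) : C := if a == c then 0 else br (zpair u a c + 1).
Definition yval a c (u : V) : C := (br (zpair u a c))^-1.

Lemma entire_prod (I : Type) (s : seq I) (P : pred I) (F : I -> V -> C) :
  (forall i, P i -> entire (F i)) -> entire (fun u => \prod_(i <- s | P i) F i u).
Proof.
move=> eF y; elim: s => [|i s IH].
  by under eq_fun do rewrite big_nil; exact: differentiable_cst.
under eq_fun do rewrite big_cons.
case Pi: (P i) => //=; have h := differentiableM (eF i Pi y) IH; exact: h.
Qed.

Lemma generic_neq0_prod (I : Type) (s : seq I) (P : pred I) (F : I -> V -> C) :
  (forall i, P i -> entire (F i)) -> (forall i, P i -> generic_neq0 (F i)) ->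
  generic_neq0 (fun u => \prod_(i <- s | P i) F i u).
Proof.
move=> eF nF; elim: s => [|i s IH].
  by under eq_fun do rewrite big_nil; move=> O _ [y Oy]; exists y => //; exact: oner_neq0.
under eq_fun do rewrite big_cons.
by case Pi: (P i) => //=; exact: (generic_neq0_mul (eF i Pi) (nF i Pi) IH).
Qed.

Lemma E_zpair_entire a c : entire (fun u : V => br (zpair u a c)).
Proof.
rewrite (_ : (fun u => _) = fun u => br (zpair u a c + 0)); first exact: E_atom_entire.
by apply/funext => u; rewrite addr0.
Qed.

Lemma E_zpair_generic a c : a != c -> generic_neq0 (fun u : V => br (zpair u a c)).
Proof.
rewrite (_ : (fun u => _) = fun u => br (zpair u a c + 0)); first exact: E_atom_generic.
by apply/funext => u; rewrite addr0.
Qed.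

Lemma xval_meromorphic a c : meromorphic (xval a c).
Proof.
rewrite /xval; case: (a == c); first exact: meromorphic_cst.
by apply: entire_meromorphic; exact: E_atom_entire.
Qed.

Lemma yvalxx a u : yval a a u = 0.
Proof. by rewrite /yval zpairxx (E0 p01 q01 pq_generic) invr0. Qed.

Lemma yval_meromorphic a c : meromorphic (yval a c).
Proof.
have [->|ac] := eqVneq a c.
  rewrite (_ : yval c c = fun=> 0); first exact: meromorphic_cst.
  by apply/funext => u; exact: yvalxx.
by apply: entire_inv_meromorphic; [exact: E_zpair_entire | exact: E_zpair_generic].
Qed.

Definition xmer a c : K := mer (xval a c).
Definition ymer a c : K := mer (yval a c).
(** The factor of [alpha(s, q^(-2m))] that does not depend on [s], from [alphaE] at [u = - m]; its
    denominator vanishes at [m = 1]. *)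
Definition kappa m : C := br (- m%:R) / br (1 - m%:R).
Definition betaval m a c (u : V) : C := beta p q (zpair u a c) (q%:C ^- (2 * m)).
Definition kappamer m : K := mcst V (kappa m).
Definition betamer m a c : K := mer (betaval m a c).

Lemma qpow_even m : q%:C ^- (2 * m) = qpow q (2 * - m%:R : C).
Proof.
rewrite mulrN qpowN; congr (_^-1).
rewrite exprnP -(qpow_int q01); congr (qpow q _).
by rewrite -pmulrn natrM.
Qed.

Lemma q2E : q%:C ^+ 2 = qpow q (2 * 1 : C).
Proof. by rewrite mulr1 exprnP -(qpow_int q01). Qed.

Lemma xmer0 a : xmer a a = 0.
Proof.
rewrite /xmer (_ : xval a a = fun=> 0) ?mer_cst //.
by apply/funext => u; rewrite /xval eqxx.
Qed.

Lemma ymer0 a : ymer a a = 0.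
Proof.
rewrite /ymer (_ : yval a a = fun=> 0) ?mer_cst //.
by apply/funext => u; exact: yvalxx.
Qed.

Lemma xmerV a c : a != c -> invertible (xmer a c).
Proof.
move=> ac; exists (mer (fun u => (br (zpair u a c + 1))^-1)).
rewrite /xmer /xval (negPf ac); apply: mer_mulV; first exact: E_atom_entire.
exact: E_atom_generic.
Qed.

Lemma ymerV a c : a != c -> invertible (ymer a c).
Proof.
move=> ac; exists (mer (fun u => br (zpair u a c))).
rewrite mulrC; apply: mer_mulV; first exact: E_zpair_entire.
exact: E_zpair_generic.
Qed.

Lemma ymerN a c : ymer c a = - ymer a c.
Proof.
apply/eqP; rewrite -addr_eq0 /ymer -merD; try exact: yval_meromorphic.
rewrite (_ : (fun u => _) = fun=> 0) ?mer_cst //; apply/funext => u.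
by rewrite /yval zpairN (EN p01 q01 pq_generic) invrN addNr.
Qed.

Lemma zpair_unshift a i j (u : V) : a != i -> a != j -> zpair (u - omega R a) i j = zpair u i j.
Proof.
move=> ai aj; rewrite zpairD -scaleN1r zpairZ zpair_omega (negPf ai) (negPf aj).
by rewrite subrr mulr0 addr0.
Qed.

Lemma unshift_xmer a i j : a != i -> a != j -> unshift R a (xmer i j) = xmer i j.
Proof.
move=> ai aj; rewrite /unshift /= mshiftE; last exact: xval_meromorphic.
by congr mer; apply/funext => u; rewrite /xval zpair_unshift.
Qed.

Lemma unshift_ymer a i j : a != i -> a != j -> unshift R a (ymer i j) = ymer i j.
Proof.
move=> ai aj; rewrite /unshift /= mshiftE; last exact: yval_meromorphic.
by congr mer; apply/funext => u; rewrite /yval zpair_unshift.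
Qed.

Lemma E_nat_neq0 m : br (m.+1%:R) != 0.
Proof.
rewrite (_ : m.+1%:R = (m.+1 : int)%:~R :> C); last by rewrite pmulrn.
exact: (E_int_neq0 p01 q01 pq_generic).
Qed.

Lemma E_1subn_neq0 m : (1 < m)%N -> br (1 - m%:R) != 0.
Proof.
case: m => [|[|m]] // _.
rewrite (_ : 1 - m.+2%:R = - m.+1%:R); last by rewrite -[m.+2]addn1 natrD opprD addrCA subrr addr0.
by rewrite (EN p01 q01 pq_generic) oppr_eq0; exact: E_nat_neq0.
Qed.

Lemma E_Nn_neq0 m : (0 < m)%N -> br (- m%:R) != 0.
Proof. by case: m => // m _; rewrite (EN p01 q01 pq_generic) oppr_eq0; exact: E_nat_neq0. Qed.

Lemma kappamerV m : (1 < m)%N -> invertible (kappamer m).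
Proof.
move=> m1; exists (mcst V (kappa m)^-1); rewrite /kappamer -mcstM mulfV //.
apply: mulf_neq0; first by apply: E_Nn_neq0; exact: ltnW.
by apply: invr_neq0; exact: E_1subn_neq0.
Qed.

Lemma alpha_mer m a c : a != c ->
  mer (fun u : V => alpha p q (zpair u a c) (q%:C ^- (2 * m))) = kappamer m * xmer a c * ymer a c.
Proof.
move=> ac; rewrite /kappamer -mer_cst /xmer /ymer -merM; last 2 first.
- exact: meromorphic_cst.
- exact: xval_meromorphic.
rewrite -merM; last 2 first.
- by apply: meromorphic_mul; [exact: meromorphic_cst | exact: xval_meromorphic].
- exact: yval_meromorphic.
congr mer; apply/funext => u; rewrite qpow_even (alphaE p01 q01 pq_generic) /xval (negPf ac).
by rewrite /kappa [- m%:R + 1]addrC.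
Qed.

Definition two_ratio : C := br 1 / br (1 + 1).

Lemma alpha2_mer a c : a != c ->
  mer (fun u : V => alpha p q (zpair u a c) (q%:C ^+ 2)) = mcst V two_ratio * xmer a c * ymer a c.
Proof.
move=> ac; rewrite -mer_cst /xmer /ymer -merM; last 2 first.
- exact: meromorphic_cst.
- exact: xval_meromorphic.
rewrite -merM; last 2 first.
- by apply: meromorphic_mul; [exact: meromorphic_cst | exact: xval_meromorphic].
- exact: yval_meromorphic.
congr mer; apply/funext => u; rewrite q2E (alphaE p01 q01 pq_generic) /xval (negPf ac).
by [].
Qed.

(** At [z = q^2] one has [beta(s, z) = alpha(- s, z)], because the bracket is odd. This symmetry
    makes relations (2) and (3) collapse at that ratio. *)
Lemma beta2_mer a c : a != c ->
  mer (fun u : V => beta p q (zpair u a c) (q%:C ^+ 2)) = mcst V two_ratio * xmer c a * ymer c a.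
Proof.
move=> ac; have ca : c != a by rewrite eq_sym.
rewrite -(alpha2_mer ca); congr mer; apply/funext => u.
rewrite q2E (alphaE p01 q01 pq_generic) (betaE p01 q01 pq_generic) (zpairN u a c).
rewrite (_ : - zpair u a c + 1 = - (zpair u a c - 1)); last by rewrite opprB addrC.
by rewrite !(EN p01 q01 pq_generic) invrN !mulrN mulNr opprK.
Qed.

Lemma two_ratioV : invertible (mcst V two_ratio).
Proof.
exists (mcst V two_ratio^-1); rewrite -mcstM mulfV //.
by apply: mulf_neq0; [exact: (E_nat_neq0 0) | apply: invr_neq0; exact: (E_nat_neq0 1)].
Qed.

End Coefficients.

Section BetaSum.
Variables (R : realType) (n : nat) (p q : R).
Local Notation C := R[i].
Local Notation V := (hdual R n).
Local Notation K := (mero V).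
Local Notation W := 'rV[C]_(dim V).
Local Notation br := (E p q).
Local Notation xval := (@xval R n p q).
Local Notation yval := (@yval R n p q).
Hypothesis p01 : 0 < p < 1.
Hypothesis q01 : 0 < q < 1.
Hypothesis pq_generic : forall a b : int, p ^ a * q ^ b = 1 -> a = 0 /\ b = 0.

Let mx := xval_meromorphic (n := n) q p01.
Let my := yval_meromorphic (n := n) p01 q01 pq_generic.

Lemma betavalE m a c (u : V) :
  betaval p q m a c u = br 1 / br (1 - m%:R) * br (zpair u a c + m%:R) * yval a c u.
Proof.
by rewrite /betaval qpow_even // (betaE p01 q01 pq_generic) opprK [- m%:R + 1]addrC.
Qed.

Lemma betaval_meromorphic m a c : meromorphic (@betaval R n p q m a c).
Proof.
rewrite (_ : betaval p q m a c = fun u : V => br 1 / br (1 - m%:R) * br (zpair u a c + m%:R) * yval a c u); last first.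
  by apply/funext => u; exact: betavalE.
have h1 := meromorphic_mul (@meromorphic_cst R V (br 1 / br (1 - m%:R)))
  (entire_meromorphic (E_atom_entire (n := n) q p01 a c m%:R)).
exact: (meromorphic_mul h1 (my a c)).
Qed.

Let mp I (P : pred 'I_n) (F : 'I_n -> V -> C) (mF : forall i, meromorphic (F i)) :
  mer (fun u => \prod_(j <- I | P j) F j u) = \prod_(j <- I | P j) mer (F j) := mer_prod I P mF.

(** This is [bracket_sum] with [x j = zeta_(j a0)] and base point 0, applied pointwise on a dense
    open set. *)
Lemma mer_beta_sum (Z : {set 'I_n}) a0 : (1 < #|Z|)%N -> a0 \notin Z ->
  \sum_(a in Z) signum (@ymer R n p q) [set a] (Z :\ a)
     * signum (fun i j => @xmer R n p q j i) [set a] (Z :\ a) * betamer p q #|Z| a a0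
  = kappamer n p q #|Z| * signum (fun i j => xmer p q j i) [set a0] Z * signum (ymer p q) [set a0] Z.
Proof.
move=> Z1 a0Z; set m := #|Z|.
pose prodx a J (u : V) := \prod_(j in J : {set 'I_n}) xval j a u.
pose prody a J (u : V) := \prod_(j in J : {set 'I_n}) yval a j u.
have mpx a J : meromorphic (prodx a J) by apply: meromorphic_prod => j; exact: mx.
have mpy a J : meromorphic (prody a J) by apply: meromorphic_prod => j; exact: my.
have sxE a J : signum (fun i j => @xmer R n p q j i) [set a] J = mer (prodx a J).
  by rewrite /signum big_set1 /prodx (mp _ _ (fun j => mx j a)).
have syE a J : signum (@ymer R n p q) [set a] J = mer (prody a J).
  by rewrite /signum big_set1 /prody (mp _ _ (fun j => my a j)).
have mb := betaval_meromorphic m.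
pose L a (u : V) := prody a (Z :\ a) u * prodx a (Z :\ a) u * betaval p q m a a0 u.
have mL a : meromorphic (L a).
  exact: (meromorphic_mul (meromorphic_mul (mpy _ _) (mpx _ _)) (mb a a0)).
pose r (u : V) := kappa p q m * prodx a0 Z u * prody a0 Z u.
have mk := @meromorphic_cst R V (kappa p q m).
have mr : meromorphic r.
  exact: (meromorphic_mul (meromorphic_mul mk (mpx _ _)) (mpy _ _)).
transitivity (mer (fun u => \sum_(a in Z) L a u)).
  rewrite (mer_sum _ _ mL); apply: eq_bigr => a aZ.
  rewrite sxE syE -(merM (mpy _ _) (mpx _ _)).
  by rewrite -(merM (meromorphic_mul (mpy _ _) (mpx _ _)) (mb a a0)).
transitivity (mer r); last first.
  rewrite sxE syE /kappamer -mer_cst -(merM mk (mpx _ _)).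
  by rewrite -(merM (meromorphic_mul mk (mpx _ _)) (mpy _ _)).
apply: mer_eq => //; first exact: meromorphic_sum.
(* Where [f] is nonzero, all denominators [[zeta_ij]] are nonzero at once. *)
pose f (u : V) := \prod_(s : 'I_n * 'I_n | s.1 != s.2) br (zpair u s.1 s.2).
have ef : entire f by apply: entire_prod => s _; exact: E_zpair_entire.
have nf : generic_neq0 f.
  by apply: generic_neq0_prod => s s12; [exact: E_zpair_entire | exact: E_zpair_generic].
have [oD dD] := generic_neq0_dense ef nf.
exists [set y | f (r2v y) != 0]; split=> // y /=; move: (r2v y) => u fu {y}.
have bru a c : a != c -> br (zpair u a c) != 0.
  move=> ac; apply: contraNneq fu => b0.
  by rewrite /f (bigD1 (a, c)) //= b0 mul0r.
have zE a b : zpair u a a0 - zpair u b a0 = zpair u a b.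
  by rewrite -(zpair_chain u a b a0) addrK.
have := bracket_sum (E0 p01 q01 pq_generic) (EN p01 q01 pq_generic) (E_three_term q p01)
  (E_nat_neq0 p01 q01 pq_generic) (x := fun j => zpair u j a0) (Z := Z) (x0 := 0).
move=> /(_ _ _)/wrap[].
- by move=> a b _ _ ab; rewrite zE; exact: bru.
- by move=> a aZ; rewrite subr0; apply: bru; apply: contraNneq a0Z => <-.
rewrite -/m => BS.
pose h s := br (s + 1) / br (- s).
have hE a (J : {set _}) : a \notin J -> prody a J u * prodx a J u = \prod_(j in J) h (zpair u j a).
  move=> aJ; rewrite /prody /prodx -big_split; apply: eq_bigr => j jJ /=.
  rewrite /yval /xval; case: eqP => [ja|_]; first by rewrite -ja jJ in aJ.
  by rewrite /h (zpairN u j a) mulrC.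
have c0 := E_1subn_neq0 p01 q01 pq_generic Z1; rewrite -/m in c0.
rewrite /r -mulrA [prodx _ _ _ * _]mulrC hE // /kappa (EN p01 q01 pq_generic).
apply: (mulfI c0).
have -> : br (1 - m%:R) * (- br m%:R / br (1 - m%:R) * \prod_(j in Z) h (zpair u j a0)) =
   - br m%:R * \prod_(j in Z) h (zpair u j a0 - 0).
  rewrite mulrA [- _ / _]mulrC [X in X * _]mulrA mulfV // mul1r; congr (_ * _).
  by apply: eq_bigr => j _; rewrite subr0.
rewrite -BS mulr_sumr; apply: eq_bigr => a aZ.
have aa0 : a != a0 by apply: contraNneq a0Z => <-.
have PE : \prod_(j in Z :\ a) h (zpair u j a) =
    \prod_(j in Z :\ a) (br (zpair u j a0 - zpair u a a0 + 1) / br (- (zpair u j a0 - zpair u a a0))).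
  by apply: eq_bigr => j _; rewrite zE.
rewrite /L hE ?setD11 // betavalE subr0 /yval PE; move: (bru _ _ aa0) c0.
move: (br (1 - m%:R)) (\prod_(j in Z :\ a) _) (br 1) (br (zpair u a a0 + m%:R)) (br (zpair u a a0)).
by move=> c P b1 bm b0 b00 c0; field; rewrite c0 b00.
Qed.

End BetaSum.

Section AbstractRelations.
Variables (K : comNzRingType) (A : nzRingType) (l r : {rmorphism K -> A}).

(** Both products are multiples of the same symmetric element [v * u' + u * v'], and with the
    factors [X'] and [X] the two multiples cancel. *)
Lemma row_cancel (t X X' Y : K) (u u' v v' : A) :
  u' * v = r (t * X * Y) * v * u' + r (t * X * Y) * u * v' ->
  v' * u = r (t * X' * - Y) * u * v' + r (t * X' * - Y) * v * u' ->
  r X' * u' * v + r X * v' * u = 0.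
Proof.
move=> E1 E2; rewrite -mulrA E1 -[r X * _ * _]mulrA E2 -!mulrA -!mulrDr !mulrA -!rmorphM.
rewrite [u * v' + _]addrC -mulrDl -rmorphD (_ : _ + _ = 0) ?rmorph0 ?mul0r //; ring.
Qed.

Lemma exchange_cancel (t t' Xl Yl Y X X' : K) (a b a' b' c d c' d' : A) :
  t * t' = 1 -> l t = r t ->
  l (t * Xl * - Yl) * (a * b' - c * d') = r (t * X * Y) * a' * b - r (t * X' * - Y) * c' * d ->
  l (Xl * Yl) * (c * d' - a * b') = r Y * (r X' * c' * d + r X * a' * b).
Proof.
move=> tt lt h; have rt : r t' * r t = 1 by rewrite -rmorphM mulrC tt rmorph1.
have -> : l (Xl * Yl) * (c * d' - a * b') = r t' * (l (t * Xl * - Yl) * (a * b' - c * d')).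
  have -> : l (t * Xl * - Yl) = - (r t * l (Xl * Yl)) by rewrite -lt -rmorphM mulrN rmorphN mulrA.
  by rewrite mulNr -mulrN opprB mulrA [r t' * _]mulrA rt mul1r.
rewrite h mulrBr mulrDr !mulrA -!rmorphM addrC -!mulNr -rmorphN.
have -> : - (t' * (t * X' * - Y)) = Y * X' by rewrite -[RHS]mul1r -tt; ring.
by have -> : t' * (t * X * Y) = Y * X by rewrite -[RHS]mul1r -tt; ring.
Qed.

End AbstractRelations.

Section Relations.
Variables (R : realType) (n : nat) (p q : R).
Local Notation C := R[i].
Local Notation V := (hdual R n).
Local Notation K := (mero V).
Local Notation A := (fell n p q).
Local Notation br := (E p q).
Local Notation l := (@lmap R n p q).
Local Notation r := (@rmap R n p q).
Local Notation e := (@egen R n p q).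
Local Notation x := (@xmer R n p q).
Local Notation y := (@ymer R n p q).
Hypothesis p01 : 0 < p < 1.
Hypothesis q01 : 0 < q < 1.
Hypothesis pq_generic : forall a b : int, p ^ a * q ^ b = 1 -> a = 0 /\ b = 0.

Let Q0 : q%:C != 0 :> C.
Proof. by rewrite -modulus_gt0 modulus_real normr_gt0; case/andP: q01 => /lt0r_neq0. Qed.

Let P0 : p%:C != 0 :> C.
Proof. by rewrite -modulus_gt0 modulus_real normr_gt0; case/andP: p01 => /lt0r_neq0. Qed.

(** Genericity of [p] and [q]: a power of [q] lies in the excluded set only if it is [q^(-2)]. *)
Lemma regular_ratio_exp (s : int) (z1 z2 : C) : z1 / z2 = q%:C ^ s -> s != - 2 ->
  regular_ratio p q z1 z2.
Proof.
move=> zs s2 k; apply/eqP; rewrite zs => qs.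
have ks : (k != 0) || (- 2 - s != 0) by rewrite subr_eq0 [- 2 == s]eq_sym s2 orbT.
have := pq_neq pq_generic ks; rewrite expfzDr // mulrA -qs -expfzDr // subrr.
by rewrite expr0z eqxx.
Qed.

Lemma square_ratio (z : C) : z != 0 -> q%:C ^+ 2 * z / z = q%:C ^+ 2.
Proof. by move=> z0; rewrite mulfK. Qed.

Lemma square_regular (z : C) : z != 0 -> regular_ratio p q (q%:C ^+ 2 * z) z.
Proof. by move=> z0; apply: (@regular_ratio_exp 2); rewrite ?square_ratio. Qed.

Lemma square_scale_neq0 (z : C) : z != 0 -> q%:C ^+ 2 * z != 0.
Proof. by move=> z0; rewrite mulf_neq0 ?expf_neq0. Qed.

Local Notation t2 := (mcst V (two_ratio p q)).
Local Opaque alpha beta.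

Lemma alpha2_lam a c : a != c -> \pi_A (alpha_lam p q a c (q%:C ^+ 2)) = l (t2 * x a c * y a c).
Proof. by move=> ac; congr (l _); exact: alpha2_mer. Qed.

Lemma beta2_lam a c : a != c -> \pi_A (beta_lam p q a c (q%:C ^+ 2)) = l (t2 * x c a * y c a).
Proof. by move=> ac; congr (l _); exact: beta2_mer. Qed.

Lemma alpha2_rho a c : a != c -> \pi_A (alpha_rho p q a c (q%:C ^+ 2)) = r (t2 * x a c * y a c).
Proof. by move=> ac; congr (r _); exact: alpha2_mer. Qed.

Lemma beta2_rho a c : a != c -> \pi_A (beta_rho p q a c (q%:C ^+ 2)) = r (t2 * x c a * y c a).
Proof. by move=> ac; congr (r _); exact: beta2_mer. Qed.

(** By [beta2_mer], the left side of relation (3) at ratio [q^2] is symmetric in [a] and [c], hence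
    so is the right side. *)
Lemma egen_column a c b z : z != 0 -> a != c ->
  e a b z * e c b (q%:C ^+ 2 * z) - e c b z * e a b (q%:C ^+ 2 * z) = 0.
Proof.
move=> z0 ac.
have rel a' c' : a' != c' -> l (t2 * x a' c' * y a' c') * e a' b (q%:C ^+ 2 * z) * e c' b z +
     l (t2 * x c' a' * y c' a') * e c' b (q%:C ^+ 2 * z) * e a' b z =
     e c' b z * e a' b (q%:C ^+ 2 * z).
  move=> ac'.
  have := fell_pi_rel (rel3 b (square_scale_neq0 z0) z0 ac' (square_regular z0)).
  rewrite !(fell_piD, fell_piM) square_ratio //.
  by rewrite (alpha2_lam ac') (beta2_lam ac') => h; exact: h.
have ca : c != a by rewrite eq_sym.
by rewrite -(rel a c ac) -(rel c a ca) [X in _ - X]addrC subrr.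
Qed.

Lemma egen_row a b d z : z != 0 -> b != d ->
  r (x d b) * e a b (q%:C ^+ 2 * z) * e a d z
  + r (x b d) * e a d (q%:C ^+ 2 * z) * e a b z = 0.
Proof.
move=> z0 bd.
have rel b' d' : b' != d' -> e a b' (q%:C ^+ 2 * z) * e a d' z =
   r (t2 * x b' d' * y b' d') * e a d' z * e a b' (q%:C ^+ 2 * z)
   + r (t2 * x b' d' * y b' d') * e a b' z * e a d' (q%:C ^+ 2 * z).
  move=> bd'; have db' : d' != b' by rewrite eq_sym.
  have := fell_pi_rel (rel2 a (square_scale_neq0 z0) z0 bd' (square_regular z0)).
  rewrite !(fell_piD, fell_piM) square_ratio //.
  by rewrite (alpha2_rho bd') (beta2_rho db') => h; exact: h.
have db : d != b by rewrite eq_sym.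
have := rel d b db; rewrite (ymerN p01 q01 pq_generic b d) => rdb.
exact: row_cancel (rel b d bd) rdb.
Qed.

(** Relation (5) with [k = 0] and the rows in the order [c], [a]; the constant [two_ratio], common
    to all coefficients, is cancelled. *)
Lemma egen_exchange2 a c b d z : z != 0 -> a != c -> b != d ->
  l (x c a * y a c) * (e a b z * e c d (q%:C ^+ 2 * z) - e c b z * e a d (q%:C ^+ 2 * z))
  = r (y b d) * (r (x d b) * e a b (q%:C ^+ 2 * z) * e c d z
                 + r (x b d) * e a d (q%:C ^+ 2 * z) * e c b z).
Proof.
move=> z0 ac bd.
have ca : c != a by rewrite eq_sym.
have qpow1' (f : V -> C) : mer (fun u => qpow q (2 * (0 : int)%:~R * f u)) = 1.
  transitivity (mer (fun=> 1 : C) : K); last exact: mer_cst.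
  congr mer; apply/funext => u.
  by rewrite mulr0 mul0r qpow0.
have [t tV] := two_ratioV n p01 q01 pq_generic.
have lt : l t2 = r t2 by rewrite lmap_cst rmap_cst.
have rel : l (t2 * x c a * y c a) *
     (e c b z * e a d (q%:C ^+ 2 * z) - e a b z * e c d (q%:C ^+ 2 * z)) =
   r (t2 * x b d * y b d) * e a d (q%:C ^+ 2 * z) * e c b z
   - r (t2 * x d b * y d b) * e a b (q%:C ^+ 2 * z) * e c d z.
  have := fell_pi_rel (rel5 p q 0 z0 ca bd).
  rewrite !(fell_piB, fell_piM) expr0z mul1r.
  rewrite (alpha2_lam ca) (alpha2_rho bd) (beta2_rho bd).
  rewrite -[\pi_A (Xlam (mer _))]/(l _) -[\pi_A (Xrho (mer _))]/(r _) !qpow1'.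
  by rewrite [l 1]rmorph1 [r 1]rmorph1 !mul1r => h; exact: h.
rewrite (ymerN p01 q01 pq_generic a c) (ymerN p01 q01 pq_generic b d) in rel.
exact: exchange_cancel tV lt rel.
Qed.

Lemma egen_exchange a c b d z m : (1 < m)%N -> z != 0 -> a != c -> b != d ->
  l (kappamer n p q m * x a c * y a c) * e a b z * e c d (q%:C ^+ (2 * m) * z)
    + l (betamer p q m a c) * e c b z * e a d (q%:C ^+ (2 * m) * z)
  = r (kappamer n p q m * x b d * y b d) * e c d (q%:C ^+ (2 * m) * z) * e a b z
    + r (betamer p q m d b) * e c b (q%:C ^+ (2 * m) * z) * e a d z.
Proof.
move=> m1 z0 ac bd; set w := q%:C ^+ (2 * m) * z.
have qm0 : q%:C ^+ (2 * m) != 0 :> C by rewrite expf_neq0.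
have w0 : w != 0 by rewrite mulf_neq0.
have zw : z / w = q%:C ^- (2 * m) by rewrite /w invfM mulrCA mulfV // mulr1.
have reg : regular_ratio p q z w.
  apply: (@regular_ratio_exp (- (2 * m)%N%:Z)); first by rewrite zw exprnN.
  by rewrite eqr_opp -[2]/(2 * 1)%N%:Z eqz_nat eqn_pmul2l // gtn_eqF.
have := fell_pi_rel (rel4 z0 w0 ac bd reg).
rewrite !(fell_piD, fell_piM) zw.
have -> : \pi_A (alpha_lam p q a c (q%:C ^- (2 * m))) = l (kappamer n p q m * x a c * y a c).
  by congr (l _); exact: alpha_mer.
have -> : \pi_A (alpha_rho p q b d (q%:C ^- (2 * m))) = r (kappamer n p q m * x b d * y b d).
  by congr (r _); exact: alpha_mer.
by move=> h; exact: h.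
Qed.

End Relations.

(** * The minors *)

Section MinorIdentities.
Variables (R : realType) (n : nat) (p q : R) (z : R[i]).
Local Notation C := R[i].
Local Notation V := (hdual R n).
Local Notation K := (mero V).
Local Notation A := (fell n p q).
Local Notation br := (E p q).
Local Notation l := (@lmap R n p q).
Local Notation r := (@rmap R n p q).
Local Notation x := (@xmer R n p q).
Local Notation y := (@ymer R n p q).
Hypothesis p01 : 0 < p < 1.
Hypothesis q01 : 0 < q < 1.
Hypothesis pq_generic : forall a b : int, p ^ a * q ^ b = 1 -> a = 0 /\ b = 0.
Hypothesis z0 : z != 0.

Let Q0 : q%:C != 0 :> C.
Proof. by rewrite -modulus_gt0 modulus_real normr_gt0; case/andP: q01 => /lt0r_neq0. Qed.

Definition point k : C := q%:C ^+ (2 * k) * z.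
Definition egenk a b k : A := egen p q a b (point k).
Definition minork I J k : A := minor p q I J (point k).
Definition supmer (I : {set 'I_n}) : K := mer (Fsup p q I).

Lemma point_neq0 k : point k != 0.
Proof. by rewrite mulf_neq0 ?expf_neq0. Qed.

Lemma pointD m k : q%:C ^+ (2 * m) * point k = point (k + m).
Proof. by rewrite /point mulrA -exprD -mulnDr addnC. Qed.

Lemma pointS k : q%:C ^+ 2 * point k = point k.+1.
Proof. by rewrite -[k.+1]addn1 -pointD. Qed.

Lemma point0 : point 0 = z.
Proof. by rewrite /point muln0 mul1r. Qed.

Lemma mer_Sl I J : mer (Sl p q I J : V -> C) = signum (fun i j => x j i) I J.
Proof.
have mx i j := xval_meromorphic (n := n) q p01 i j.
have mxp i : meromorphic (fun u => \prod_(j in J) xval p q j i u).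
  by apply: meromorphic_prod => j; exact: mx.
rewrite /signum (_ : Sl p q I J = fun u : V => \prod_(i in I) \prod_(j in J) xval p q j i u); last first.
  apply/funext => u; rewrite /Sl; case: ifP => [dIJ|/negbT].
    apply: eq_bigr => i iI; apply: eq_bigr => j jJ; rewrite /xval; case: eqP => // ji.
    by have := disjointFr dIJ iI; rewrite -ji jJ.
  rewrite -setI_eq0 => /set0Pn[j]; rewrite inE => /andP[jI jJ].
  apply/esym/(signum_meet (w := fun i j => xval p q j i u) _ jI jJ) => i.
  by rewrite /xval eqxx.
rewrite (mer_prod _ _ mxp); apply: eq_bigr => i _.
by rewrite (mer_prod _ _ (fun j => mx j i)).
Qed.

Lemma mer_Sr I J : mer (Sr p q I J : V -> C) = signum y I J.
Proof.
have my i j := yval_meromorphic (n := n) p01 q01 pq_generic i j.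
have myp i : meromorphic (fun u => \prod_(j in J) yval p q i j u).
  by apply: meromorphic_prod => j; exact: my.
rewrite /signum (_ : Sr p q I J = fun u : V => \prod_(i in I) \prod_(j in J) yval p q i j u); last first.
  apply/funext => u; rewrite /Sr; case: ifP => [//|/negbT].
  rewrite -setI_eq0 => /set0Pn[j]; rewrite inE => /andP[jI jJ].
  apply/esym/(signum_meet (w := fun i j => yval p q i j u) _ jI jJ) => i.
  exact: yvalxx.
rewrite (mer_prod _ _ myp); apply: eq_bigr => i _.
by rewrite (mer_prod _ _ (my i)).
Qed.

Lemma mer_FsupV I : mer (fun u : V => (Fsup p q I u)^-1) = pair_prod y I.
Proof.
have my i j := yval_meromorphic (n := n) p01 q01 pq_generic i j.
have myp (i : 'I_n) : meromorphic (fun u => \prod_(j in I | (i < j)%N) yval p q i j u).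
  by apply: meromorphic_prod => j; exact: my.
rewrite /pair_prod (_ : (fun u : V => _) =
    fun u => \prod_(i in I) \prod_(j in I | (i < j)%N) yval p q i j u); last first.
  apply/funext => u; rewrite /Fsup -prodfV; apply: eq_bigr => i _.
  by rewrite -prodfV.
rewrite (mer_prod _ _ myp); apply: eq_bigr => i _.
by rewrite (mer_prod _ _ (my i)).
Qed.

Lemma supmerV I : supmer I * pair_prod y I = 1.
Proof.
rewrite -mer_FsupV; have ef (i : 'I_n) : entire (fun u : V => \prod_(j in I | (i < j)%N) br (zpair u i j)).
  by apply: entire_prod => j _; exact: E_zpair_entire.
apply: mer_mulV; first by apply: entire_prod => i _; exact: ef.
apply: generic_neq0_prod => i _; first exact: ef.
apply: generic_neq0_prod => j; first by move=> _; exact: E_zpair_entire.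
by move=> /andP[_ ij]; apply: E_zpair_generic => //; rewrite neq_ltn ij.
Qed.

Lemma minork_card (I J : {set 'I_n}) k : #|I| != #|J| -> minork I J k = 0.
Proof. by rewrite /minork /minor; case: eqP. Qed.

Lemma minork_enum (I J : {set 'I_n}) (eqIJ : #|I| = #|J|) k :
  minork I J k = r (supmer J) * l (pair_prod y I) *
    \sum_(s : {perm 'I_n} | perm_on I s) (-1) ^+ s *
      \prod_(i < #|I|) egenk (s (enum_val i)) (enum_val (cast_ord eqIJ i)) (k + i).
Proof.
rewrite -mer_FsupV /minork /minor; case: eqP => // e; rewrite (eq_irrelevance e eqIJ).
congr (_ * _); apply: eq_bigr => s _; congr (_ * _); apply: eq_bigr => i _.
by rewrite pointD.
Qed.

(** The size is a variable [d] with an equation, so that [d] can be replaced by [#|I|]; the cast in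
    the definition of the minor is then absorbed into the parametrization [b']. *)
Lemma minork_alternant_in (I J : {set 'I_n}) d (a b : 'I_d -> 'I_n) k :
  #|I| = d -> I = [set a i | i : 'I_d] -> J = [set b i | i : 'I_d] ->
  increasing a -> increasing b ->
  minork I J k = r (supmer J) * l (pair_prod y I) * alternant egenk a b k.
Proof.
move=> cI; case: d / cI a b => a b IE JE ia ib.
have eqIJ : #|I| = #|J|.
  by rewrite [in RHS]JE card_imset ?card_ord //; exact: increasing_inj.
rewrite (minork_enum eqIJ) (sum_perm_on (increasing_inj ia) _ IE); congr (_ * _).
pose b' i := b (cast_ord (esym eqIJ) i).
have ib' : increasing b' by move=> i j ij; exact: ib.
have JE' : J = [set b' i | i : 'I_#|J|].
  apply/setP => t; rewrite {1}JE; apply/imsetP/imsetP => [[i _ ->]|[i _ ->]].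
    by exists (cast_ord eqIJ i) => //; rewrite /b' cast_ordK.
  by exists (cast_ord (esym eqIJ) i).
apply: eq_bigr => s _; rewrite odd_extend_perm; congr (_ * _); apply: eq_bigr => i _.
rewrite -(increasing_enum ia IE) extend_permE -(increasing_enum ib' JE').
by rewrite /b' cast_ordK.
Qed.

Lemma minork_alternant d (a b : 'I_d -> 'I_n) k : increasing a -> increasing b ->
  minork [set a i | i : 'I_d] [set b i | i : 'I_d] k =
  r (supmer [set b i | i : 'I_d]) * l (pair_prod y [set a i | i : 'I_d]) * alternant egenk a b k.
Proof.
move=> ia ib; apply: minork_alternant_in => //.
by rewrite card_imset ?card_ord //; exact: increasing_inj.
Qed.

Lemma minork00 k : minork finset.set0 finset.set0 k = 1.
Proof.
rewrite (minork_enum (erefl _)).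
have -> : pair_prod y finset.set0 = 1 by rewrite /pair_prod big_set0.
have -> : supmer finset.set0 = 1.
  by have := supmerV finset.set0; rewrite /pair_prod big_set0 mulr1.
rewrite !rmorph1 !mul1r (big_pred1 (1%g : {perm 'I_n})) => [|s].
  rewrite odd_perm1 expr0 mul1r big1 // => i.
  by have := ltn_ord i; rewrite {2}cards0.
apply/idP/eqP => [sI|->]; last exact: perm_on1.
by apply/permP => t; rewrite perm1 (out_perm sI) ?inE.
Qed.

Lemma minork_expand_first (I J : {set 'I_n}) (b : 'I_n) k : (forall j : 'I_n, j \in J -> (b < j)%N) ->
  r (signum y [set b] J) * minork I (b |: J) k =
  \sum_(a in I) l (signum y [set a] (I :\ a)) * egenk a b k * minork (I :\ a) J k.+1.
Proof.
apply: (D_expand_first (sh := @unshift R n) (Fp := supmer)).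
- exact: lrmapC.
- by move=> a c m f; exact: egen_lmap (point_neq0 m).
- by move=> a c m f; exact: egen_rmap (point_neq0 m).
- exact: ymerN.
- exact: unshift_ymer.
- exact: supmerV.
- exact: minork_card.
- exact: minork_alternant.
Qed.

Lemma egenk_column a c b k : a != c ->
  egenk a b k * egenk c b k.+1 - egenk c b k * egenk a b k.+1 = 0.
Proof. by move=> ac; rewrite /egenk -pointS; exact: egen_column (point_neq0 k) ac. Qed.

Lemma egenk_row a b d k : b != d ->
  r (x d b) * egenk a b k.+1 * egenk a d k + r (x b d) * egenk a d k.+1 * egenk a b k = 0.
Proof. by move=> bd; rewrite /egenk -pointS; exact: egen_row (point_neq0 k) bd. Qed.

Lemma egenk_exchange2 a c b d k : a != c -> b != d ->
  l (x c a * y a c) * (egenk a b k * egenk c d k.+1 - egenk c b k * egenk a d k.+1)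
  = r (y b d) * (r (x d b) * egenk a b k.+1 * egenk c d k + r (x b d) * egenk a d k.+1 * egenk c b k).
Proof.
by move=> ac bd; rewrite /egenk -pointS; exact: egen_exchange2 (point_neq0 k) ac bd.
Qed.

Lemma egenk_exchange a c b d k m : (1 < m)%N -> a != c -> b != d ->
  l (kappamer n p q m * x a c * y a c) * egenk a b k * egenk c d (k + m)
    + l (betamer p q m a c) * egenk c b k * egenk a d (k + m)
  = r (kappamer n p q m * x b d * y b d) * egenk c d (k + m) * egenk a b k
    + r (betamer p q m d b) * egenk c b (k + m) * egenk a d k.
Proof.
by move=> m1 ac bd; rewrite /egenk -pointD; exact: egen_exchange m1 (point_neq0 k) ac bd.
Qed.

Lemma lmap_kappamer m : l (kappamer n p q m) = r (kappamer n p q m).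
Proof. by rewrite lmap_cst rmap_cst. Qed.

Lemma minork_columns (J1 J2 I : {set 'I_n}) k :
  r (signum y J1 J2) * minork I (J1 :|: J2) k =
  \sum_(P : {set 'I_n} * {set 'I_n} | P.1 :|: P.2 == I)
    l (signum y P.1 P.2) * minork P.1 J1 k * minork P.2 J2 (k + #|J1|).
Proof.
apply: (laplace_columns (sh := @unshift R n) (e := egenk) (x := x)).
- exact: fell_double_eq0.
- exact: lrmapC.
- by move=> a c m f; exact: egen_lmap (point_neq0 m).
- by move=> a c m f; exact: egen_rmap (point_neq0 m).
- exact: ymer0.
- exact: xmerV.
- exact: ymerV.
- exact: ymerN.
- exact: unshift_ymer.
- exact: egenk_column.
- exact: egenk_exchange2.
- exact: minork00.
- exact: minork_card.
- exact: minork_expand_first.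
Qed.

Lemma minork_rows (I1 I2 J : {set 'I_n}) k :
  l (signum (fun i j => x j i) I1 I2) * minork (I1 :|: I2) J k =
  \sum_(P : {set 'I_n} * {set 'I_n} | P.1 :|: P.2 == J)
    r (signum (fun i j => x j i) P.1 P.2) * minork I1 P.1 (k + #|I2|) * minork I2 P.2 k.
Proof.
apply: (laplace_rows (sh := @unshift R n) (e := egenk) (y := y)
  (kappa := kappamer n p q) (beta := @betamer R n p q)).
- exact: fell_double_eq0.
- exact: lrmapC.
- by move=> a c m f; exact: egen_lmap (point_neq0 m).
- by move=> a c m f; exact: egen_rmap (point_neq0 m).
- exact: xmer0.
- exact: ymer0.
- exact: xmerV.
- exact: ymerV.
- exact: ymerN.
- exact: unshift_xmer.
- exact: unshift_ymer.
- exact: egenk_column.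
- exact: egenk_row.
- exact: egenk_exchange2.
- exact: kappamerV.
- exact: lmap_kappamer.
- exact: egenk_exchange.
- exact: mer_beta_sum.
- exact: minork00.
- exact: minork_card.
- exact: minork_expand_first.
Qed.

End MinorIdentities.

Theorem theorem6p11 (R : realType) (n : nat) (p q : R)
    (hn : (0 < n)%N) (hp : 0 < p < 1) (hq : 0 < q < 1)
    (hpq : forall a b : int, p ^ a * q ^ b = 1 -> a = 0 /\ b = 0)
    (z : R[i]) (hz : z != 0) :
  (forall I1 I2 J : {set 'I_n},
     lam p q (Sl p q I1 I2) * minor p q (I1 :|: I2) J z =
     \sum_(K : {set 'I_n} * {set 'I_n} | K.1 :|: K.2 == J)
        rho p q (Sl p q K.1 K.2) *
        minor p q I1 K.1 (q%:C ^+ (2 * #|I2|) * z) * minor p q I2 K.2 z) /\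
  (forall J1 J2 I : {set 'I_n},
     rho p q (Sr p q J1 J2) * minor p q I (J1 :|: J2) z =
     \sum_(K : {set 'I_n} * {set 'I_n} | K.1 :|: K.2 == I)
        lam p q (Sr p q K.1 K.2) *
        minor p q K.1 J1 z * minor p q K.2 J2 (q%:C ^+ (2 * #|J1|) * z)).
Proof.
split=> [I1 I2 J|J1 J2 I].
  have := minork_rows hp hq hpq hz I1 I2 J 0; rewrite /minork point0 -mer_Sl // => h.
  rewrite [LHS]h; apply: eq_bigr => K _.
  by rewrite -mer_Sl // /minork point0 add0n.
have := minork_columns hp hq hpq hz J1 J2 I 0; rewrite /minork point0 -mer_Sr // => h.
rewrite [LHS]h; apply: eq_bigr => K _.
by rewrite -mer_Sr // /minork point0 add0n.
Qed.
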